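(* Let $n\ge 1$ and let $Y_1,Y_2,\ldots,Y_k$ be a balanced set (with repetitions allowed) of oriented $(n-1)$-dimensional combinatorial spheres. Then there is an oriented $n$-dimensional combinatorial manifold $K$ whose set (with repetitions) of links of vertices coincides, up to orientation-preserving isomorphism, with the set $$\underbrace{Y_1,\ldots,Y_1}_{r},\underbrace{Y_2,\ldots,Y_2}_{r},\ldots,\underbrace{Y_k,\ldots,Y_k}_{r},Z_1,Z_2,\ldots,Z_l,-Z_1,-Z_2,\ldots,-Z_l$$ for some positive integer $r$ and some oriented $(n-1)$-dimensional combinatorial spheres $Z_1,Z_2,\ldots,Z_l$.
   Context: All simplicial complexes are finite. A combinatorial sphere is a simplicial complex piecewise-linearly homeomorphic to the boundary of a simplex. An $n$-dimensional combinatorial manifold is a simplicial complex such that the link of each of its vertices is an $(n-1)$-dimensional combinatorial sphere (all manifolds are closed; they need not be connected). An isomorphism of oriented complexes is an orientation-preserving simplicial map with simplicial inverse; an anti-isomorphism is an orientation-reversing one. $-Z$ is $Z$ with reversed orientation. The link of an oriented simplex $\sigma$ in an oriented complex is oriented so that $\sigma*\mathrm{link}\,\sigma$ (vertices of $\sigma$ first) has the given orientation; a vertex of a complex of positive dimension is taken with positive orientation. A set (with repetitions) $Y_1,\ldots,Y_k$ of oriented combinatorial spheres of the same dimension is balanced if the vertices of the disjoint union $Y_1\sqcup\cdots\sqcup Y_k$ can be paired off so that the links of the two vertices of each pair are anti-isomorphic. Convention in the degenerate dimension: an oriented $0$-sphere is a pair of points of opposite signs, the link of a signed point is the empty set with that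 sign, and empty sets of opposite signs are anti-isomorphic. *)

(* Defs.v *)
From mathcomp Require Import all_boot all_order all_algebra perm.
From mathcomp Require Import classical_sets functions reals.
(* Last, so that set0 and its theory are those of {set T}. *)
From mathcomp Require Import finset.

Set Implicit Arguments.
Unset Strict Implicit.
Unset Printing Implicit Defensive.

Import Order.TTheory GRing.Theory Num.Theory.

Local Open Scope ring_scope.

Section Complexes.
Variable V : finType.

(* The empty simplex always belongs to a complex.  An element of V is a vertex
   only if its singleton is a simplex. *)
Definition is_complex (K : {set {set V}}) : Prop :=
  set0 \in K /\ forall s t : {set V}, s \in K -> t \subset s -> t \in K.

Definition vertex (K : {set {set V}}) := {v : V | [set v] \in K}.

Definition link (K : {set {set V}}) (v : V) : {set {set V}} :=
  [set s : {set V} | (v \notin s) && (v |: s \in K)].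

(* s lists the vertices of a maximal simplex of K, in some order. *)
Definition orders_facet (K : {set {set V}}) (s : seq V) : bool :=
  uniq s && maxset (fun t : {set V} => t \in K) [set x in s].

End Complexes.

(* The boundary of an n-simplex: a complex of dimension n - 1, equal to
   [set set0] for n = 0. *)
Definition bd_simplex (n : nat) : {set {set 'I_n.+1}} :=
  [set s : {set _} | s \proper [set: 'I_n.+1]].

Section PiecewiseLinear.
Variable R : realType.

(* Points of the geometric realization, in barycentric coordinates. *)
Definition realization (V : finType) (K : {set {set V}}) : set {ffun V -> R} :=
  [set x | [/\ forall v, 0 <= x v, \sum_v x v = 1
             & [set v | x v != 0]%SET \in K]]%classic.

Definition combination (U V : finType) (a : U -> {ffun V -> R})
    (x : {ffun U -> R}) : {ffun V -> R} :=
  [ffun v => \sum_u x u * a u v].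

(* The complex M, with its vertices placed at the points a u of the realization
   of K, is a simplicial subdivision of K. *)
Definition subdivision (U V : finType) (K : {set {set V}}) (M : {set {set U}})
    (a : U -> {ffun V -> R}) : Prop :=
  [/\ is_complex M,
      forall s, s \in M -> exists2 t, t \in K &
        forall u v, u \in s -> a u v != 0 -> v \in t
    & set_bij (realization M) (realization K) (combination a)].

(* Continuity is automatic: f is affine on each of finitely many closed
   simplices covering the realization of K. *)
Definition pl_map (V W : finType) (K : {set {set V}}) (L : {set {set W}})
    (f : {ffun V -> R} -> {ffun W -> R}) : Prop :=
  set_fun (realization K) (realization L) f /\
  exists (U : finType) (M : {set {set U}}) (a : U -> {ffun V -> R}),
    subdivision K M a /\
    forall x, realization M x -> f (combination a x) = combination (f \o a) x.

Definition pl_homeomorphic (V W : finType)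
    (K : {set {set V}}) (L : {set {set W}}) : Prop :=
  exists (f : {ffun V -> R} -> {ffun W -> R})
         (g : {ffun W -> R} -> {ffun V -> R}),
    [/\ pl_map K L f, pl_map L K g,
        forall x, realization K x -> g (f x) = x
      & forall y, realization L y -> f (g y) = y].

(* Combinatorial spheres of dimension n - 1, so that n = 0 is meaningful. *)
Definition comb_sphere_pred (n : nat) (V : finType) (K : {set {set V}}) : Prop :=
  is_complex K /\ pl_homeomorphic K (bd_simplex n).

(* Combinatorial manifolds of dimension n. *)
Definition comb_manifold (n : nat) (V : finType) (K : {set {set V}}) : Prop :=
  is_complex K /\ forall v : vertex K, comb_sphere_pred n (link K (val v)).

End PiecewiseLinear.

(* [positive X s] says whether the ordering s of a facet is positively oriented;
   its values on other sequences are irrelevant.  A positive (resp. negative)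
   point v has [positive X [:: v]] true (resp. false), and the sign of the
   empty simplex is [positive X [::]]. *)
Record ocomplex := OComplex {
  carrier : finType;
  faces : {set {set carrier}};
  positive : seq carrier -> bool }.
Arguments positive : clear implicits.

(* Odd permutations reverse the orientation of a facet, and two distinct facets
   sharing a codimension one face induce opposite orientations on it.  In
   dimension 0 the second condition says that distinct points have opposite
   signs. *)
Definition coherent (X : ocomplex) : Prop :=
  (forall (m : nat) (t : m.-tuple (carrier X)) (p : 'S_m),
     orders_facet (faces X) t ->
     positive X [tuple tnth t (p i) | i < m] = odd_perm p (+) positive X t) /\
  (forall (v w : carrier X) (s : seq (carrier X)), v != w ->
     orders_facet (faces X) (v :: s) -> orders_facet (faces X) (w :: s) ->
     positive X (v :: s) = ~~ positive X (w :: s)).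

(* Oriented combinatorial spheres of dimension n - 1. *)
Definition oriented_sphere_pred (R : realType) (n : nat) (X : ocomplex) : Prop :=
  comb_sphere_pred R n (faces X) /\ coherent X.

(* Oriented combinatorial manifolds of dimension n. *)
Definition oriented_manifold (R : realType) (n : nat) (X : ocomplex) : Prop :=
  comb_manifold R n (faces X) /\ coherent X.

Definition olink (X : ocomplex) (v : carrier X) : ocomplex :=
  OComplex (link (faces X) v) (fun s => positive X (v :: s)).

Definition oopp (X : ocomplex) : ocomplex :=
  OComplex (faces X) (fun s => ~~ positive X s).

Definition overtex (X : ocomplex) := vertex (faces X).

Definition vertex_link (X : ocomplex) (v : overtex X) : ocomplex :=
  olink (val v).

Definition simplicial (X Y : ocomplex) (f : overtex X -> overtex Y) : Prop :=
  forall s : {set overtex X},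
    val @: s \in faces X -> val @: (f @: s) \in faces Y.

(* b = false: isomorphism; b = true: anti-isomorphism. *)
Definition oiso_sign (b : bool) (X Y : ocomplex) : Prop :=
  exists (f : overtex X -> overtex Y) (g : overtex Y -> overtex X),
    [/\ simplicial f, simplicial g, cancel f g, cancel g f
      & forall s : seq (overtex X), orders_facet (faces X) (map val s) ->
          positive Y (map val (map f s)) = b (+) positive X (map val s)].

Definition isomorphic := oiso_sign false.
Definition anti_isomorphic := oiso_sign true.

(* The vertices of the disjoint union of the Y i, and their links. *)
Definition union_vertex (k : nat) (Y : 'I_k -> ocomplex) :=
  {i : 'I_k & overtex (Y i)}.

Definition union_link (k : nat) (Y : 'I_k -> ocomplex) (x : union_vertex Y)
    : ocomplex :=
  let: existT _ v := x in vertex_link v.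

Definition balanced (k : nat) (Y : 'I_k -> ocomplex) : Prop :=
  exists tau : union_vertex Y -> union_vertex Y,
    [/\ involutive tau, forall x, tau x <> x
      & forall x, anti_isomorphic (union_link x) (union_link (tau x))].

(* The sets with repetitions (X i)_i and (X' j)_j coincide up to
   orientation-preserving isomorphism. *)
Definition same_up_to_iso (I J : Type) (X : I -> ocomplex) (X' : J -> ocomplex)
    : Prop :=
  exists2 f : I -> J, bijective f & forall i, isomorphic (X i) (X' (f i)).

(* Each Y i repeated r times, together with all Z j and all - Z j. *)
Definition repeat_with_pairs (k r l : nat) (Y : 'I_k -> ocomplex)
    (Z : 'I_l -> ocomplex) (x : 'I_k * 'I_r + ('I_l + 'I_l)) : ocomplex :=
  match x with
  | inl (i, _) => Y i
  | inr (inl j) => Z j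
  | inr (inr j) => oopp (Z j)
  end.

(* Main.v *)
(** A combinatorial (n-1)-sphere is a complex whose cone is PL isomorphic, by a
    positively homogeneous map, to R^n; differentiating such maps shows that the
    links of the vertices of a PL manifold are spheres for any triangulation.

    Colour the vertices of the Y_i by the vertices of their disjoint union, in
    all possible ways. The balancing provides, for each nonempty set w of
    colours, an involution of the coloured spheres which preserves the faces
    containing w and reverses their orientations. A chamber consists of a
    coloured sphere, a family of such involutions, and a bit for every w.
    Crossing the wall w applies the involution of w to the sphere, conjugates
    by it the involutions of the walls containing w, and flips the bit of w, so
    crossings of comparable walls commute. Each chamber is realized as a cone
    over its sphere with a collar, and 2^m chambers meet at the vertex of a
    chain of m walls. Replacing every chamber by the barycentric subdivision of
    a cubical cell gives a PL homeomorphic complex in which the link of such a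
    vertex unfolds onto a link in the barycentric subdivision of a sphere: the
    glued complex is a manifold. The links of the centres of the chambers are
    the Y_i, each the same number of times. At any other vertex, crossing a wall
    w of its chain (or w = {c} at the vertex c of a sphere) induces an
    anti-isomorphism with the link of another vertex, which pairs off the
    remaining links. *)

Require Import Defs.
From mathcomp Require Import all_boot all_order all_algebra perm.
From mathcomp Require Import classical_sets functions reals boolp.
From mathcomp Require Import fintype finset lra.

Set Implicit Arguments.
Unset Strict Implicit.
Unset Printing Implicit Defensive.
Import Order.TTheory GRing.Theory Num.Theory.
Local Open Scope ring_scope.

(** * Piecewise linear cones *)

(** Working with cones instead of spheres turns the topology of polyhedra into linear algebra: near
    a point a homogeneous piecewise linear map equals its first-order expansion exactly, so
    derivatives need no limits, and the cone over a link is a tangent cone with one line divided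
    out.

    Two triangulations of the glued space are needed. In the cubical one the chambers around a
    vertex are told apart by the signs of coordinates, but the link of a centre is only a second
    barycentric subdivision of some [Y i]. The collar restores [Y i] itself and agrees with the
    cubical cell on everything that two chambers share.

    The obstacle in the gluing is that involutions chosen independently for two walls have no reason
    to commute, while a vertex on a chain of m walls must see 2^m chambers. This is why the
    involutions belong to the chamber and change when a wall is crossed. Taking all colourings, all
    admissible families and all sets of bits keeps the chambers closed under crossing and gives
    every [Y i] the same number of them. *)

Section PLCones.
Variable R : realType.
Local Notation vec V := {ffun V -> R}.

Section Vectors.
Variables U V W : finType.

Definition dot (h x : vec V) : R := \sum_v h v * x v.
Definition scale (c : R) (x : vec V) : vec V := [ffun v => c * x v].
Definition unitv (v : V) : vec V := [ffun w => (w == v)%:R].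
Definition supp (x : vec V) : {set V} := [set v | x v != 0].

Lemma dotD h x y : dot h (x + y) = dot h x + dot h y.
Proof. by rewrite /dot -big_split; apply: eq_bigr => v _; rewrite ffunE mulrDr. Qed.
Lemma dotZ h c x : dot h (scale c x) = c * dot h x.
Proof. by rewrite /dot mulr_sumr; apply: eq_bigr => v _; rewrite ffunE mulrCA. Qed.
Lemma dot0 h : dot h 0 = 0.
Proof. by rewrite /dot big1 // => v _; rewrite ffunE mulr0. Qed.
Lemma dot_unit v x : dot (unitv v) x = x v.
Proof.
rewrite /dot (bigD1 v) //= ffunE eqxx mul1r big1 ?addr0 // => w /negPf wv.
by rewrite ffunE wv mul0r.
Qed.

Lemma scaleD c x y : scale c (x + y) = scale c x + scale c y.
Proof. by apply/ffunP => v; rewrite !ffunE mulrDr. Qed.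
Lemma scaleDl c d x : scale (c + d) x = scale c x + scale d x.
Proof. by apply/ffunP => v; rewrite !ffunE mulrDl. Qed.
Lemma scaleA c d x : scale c (scale d x) = scale (c * d) x.
Proof. by apply/ffunP => v; rewrite !ffunE mulrA. Qed.
Lemma scale1 x : scale 1 x = x.
Proof. by apply/ffunP => v; rewrite !ffunE mul1r. Qed.
Lemma scale0 x : scale 0 x = 0.
Proof. by apply/ffunP => v; rewrite !ffunE mul0r. Qed.
Lemma scaleN1 x : scale (-1) x = - x.
Proof. by apply/ffunP => v; rewrite !ffunE mulN1r. Qed.

End Vectors.

Section Combination.
Variables U V W : finType.
Implicit Types (a : U -> vec V).

Lemma combD a (x y : vec U) : combination a (x + y) = combination a x + combination a y.
Proof.
apply/ffunP => v; rewrite !ffunE -big_split; apply: eq_bigr => u _.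
by rewrite !ffunE mulrDl.
Qed.
Lemma combZ a c (x : vec U) : combination a (scale c x) = scale c (combination a x).
Proof.
apply/ffunP => v; rewrite !ffunE mulr_sumr; apply: eq_bigr => u _.
by rewrite !ffunE mulrA.
Qed.
Lemma combN a (x : vec U) : combination a (- x) = - combination a x.
Proof. by rewrite -!scaleN1 combZ. Qed.
Lemma combB a (x y : vec U) : combination a (x - y) = combination a x - combination a y.
Proof. by rewrite combD combN. Qed.
Lemma comb0 a : combination a 0 = 0.
Proof. by rewrite -(scale0 (0 : vec U)) combZ scale0. Qed.
Lemma comb_unit a u : combination a (unitv u) = a u.
Proof.
apply/ffunP => v; rewrite ffunE (bigD1 u) //= ffunE eqxx mul1r.
by rewrite big1 ?addr0 // => w /negPf wv; rewrite ffunE wv mul0r.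
Qed.
Lemma eq_comb a b (x : vec U) : (forall u, x u != 0 -> a u = b u) ->
  combination a x = combination b x.
Proof.
move=> ab; apply/ffunP => v; rewrite !ffunE; apply: eq_bigr => u _.
by have [->|/ab->//] := eqVneq (x u) 0; rewrite !mul0r.
Qed.
Lemma comb_comb a (b : V -> vec W) (x : vec U) :
  combination b (combination a x) = combination (fun u => combination b (a u)) x.
Proof.
apply/ffunP => w; rewrite !ffunE.
under eq_bigr do rewrite ffunE mulr_suml.
rewrite exchange_big; apply: eq_bigr => u _; rewrite ffunE mulr_sumr.
by apply: eq_bigr => v _; rewrite mulrA.
Qed.
Lemma dot_comb a h (x : vec U) :
  dot h (combination a x) = dot [ffun u => dot h (a u)] x.
Proof.
rewrite /dot; under eq_bigr do rewrite ffunE mulr_sumr.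
rewrite exchange_big; apply: eq_bigr => u _; rewrite ffunE mulr_suml.
by apply: eq_bigr => v _; rewrite mulrCA mulrC -mulrA mulrC.
Qed.
Lemma comb_delta (x : vec U) : combination (@unitv U) x = x.
Proof.
apply/ffunP => v; rewrite ffunE (bigD1 v) //= ffunE eqxx mulr1.
by rewrite big1 ?addr0 // => w /negPf wv; rewrite ffunE eq_sym wv mulr0.
Qed.
Lemma comb_ge0 a (x : vec U) v : (forall u, 0 <= x u) -> (forall u, x u != 0 -> 0 <= a u v) ->
  0 <= combination a x v.
Proof.
move=> x0 a0; rewrite ffunE; apply: sumr_ge0 => u _.
by have [->|/a0] := eqVneq (x u) 0; [rewrite mul0r | exact: mulr_ge0].
Qed.

(** The pseudo-inverse of the matrix of [a]. With it, [z] lies in the span of the vectors [a u] iff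
    it satisfies the linear equations a L z = z, and L z is then a choice of coefficients;
    [comb_inverse] uses both facts. *)
Lemma generalized_inverse a : exists L : {ffun V -> vec U},
  forall y, combination a (combination L (combination a y)) = combination a y.
Proof.
pose rv (T : finType) (x : vec T) : 'rV[R]_#|T| := \row_i x (enum_val i).
pose mx (S T : finType) (b : S -> vec T) : 'M[R]_(#|S|, #|T|) :=
  \matrix_(i, j) b (enum_val i) (enum_val j).
have rvM (S T : finType) (b : S -> vec T) x : rv T (combination b x) = rv S x *m mx _ _ b.
  apply/rowP => j; rewrite !mxE ffunE (big_enum_val (fun u => x u * b u _)).
  by apply: eq_bigr => i _; rewrite !mxE.
have rvI (T : finType) : injective (rv T).
  move=> x y /rowP xy; apply/ffunP => t.
  by have := xy (enum_rank t); rewrite !mxE enum_rankK.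
pose L : {ffun V -> vec U} :=
  [ffun v => [ffun u => pinvmx (mx _ _ a) (enum_rank v) (enum_rank u)]].
exists L => y.
have mxL : mx _ _ L = pinvmx (mx _ _ a).
  by apply/matrixP => i j; rewrite [LHS]mxE /L !ffunE !enum_valK.
apply: rvI; rewrite !rvM mxL.
by rewrite mulmxKpV ?submxMl.
Qed.

End Combination.

Section Piecewise.
Variables U V W : finType.

(** Closure under addition is the only convexity that [pl] asks of its test sets, so piecewise
    linearity can be stated and composed without choosing a subdivision. *)
Definition additive_set (C : vec V -> Prop) : Prop :=
  forall x y, C x -> C y -> C (x + y).

Definition signed (hs : seq (vec V)) (C : vec V -> Prop) : Prop :=
  forall h, h \in hs ->
    (forall x, C x -> 0 <= dot h x) \/ (forall x, C x -> dot h x <= 0).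

(* Positively homogeneous piecewise linear maps: f is linear wherever finitely
   many linear functionals do not change sign. *)
Definition pl (P : vec V -> Prop) (f : vec V -> vec W) : Prop :=
  exists (hs : seq (vec V)) (As : seq {ffun V -> vec W}),
    forall C : vec V -> Prop, (forall x, C x -> P x) -> additive_set C ->
      signed hs C ->
      exists2 A, A \in As & forall x, C x -> f x = combination A x.

(** [x0] is the analogue of a relative interior point. A sum of two numbers of the same sign
    vanishes only if both do, so adding a point where [h] does not vanish never spoils the
    functionals treated before. *)
Lemma generic_point (hs : seq (vec V)) (C : vec V -> Prop) z :
  C z -> additive_set C -> signed hs C ->
  exists2 x0, C x0 & forall h x, h \in hs -> dot h x0 = 0 -> C x -> dot h x = 0.
Proof.
move=> Cz Cadd; elim: hs => [|h hs IH] sg; first by exists z.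
have [|x0 Cx0 x0P] := IH; first by move=> k kin; apply: sg; rewrite inE kin orbT.
have [[x [Cx [hx0 hx]]]|no] := pselect (exists x, C x /\ dot h x0 = 0 /\ dot h x <> 0).
  exists (x0 + x); first exact: Cadd.
  move=> k y; rewrite inE => /orP[/eqP->|kin] k0 Cy.
    by case: hx; move: k0; rewrite dotD hx0 add0r.
  apply: (x0P _ _ kin) => //; move: k0; rewrite dotD.
  by have [] := sg k; rewrite ?inE ?kin ?orbT // => s;
     have := s _ Cx; have := s _ Cx0; lra.
exists x0 => // k y; rewrite inE => /orP[/eqP->|kin] k0 Cy; last exact: x0P k0 Cy.
by apply: contrapT => ky; apply: no; exists y.
Qed.

End Piecewise.

Section PiecewiseTheory.
Variables U V W : finType.

Lemma signed_sub (hs hs' : seq (vec V)) (C : vec V -> Prop) :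
  {subset hs' <= hs} -> signed hs C -> signed hs' C.
Proof. by move=> sub sg h /sub /sg. Qed.

Lemma pl_sub (P Q : vec V -> Prop) (f : vec V -> vec W) :
  (forall x, P x -> Q x) -> pl Q f -> pl P f.
Proof.
by move=> PQ [hs [As H]]; exists hs, As => C CP; apply: H => x /CP /PQ.
Qed.

Lemma eq_pl (P : vec V -> Prop) (f g : vec V -> vec W) :
  (forall x, P x -> f x = g x) -> pl P f -> pl P g.
Proof.
move=> fg [hs [As H]]; exists hs, As => C CP Ca Cs.
by have [A Ain Af] := H C CP Ca Cs; exists A => // x Cx; rewrite -fg ?Af //; apply: CP.
Qed.

Lemma pl_comb (P : vec V -> Prop) (a : V -> vec W) : pl P (combination a).
Proof.
exists [::], [:: finfun a] => C CP Ca Cs; exists (finfun a); rewrite ?inE // => x Cx.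
by apply: eq_comb => u _; rewrite ffunE.
Qed.

Lemma pl_add (P : vec V -> Prop) (f g : vec V -> vec W) :
  pl P f -> pl P g -> pl P (fun x => f x + g x).
Proof.
move=> [hs [As H]] [hs' [As' H']].
exists (hs ++ hs'), [seq [ffun v => A v + B v] | A : {ffun V -> vec W} <- As, B : {ffun V -> vec W} <- As'] => C CP Ca Cs.
have [A Ain Af] : exists2 A, A \in As & forall x, C x -> f x = combination A x.
  by apply: H => //; apply: signed_sub Cs => h hin; rewrite mem_cat hin.
have [B Bin Bg] : exists2 A, A \in As' & forall x, C x -> g x = combination A x.
  by apply: H' => //; apply: signed_sub Cs => h hin; rewrite mem_cat hin orbT.
exists [ffun v => A v + B v]; first by apply/allpairsP; exists (A, B).
move=> x Cx; rewrite Af // Bg //; apply/ffunP => w; rewrite !ffunE -big_split.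
by apply: eq_bigr => v _; rewrite !ffunE mulrDr.
Qed.

End PiecewiseTheory.

(** The functionals of [g] are pulled back along every linear piece of [f]. A linear image of an
    additive set is additive, so [g] can be tested on it. *)
Lemma pl_comp (U V W : finType) (P : vec U -> Prop) (Q : vec V -> Prop)
    (f : vec U -> vec V) (g : vec V -> vec W) :
  (forall x, P x -> Q (f x)) -> pl P f -> pl Q g -> pl P (fun x => g (f x)).
Proof.
move=> PQ [hs [As H]] [hs' [As' H']].
exists (hs ++ [seq [ffun u => dot h (A u)] | h : vec V <- hs', A : {ffun U -> vec V} <- As]).
exists [seq [ffun u => combination B (A u)]
  | A : {ffun U -> vec V} <- As, B : {ffun V -> vec W} <- As'] => C CP Ca Cs.
have [A Ain Af] : exists2 A, A \in As & forall x, C x -> f x = combination A x.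
  by apply: H => //; apply: signed_sub Cs => h hin; rewrite mem_cat hin.
pose C' y := exists2 x, C x & y = combination A x.
have [B Bin Bg] : exists2 B, B \in As' & forall x, C' x -> g x = combination B x.
  apply: H'.
  - by move=> _ [x Cx ->]; rewrite -Af //; apply/PQ/CP.
  - by move=> _ _ [x Cx ->] [y Cy ->]; exists (x + y); rewrite ?combD //; apply: Ca.
  - move=> h hin; have [|s|s] := Cs [ffun u => dot h (A u)].
    + by rewrite mem_cat; apply/orP; right; apply/allpairsP; exists (h, A).
    + by left=> _ [x Cx ->]; rewrite dot_comb; apply: s.
    + by right=> _ [x Cx ->]; rewrite dot_comb; apply: s.
exists [ffun u => combination B (A u)]; first by apply/allpairsP; exists (A, B).
move=> x Cx; rewrite Af // Bg; last by exists x.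
by rewrite comb_comb; apply: eq_comb => u _; rewrite ffunE.
Qed.

Definition isof (V W : finType) (P : vec V -> Prop) (Q : vec W -> Prop)
    (f : vec V -> vec W) (g : vec W -> vec V) : Prop :=
  [/\ pl P f, pl Q g, forall x, P x -> Q (f x) /\ g (f x) = x
    & forall y, Q y -> P (g y) /\ f (g y) = y].

Definition iso (V W : finType) (P : vec V -> Prop) (Q : vec W -> Prop) : Prop :=
  exists f g, isof P Q f g.

Lemma isof_sym (V W : finType) (P : vec V -> Prop) (Q : vec W -> Prop) f g :
  isof P Q f g -> isof Q P g f.
Proof. by case. Qed.

Lemma isof_trans (U V W : finType) (P : vec U -> Prop) (Q : vec V -> Prop)
    (S : vec W -> Prop) f g f' g' :
  isof P Q f g -> isof Q S f' g' -> isof P S (fun x => f' (f x)) (fun x => g (g' x)).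
Proof.
move=> [fp gp fg gf] [fp' gp' fg' gf']; split.
- by apply: pl_comp fp fp' => x /fg[].
- by apply: pl_comp gp' gp => x /gf'[].
- by move=> x Px; have [Qx gx] := fg x Px; have [Sx ->] := fg' _ Qx.
- by move=> x Px; have [Qx gx] := gf' x Px; have [Sx ->] := gf _ Qx.
Qed.

Lemma iso_sym (V W : finType) (P : vec V -> Prop) (Q : vec W -> Prop) :
  iso P Q -> iso Q P.
Proof. by move=> [f [g H]]; exists g, f; exact: isof_sym. Qed.

Lemma iso_trans (U V W : finType) (P : vec U -> Prop) (Q : vec V -> Prop)
    (S : vec W -> Prop) : iso P Q -> iso Q S -> iso P S.
Proof.
move=> [f [g H]] [f' [g' H']]; exists (fun x => f' (f x)), (fun x => g (g' x)).
exact: (isof_trans H H').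
Qed.

End PLCones.

Section Cones.
Variable R : realType.
Local Notation vec V := {ffun V -> R}.

(* The tangent cone, at a point of the open simplex s, of the cone over K. *)
Definition coneT (V : finType) (K : {set {set V}}) (s : {set V}) (x : vec V) : Prop :=
  (forall v, v \notin s -> 0 <= x v) /\ s :|: supp x \in K.

Definition cone (V : finType) (K : {set {set V}}) : vec V -> Prop := coneT K set0.

Definition all_vec (V : finType) (_ : vec V) : Prop := True.

Lemma max_subN (x : R) : Num.max 0 x - Num.max 0 (- x) = x.
Proof. by case: (lerP 0 x) => x0; case: (lerP 0 (- x)) => x1; lra. Qed.

Section ConeTheory.
Variables (V : finType) (K : {set {set V}}).
Implicit Types x y : vec V.

Lemma coneP x : cone K x <-> (forall v, 0 <= x v) /\ supp x \in K.
Proof.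
rewrite /cone /coneT set0U; split=> -[x0 xK]; split=> // v.
by apply: x0; rewrite inE.
Qed.

Lemma cone_ge0 x : cone K x -> forall v, 0 <= x v.
Proof. by case/coneP. Qed.

Lemma suppP x v : reflect (x v = 0) (v \notin supp x).
Proof. by rewrite inE negbK; exact: eqP. Qed.

Lemma suppD x y : supp (x + y) \subset supp x :|: supp y.
Proof.
apply/subsetP => v; rewrite !inE ffunE; apply: contraNT.
by rewrite negb_or !negbK => /andP[/eqP-> /eqP->]; rewrite addr0.
Qed.

Lemma suppD_ge0 x y : (forall v, 0 <= x v) -> (forall v, 0 <= y v) ->
  supp (x + y) = supp x :|: supp y.
Proof.
move=> x0 y0; apply/setP => v; rewrite !inE ffunE.
by rewrite paddr_eq0 // negb_and.
Qed.

Lemma supp_scale c x : c != 0 -> supp (scale c x) = supp x.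
Proof.
by move=> c0; apply/setP => v; rewrite !inE ffunE mulf_eq0 negb_or c0.
Qed.

Lemma supp_unit v : supp (@unitv R V v) = [set v].
Proof. by apply/setP => w; rewrite !inE ffunE pnatr_eq0 eqb0 negbK. Qed.

Lemma supp0 : supp (0 : vec V) = set0.
Proof. by apply/setP => w; rewrite !inE ffunE eqxx. Qed.

Hypothesis KC : is_complex K.

Lemma face_sub (s t : {set V}) : s \in K -> t \subset s -> t \in K.
Proof. by case: KC => _; apply. Qed.

Lemma coneT_scale (s : {set V}) c x : 0 < c -> coneT K s x -> coneT K s (scale c x).
Proof.
move=> c0 [x0 xK]; split=> [v vs|]; first by rewrite ffunE mulr_ge0 ?x0 // ltW.
by rewrite supp_scale ?gt_eqF.
Qed.

Lemma cone0 : cone K 0.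
Proof. by apply/coneP; rewrite supp0; split=> [v|]; [rewrite ffunE | case: KC]. Qed.

Lemma cone_face (s : {set V}) x : s \in K -> (forall v, 0 <= x v) -> supp x \subset s -> cone K x.
Proof. by move=> sK x0 xs; apply/coneP; split=> //; exact: face_sub xs. Qed.

(** A generic point for the coordinate functionals has the largest support among the points of [C],
    and this support is a face. *)
Lemma additive_in_face (C : vec V -> Prop) :
  (forall x, C x -> cone K x) -> additive_set C -> (exists x, C x) ->
  exists2 s, s \in K & forall x, C x -> supp x \subset s.
Proof.
move=> CK Ca [z Cz]; pose hs := [seq @unitv R V v | v : V].
have [|x0 Cx0 x0P] := @generic_point R V hs C z Cz Ca.
  by move=> _ /mapP[v _ ->]; left=> x /CK /cone_ge0; rewrite dot_unit.
exists (supp x0) => [|x Cx]; first by case/coneP: (CK _ Cx0).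
apply/subsetP => v; rewrite !inE; apply: contra_neq => x0v.
by rewrite -dot_unit (x0P _ x (image_f _ _)) // dot_unit.
Qed.

End ConeTheory.

Definition supp_in (V : finType) (s : {set V}) (x : vec V) :=
  (forall v, 0 <= x v) /\ supp x \subset s.

(* A linear map which is bijective from a simplicial fan onto a set has a
   piecewise linear inverse: each cone of the fan is cut out by linear
   inequalities, obtained from a generalized inverse. *)
Lemma comb_inverse (U W : finType) (M : {set {set U}}) (a : U -> vec W)
    (Q : vec W -> Prop) :
  is_complex M ->
  (forall x y, cone M x -> cone M y -> combination a x = combination a y -> x = y) ->
  (forall z, Q z -> exists2 x, cone M x & combination a x = z) ->
  exists2 g, pl Q g & forall x, cone M x -> Q (combination a x) -> g (combination a x) = x.
Proof.
move=> MC inj surj.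
have /choice[g gP] : forall z, exists x, Q z -> cone M x /\ combination a x = z.
  move=> z; have [/surj[x Mx <-]|nQ] := pselect (Q z); last by exists 0.
  by exists x.
exists g => [|x Mx Qx]; last by have [? ?] := gP _ Qx; apply: inj.
(* [as_ s] keeps the vectors of the face [s] and kills the others, so that its generalized inverse
   concerns the cone of [s] alone. *)
have [as_ asE] : exists as_ : {set U} -> U -> vec W,
    forall s u, as_ s u = if u \in s then a u else 0.
  by exists (fun (s : {set U}) u => if u \in s then a u else 0).
have combs (s : {set U}) x : supp x \subset s -> combination (as_ s) x = combination a x.
  move=> xs; apply: eq_comb => u xu; rewrite asE ifT //.
  by apply: (subsetP xs); rewrite inE.
have [L LP] := choice (fun s => generalized_inverse (as_ s)).
(* Injectivity on the cone of [s] gives linear independence: a relation is an equality between its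
   positive and its negative part. *)
have indep (s : {set U}) x : s \in M -> combination (as_ s) x = 0 -> forall u, u \in s -> x u = 0.
  move=> sM x0 u us.
  pose xp : vec U := [ffun u => if u \in s then Num.max 0 (x u) else 0].
  pose xm : vec U := [ffun u => if u \in s then Num.max 0 (- x u) else 0].
  have Mp : cone M xp.
    apply: (cone_face MC sM) => [v|]; first by rewrite ffunE; case: ifP; rewrite ?le_max ?lexx.
    by apply/subsetP => v; rewrite inE ffunE; case: ifP; rewrite ?eqxx.
  have Mm : cone M xm.
    apply: (cone_face MC sM) => [v|]; first by rewrite ffunE; case: ifP; rewrite ?le_max ?lexx.
    by apply/subsetP => v; rewrite inE ffunE; case: ifP; rewrite ?eqxx.
  have /(inj _ _ Mp Mm) /ffunP /(_ u) : combination a xp = combination a xm.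
    apply/eqP; rewrite -subr_eq0 -combB -x0; apply/eqP/ffunP => w.
    rewrite !ffunE; apply: eq_bigr => v _; rewrite !ffunE asE.
    by case: ifP => vs; rewrite ?ffunE ?subr0 ?mul0r ?mulr0 // max_subN.
  by rewrite !ffunE us => /eqP; rewrite -subr_eq0 max_subN => /eqP.
(* The cone of [s] is where all [eqs s w] vanish, which puts [z] in the span, and where all
   [ineqs s u] with [u] in [s], which are the coefficients, are nonnegative. *)
pose eqs (s : {set U}) w : vec W := [ffun w' => combination (as_ s) (L s w') w - (w' == w)%:R].
have eqsP s w z : dot (eqs s w) z = combination (as_ s) (combination (L s) z) w - z w.
  rewrite comb_comb !ffunE /dot -(dot_unit w z) /dot -sumrB; apply: eq_bigr => w' _.
  by rewrite !ffunE mulrBl [w' == w]eq_sym mulrC.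
pose ineqs (s : {set U}) u : vec W := [ffun w' => L s w' u].
have ineqsP s u z : dot (ineqs s u) z = combination (L s) z u.
  by rewrite !ffunE /dot; apply: eq_bigr => w _; rewrite ffunE mulrC.
have mem_face (s : {set U}) z : s \in M -> (exists2 x, supp_in s x & combination a x = z) <->
    (forall w, dot (eqs s w) z = 0) /\ (forall u, u \in s -> 0 <= dot (ineqs s u) z).
  move=> sM; split=> [[x [x0 xs] <-]|[E I]].
    have xE : combination (as_ s) (combination (L s) (combination a x)) = combination a x.
      by rewrite -(combs s) // LP.
    split=> [w|u us]; first by rewrite eqsP xE subrr.
    rewrite ineqsP -[leRHS](subrK (x u)).
    have -> : combination (L s) (combination a x) u - x u = 0.
      have /(indep _ _ sM)/(_ _ us) : combination (as_ s)
          (combination (L s) (combination a x) - x) = 0.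
        by rewrite combB xE (combs s) ?subrr.
      by rewrite !ffunE.
    by rewrite add0r.
  pose y : vec U := [ffun u => if u \in s then combination (L s) z u else 0].
  exists y; first split.
  - by move=> u; rewrite ffunE; case: ifP => // us; rewrite -ineqsP I.
  - by apply/subsetP => v; rewrite inE ffunE; case: ifP; rewrite ?eqxx.
  apply/ffunP => w; have /eqP := E w; rewrite eqsP subr_eq0 => /eqP <-.
  rewrite !ffunE; apply: eq_bigr => u _; rewrite asE ffunE; case: ifP => // _.
  by rewrite ?ffunE ?mulr0 ?mul0r.
exists ([seq eqs s w | s : {set U} <- enum {: {set U}}, w : W <- enum W] ++ [seq ineqs s u | s : {set U} <- enum {: {set U}}, u : U <- enum U]).
pose L' (s : {set U}) : {ffun W -> vec U} := [ffun w => [ffun u => if u \in s then L s w u else 0]].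
have L'E (s : {set U}) z u : combination (L' s) z u = if u \in s then combination (L s) z u else 0.
  rewrite !ffunE; case: ifP => us; last by apply: big1 => w _; rewrite !ffunE us mulr0.
  by apply: eq_bigr => w _; rewrite !ffunE us.
exists [seq L' s | s : {set U}] => C CQ Ca Cs.
have [[z0 Cz0]|noC] := pselect (exists z, C z); last first.
  by exists (L' set0); [exact: image_f | move=> z Cz; case: noC; exists z].
(* The face is read off at a generic point. Its equations vanish at [z1], hence on [C]; an
   inequality that is nonpositive on [C] is zero at [z1], hence zero on [C] as well. *)
have [z1 Cz1 gen] := generic_point Cz0 Ca Cs.
have [Mg gE] := gP _ (CQ _ Cz1); set s := supp (g z1).
have [g0 sM] := (coneP _ _).1 Mg.
have [E1 I1] : (forall w, dot (eqs s w) z1 = 0) /\ (forall u, u \in s -> 0 <= dot (ineqs s u) z1).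
  by apply/(mem_face _ _ sM); exists (g z1).
exists (L' s); first exact: image_f.
move=> z Cz; have [y [y0 ys] yz] : exists2 x, supp_in s x & combination a x = z.
  apply/(mem_face _ _ sM); split=> [w|u us].
    apply: (gen _ _ _ (E1 w) Cz); rewrite mem_cat; apply/orP; left.
    by apply/allpairsP; exists (s, w); rewrite !mem_enum.
  have hin : ineqs s u \in [seq eqs s w | s : {set U} <- enum {: {set U}}, w : W <- enum W] ++ [seq ineqs s u | s : {set U} <- enum {: {set U}}, u : U <- enum U].
    by rewrite mem_cat; apply/orP; right; apply/allpairsP; exists (s, u); rewrite !mem_enum.
  have [/(_ z Cz)//|neg] := Cs _ hin.
  have z10 : dot (ineqs s u) z1 = 0 by apply/eqP; rewrite eq_le neg //= I1.
  by rewrite (gen _ _ hin z10 Cz).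
have My : cone M y by exact: (cone_face MC sM).
have [Mgz gzE] := gP _ (CQ _ Cz).
rewrite (inj _ _ Mgz My) ?gzE //; apply/ffunP => u; rewrite L'E.
case: ifPn => us; last by apply/suppP; apply: contra us; exact: (subsetP ys).
apply/eqP; rewrite eq_sym -subr_eq0; apply/eqP.
have /(indep _ _ sM)/(_ _ us) : combination (as_ s) (combination (L s) z - y) = 0.
  by rewrite combB -yz -(combs _ _ ys) LP subrr.
by rewrite !ffunE.
Qed.

End Cones.

(** * Tangent cones and derivatives of piecewise linear maps *)

Section Tangent.
Variable R : realType.
Local Notation vec V := {ffun V -> R}.

Section TangentCone.
Variable V : finType.
Implicit Types (P : vec V -> Prop) (p x : vec V).

(** For a conical [P] this says that p + x/N lies in [P] for all large N: the directions pointing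
    into [P] at [p], described without limits. *)
Definition tangent P p x : Prop :=
  exists N0, forall N, N0 <= N -> P (scale N p + x).

Definition conical P : Prop := forall c x, 0 < c -> P x -> P (scale c x).

(* Near p, the set P is cut out of its tangent cone by the inequalities
   l >= 0. *)
Definition conic_at P p : Prop :=
  exists2 ls : seq (vec V), forall l, l \in ls -> 0 < dot l p &
    forall x N, tangent P p x -> 0 <= N ->
      (forall l, l \in ls -> 0 <= dot l (scale N p + x)) -> P (scale N p + x).

Lemma large_dot (ls : seq (vec V)) p x : exists N0, forall N, N0 <= N ->
  forall l, l \in ls -> 0 < dot l p -> 0 <= dot l (scale N p + x).
Proof.
elim: ls => [|l ls [N0 IH]]; first by exists 0.
exists (Num.max N0 (`|dot l x| / `|dot l p|)) => N; rewrite ge_max => /andP[NN0 Nl].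
move=> k; rewrite inE => /orP[/eqP-> lp|]; last exact: IH.
rewrite dotD dotZ; have := ler_norm (- dot l x); rewrite normrN.
by move: Nl; rewrite (ger0_norm (ltW lp)) ler_pdivrMr //; lra.
Qed.

Lemma tangent_scale P p c x : conical P -> 0 < c -> tangent P p x -> tangent P p (scale c x).
Proof.
move=> Pc c0 [N0 H]; exists (c * N0) => N NN0.
have -> : scale N p + scale c x = scale c (scale (N / c) p + x).
  by rewrite scaleD scaleA mulrCA divff ?gt_eqF // mulr1.
by apply: Pc => //; apply: H; rewrite ler_pdivlMr // mulrC.
Qed.

Lemma tangent0 P p : conical P -> P p -> tangent P p 0.
Proof. by move=> Pc Pp; exists 1 => N N1; rewrite addr0; apply: Pc => //; lra. Qed.

Section Derivative.
Variables (W : finType) (P : vec V -> Prop) (p : vec V) (f : vec V -> vec W).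
Hypotheses (Pc : conical P) (Pp : P p) (Pg : conic_at P p) (fpl : pl P f).

(** The points close to the ray of [p]: every functional that is nonzero at [p] keeps its sign
    there. *)
Let cond (hs ls : seq (vec V)) z : Prop :=
  [/\ forall l, l \in ls -> 0 <= dot l z,
      forall h, h \in hs -> 0 < dot h p -> 0 <= dot h z
    & forall h, h \in hs -> dot h p < 0 -> dot h z <= 0].

Let cond_large hs ls x : (forall l, l \in ls -> 0 < dot l p) ->
  exists N0, forall N, N0 <= N -> cond hs ls (scale N p + x).
Proof.
move=> lsP.
have [N0 H0] := large_dot ls p x; have [N1 H1] := large_dot hs p x.
have [N2 H2] := large_dot [seq - h | h <- hs] p x.
have dotN h (z : vec V) : dot (- h) z = - dot h z.
  by rewrite /dot -sumrN; apply: eq_bigr => v _; rewrite ffunE mulNr.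
exists (Num.max N0 (Num.max N1 N2)) => N; rewrite !ge_max => /andP[n0 /andP[n1 n2]].
split=> [l lin|h hin hp|h hin hp]; [by apply: H0; auto | exact: H1 |].
by rewrite -oppr_ge0 -dotN; apply: H2; rewrite ?map_f // dotN oppr_gt0.
Qed.

(** The points [scale N p + x] with [x] in [C] and [N] large form an additive set on which no
    functional changes sign: one that vanishes at [p] has there the sign it has on [C]. Hence [f] is
    linear on this set, and one [A] computes both [f p] and the derivative. *)
Let piece : exists (hs : seq (vec V)) (As : seq {ffun V -> vec W}),
  forall C, (forall x, C x -> tangent P p x) -> additive_set C -> signed hs C ->
    exists A, [/\ A \in As, f p = combination A p &
      forall x, C x -> exists N0, forall N, N0 <= N ->
        f (scale N p + x) = scale N (f p) + combination A x].
Proof.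
have [ls lsP lsT] := Pg; have [hs [As H]] := fpl.
exists hs, As => C CT Ca Cs.
(* Adjoining 0 to [C] puts [p] itself among these points. *)
pose C0 x := C x \/ x = 0.
have C0T x : C0 x -> tangent P p x by case=> [/CT//|->]; exact: tangent0.
have C0a : additive_set C0.
  move=> x y [Cx|->] [Cy|->]; rewrite ?addr0 ?add0r; [|by left..|by right].
  by left; apply: Ca.
pose C' z := exists x N, [/\ C0 x, 0 < N, z = scale N p + x & cond hs ls z].
have [A Ain fA] : exists2 A, A \in As & forall z, C' z -> f z = combination A z.
  apply: H.
  - by move=> _ [x [N [/C0T Tx N0 -> [? _ _]]]]; apply: lsT => //; exact: ltW.
  - move=> _ _ [x [N [Cx N0 -> [l1 h1 k1]]]] [y [M [Cy M0 -> [l2 h2 k2]]]].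
    exists (x + y), (N + M); split; [exact: C0a | lra | by rewrite scaleDl addrACA |].
    split=> [l lin|h hin hp|h hin hp]; rewrite dotD.
    + by rewrite addr_ge0 ?l1 ?l2.
    + by rewrite addr_ge0 ?h1 ?h2.
    + by rewrite -[leRHS]addr0 lerD ?k1 ?k2.
  move=> h hin; case: (ltrgtP (dot h p) 0) => hp.
  - by right=> _ [x [N [_ _ -> [_ _ k]]]]; apply: k.
  - by left=> _ [x [N [_ _ -> [_ k _]]]]; apply: k.
  have hz x N : dot h (scale N p + x) = dot h x by rewrite dotD dotZ hp mulr0 add0r.
  have [s|s] := Cs h hin; [left|right] => _ [x [N [[Cx|->] _ -> _]]];
    by rewrite hz ?dot0 ?s.
have fN x N0 : C0 x -> (forall N, N0 <= N -> cond hs ls (scale N p + x)) ->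
    forall N, Num.max N0 1 <= N -> f (scale N p + x) = scale N (combination A p) + combination A x.
  move=> Cx xN N; rewrite ge_max => /andP[NN0 N1].
  rewrite fA; first by rewrite combD combZ.
  by exists x, N; split=> //; [lra | exact: xN].
have fp : f p = combination A p.
  rewrite fA //; exists 0, 1; split; rewrite ?addr0 ?scale1 //; [by right |].
  by split=> *; rewrite ltW; auto.
exists A; split=> // x Cx; have [N0 xN] := cond_large hs x lsP.
by exists (Num.max N0 1) => N NN; rewrite fp; apply: (fN _ N0) => //; left.
Qed.

Let ray : forall N, 0 < N -> f (scale N p) = scale N (f p).
Proof.
move=> N N0; have [hs [As H]] := fpl.
have [|||A _ fA] := H (fun z => exists2 c, 0 < c & z = scale c p).
- by move=> _ [c c0 ->]; exact: Pc.
- by move=> _ _ [c c0 ->] [d d0 ->]; exists (c + d); rewrite ?scaleDl //; lra.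
- move=> h _; case: (lerP 0 (dot h p)) => hp; [left|right] => _ [c c0 ->]; rewrite dotZ.
    by rewrite mulr_ge0 // ltW.
  by rewrite mulr_ge0_le0 // ltW.
rewrite fA; last by exists N.
rewrite combZ; congr scale; rewrite fA //; exists 1; rewrite ?scale1 //; lra.
Qed.

(** Applied to the ray of [x], [piece] gives the value at [x], which large [N] determines; applied
    to [C], it shows that the derivative is linear on [C]. The expansion is an equality for large
    [N], not an approximation. *)
Lemma derivative_exists : exists2 f' : vec V -> vec W, pl (tangent P p) f' &
  forall x, tangent P p x -> exists N0, forall N, N0 <= N ->
    f (scale N p + x) = scale N (f p) + f' x.
Proof.
have [hs [As H]] := piece.
have /choice[f' f'P] : forall x, exists y, tangent P p x -> exists N0, forall N, N0 <= N ->
    f (scale N p + x) = scale N (f p) + y.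
  move=> x; have [Tx|nTx] := pselect (tangent P p x); last by exists 0.
  have [|||A [_ _ fA]] := H (fun z => exists2 c, 0 < c & z = scale c x).
  - by move=> _ [c c0 ->]; exact: tangent_scale.
  - by move=> _ _ [c c0 ->] [d d0 ->]; exists (c + d); rewrite ?scaleDl //; lra.
  - move=> h _; case: (lerP 0 (dot h x)) => hp; [left|right] => _ [c c0 ->]; rewrite dotZ.
      by rewrite mulr_ge0 // ltW.
    by rewrite mulr_ge0_le0 // ltW.
  by exists (combination A x) => _; apply: fA; exists 1; rewrite ?scale1.
exists f' => //; exists hs, As => C CT Ca Cs.
have [A [Ain _ fA]] := H C CT Ca Cs; exists A => // x Cx.
have [N0 xN] := f'P _ (CT _ Cx); have [N1 xN'] := fA _ Cx.
have := xN (Num.max N0 N1); have := xN' (Num.max N0 N1).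
by rewrite !le_max !lexx orbT => /(_ isT) -> /(_ isT) /addrI ->.
Qed.

End Derivative.
End TangentCone.

Lemma tangent_image (V W : finType) (P : vec V -> Prop) (f : vec V -> vec W) p
    (Q : vec W -> Prop) (f' : vec V -> vec W) :
  (forall x, P x -> Q (f x)) ->
  (forall x, tangent P p x -> exists N0, forall N, N0 <= N ->
    f (scale N p + x) = scale N (f p) + f' x) ->
  forall x, tangent P p x -> tangent Q (f p) (f' x).
Proof.
move=> PQ f'P x Tx; have [N0 xN] := f'P _ Tx; have [N1 xP] := Tx.
exists (Num.max N0 N1) => N; rewrite ge_max => /andP[n0 n1].
by rewrite -xN //; apply/PQ/xP.
Qed.


(** The derivatives are inverse to each other by expanding twice at a common large [N]. The
    translation clause holds because N p + (x + t p) = (N + t) p + x; it is what [coneT_link] needs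
    in order to divide by a line. *)
Lemma tangent_iso (V W : finType) (P : vec V -> Prop) (Q : vec W -> Prop) f g p :
  isof P Q f g -> conical P -> conical Q -> P p -> conic_at P p -> conic_at Q (f p) ->
  exists f' g', isof (tangent P p) (tangent Q (f p)) f' g' /\
    forall x t, tangent P p x -> tangent P p (x + scale t p) ->
      f' (x + scale t p) = f' x + scale t (f p).
Proof.
move=> [fpl gpl fP gP] Pc Qc Pp Pg Qg.
have [Qfp gfp] := fP p Pp.
have [f' f'pl f'P] := derivative_exists Pc Pp Pg fpl.
have [g' g'pl] := derivative_exists Qc Qfp Qg gpl; rewrite gfp => g'P.
have fT x Tx : tangent Q (f p) (f' x) :=
  tangent_image (fun x Px => (fP x Px).1) f'P Tx.
have gT y (Ty : tangent Q (f p) y) : tangent P p (g' y).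
  by have := @tangent_image _ _ Q g (f p) P g' (fun x Px => (gP x Px).1); rewrite gfp => H; exact: H g'P y Ty.
exists f', g'; split; first split=> // [x Tx|y Ty]; first split; try by auto.
- have [N0 xN] := f'P _ Tx; have [N1 yN] := g'P _ (fT _ Tx); have [N2 xP] := Tx.
  pose N := Num.max N0 (Num.max N1 N2).
  have [n0 n1 n2] : [/\ N0 <= N, N1 <= N & N2 <= N] by rewrite !le_max !lexx !orbT.
  have := yN N n1; rewrite -xN // (fP _ (xP _ n2)).2 => /addrI //.
- split; first exact: gT.
  have [N0 xN] := g'P _ Ty; have [N1 yN] := f'P _ (gT _ Ty); have [N2 xP] := Ty.
  pose N := Num.max N0 (Num.max N1 N2).
  have [n0 n1 n2] : [/\ N0 <= N, N1 <= N & N2 <= N] by rewrite !le_max !lexx !orbT.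
  have := yN N n1; rewrite -xN // (gP _ (xP _ n2)).2 => /addrI //.
move=> x t Tx Txt.
have [N0 xN] := f'P _ Tx; have [N1 yN] := f'P _ Txt.
pose N := Num.max (N0 - t) N1.
have [n0 n1] : N0 <= N + t /\ N1 <= N.
  by split; [rewrite -lerBlDr |]; rewrite le_max lexx ?orbT.
have := yN N n1.
have -> : scale N p + (x + scale t p) = scale (N + t) p + x by rewrite scaleDl addrA addrAC.
by rewrite xN // scaleDl -addrA => /addrI <-; rewrite addrC.
Qed.

End Tangent.

Section ConeIso.
Variable R : realType.
Local Notation vec V := {ffun V -> R}.

Lemma comb_iso (U W : finType) (M : {set {set U}}) (a : U -> vec W) (Q : vec W -> Prop) :
  is_complex M -> (forall x, cone M x -> Q (combination a x)) ->
  (forall x y, cone M x -> cone M y -> combination a x = combination a y -> x = y) ->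
  (forall z, Q z -> exists2 x, cone M x & combination a x = z) ->
  exists g, isof (cone M) Q (combination a) g.
Proof.
move=> MC MQ inj surj; have [g gpl gP] := comb_inverse MC inj surj.
exists g; split=> // [|x Mx|z /surj[x Mx <-]]; first exact: pl_comb.
  by rewrite gP //; auto.
by rewrite gP //; auto.
Qed.

Lemma iso_ext (V W : finType) (P P' : vec V -> Prop) (Q Q' : vec W -> Prop) :
  (forall x, P x <-> P' x) -> (forall x, Q x <-> Q' x) -> iso P Q -> iso P' Q'.
Proof.
move=> PP QQ [f [g [fpl gpl fP gP]]]; exists f, g; split.
- by apply: pl_sub fpl => x /PP.
- by apply: pl_sub gpl => x /QQ.
- by move=> x /PP /fP[/QQ].
- by move=> x /QQ /gP[/PP].
Qed.

Lemma pl0 (V W : finType) (P : vec V -> Prop) (f : vec V -> vec W) : pl P f -> P 0 -> f 0 = 0.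
Proof.
move=> [hs [As H]] P0; have [|||A _ fA] := H (fun x => x = 0).
- by move=> _ ->.
- by move=> _ _ -> ->; rewrite addr0.
- by move=> h _; left=> _ ->; rewrite dot0.
by rewrite fA // comb0.
Qed.

Lemma all_vec_conical V : conical (@all_vec R V).
Proof. by []. Qed.

Lemma all_vec_tangent V p x : tangent (@all_vec R V) p x <-> all_vec x.
Proof. by split=> // _; exists 0. Qed.

Lemma all_vec_conic V p : conic_at (@all_vec R V) p.
Proof. by exists [::]. Qed.

Section CoverTangent.
Variables (V : finType) (K : {set {set V}}).
Hypothesis KC : is_complex K.

Lemma coneT_conical s : conical (@coneT R V K s).
Proof. by move=> c x; exact: coneT_scale. Qed.

Let near_coneT s (p x : vec V) N : coneT K s p -> coneT K (s :|: supp p) x -> 0 <= N ->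
  (forall v, v \in supp p :\: s -> 0 <= N * p v + x v) -> coneT K s (scale N p + x).
Proof.
move=> [p0 pK] [x0 xK] N0 H; split=> [v vs|].
  rewrite !ffunE; have [pv|pv] := boolP (v \in supp p); first by apply: H; rewrite inE vs.
  by rewrite addr_ge0 ?mulr_ge0 ?p0 // x0 // inE negb_or vs.
apply: (face_sub KC xK); rewrite -setUA setUS //.
apply: subset_trans (suppD _ _) _; rewrite setSU //.
apply/subsetP => v; rewrite !inE ffunE; apply: contra_neq => ->; exact: mulr0.
Qed.

(** On the part of [supp p] outside [s] the term N p outweighs [x], so the coordinates there become
    free, as those of [s] already are. *)
Lemma coneT_tangent s p x : coneT K s p ->
  tangent (@coneT R V K s) p x <-> coneT K (s :|: supp p) x.
Proof.
move=> Kp; have [p0 pK] := Kp.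
have [N1 H1] := large_dot [seq @unitv R V v | v : V] p (x - p).
have {}H1 N v : N1 <= N -> 0 < p v -> p v <= N * p v + x v.
  move=> NN pv; have := H1 N NN (@unitv R V v) (image_f _ _).
  by rewrite !dot_unit !ffunE => /(_ isT pv); lra.
split=> [[N0 H]|Tx].
  pose N := Num.max N0 N1.
  have [NN0 NN1] : N0 <= N /\ N1 <= N by rewrite !le_max !lexx orbT.
  have [y0 yK] := H N NN0; split=> [v|].
    rewrite inE negb_or => /andP[/y0 vs /suppP pv].
    by move: vs; rewrite !ffunE pv mulr0 add0r.
  apply: (face_sub KC yK); apply/subsetP => v; rewrite !inE.
  case: (boolP (v \in s)) => //= vs; rewrite !ffunE.
  have [->|pv _] /= := eqVneq (p v) 0; first by rewrite mulr0 add0r.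
  have pv0 : 0 < p v by rewrite lt_def pv p0.
  by rewrite gt_eqF //; apply: lt_le_trans (H1 _ _ NN1 pv0).
exists (Num.max N1 0) => N; rewrite ge_max => /andP[NN1 N0].
apply: near_coneT => // v; rewrite !inE => /andP[vs pv].
have pv0 : 0 < p v by rewrite lt_def pv p0.
by apply: le_trans (H1 _ _ NN1 pv0); exact: ltW.
Qed.

Lemma coneT_conic s p : coneT K s p -> conic_at (@coneT R V K s) p.
Proof.
move=> Kp; have [p0 pK] := Kp.
exists [seq @unitv R V v | v in supp p :\: s] => [l /imageP[v vin ->]|x N].
  by move: vin; rewrite !inE => /andP[vs pv]; rewrite dot_unit lt_def pv p0.
rewrite (coneT_tangent _ Kp) => Tx N0 H.
apply: near_coneT => // v vin; have := H _ (image_f _ vin).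
by rewrite dot_unit !ffunE.
Qed.

Lemma coneT_indicator s : s \in K -> exists2 p : vec V, cone K p & supp p = s.
Proof.
move=> sK; exists [ffun v => (v \in s)%:R]; last first.
  by apply/setP => v; rewrite inE ffunE pnatr_eq0 eqb0 negbK.
apply: (cone_face KC sK) => [v|]; first by rewrite ffunE ler0n.
by apply/subsetP => v; rewrite inE ffunE pnatr_eq0 eqb0 negbK.
Qed.

(** The isomorphism is differentiated at a point of the open simplex [s]; the tangent cone of R^n at
    any point is R^n. *)
Lemma coneT_all_vec n s : iso (@cone R V K) (@all_vec R 'I_n) -> s \in K ->
  iso (@coneT R V K s) (@all_vec R 'I_n).
Proof.
move=> [f [g fg]] sK; have [p Kp ps] := coneT_indicator sK.
have [f' [g' [iso' _]]] := tangent_iso fg (@coneT_conical _) (@all_vec_conical _) Kp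
  (coneT_conic Kp) (@all_vec_conic _ _).
apply: iso_ext (ex_intro _ _ (ex_intro _ _ iso')) => x; last exact: all_vec_tangent.
by rewrite (coneT_tangent _ Kp) set0U ps.
Qed.

End CoverTangent.

(** * Links of vertices and tangent cones at vertices *)

Section Links.
Variables (V : finType) (K : {set {set V}}).
Hypothesis KC : is_complex K.

Lemma link_complex v : [set v] \in K -> is_complex (link K v).
Proof.
move=> vK; split=> [|s t]; first by rewrite !inE setU0 vK.
rewrite !inE => /andP[vs sK] ts.
have -> /= : v \notin t by apply: contra vs; exact: (subsetP ts).
by apply: (face_sub KC sK); exact: setUS.
Qed.

Definition drop_coord (v : V) (x : vec V) : vec V := [ffun w => if w == v then 0 else x w].

Lemma drop_coordE v x : drop_coord v x = combination (fun w => if w == v then 0 else @unitv R V w) x.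
Proof.
rewrite -[in LHS](comb_delta x); apply/ffunP => u; rewrite !ffunE.
case: eqP => [->|/eqP uv].
  by rewrite big1 // => w _; case: eqP => wv; rewrite ffunE ?mulr0 // eq_sym (introF eqP wv) mulr0.
apply: eq_bigr => w _; case: eqP => // ->; by rewrite !ffunE (negPf uv).
Qed.

Lemma cone_drop v (x : vec V) : coneT K [set v] x -> cone (link K v) (drop_coord v x).
Proof.
move=> [x0 xK]; apply/coneP; split=> [w|].
  by rewrite ffunE; case: eqP => // /eqP wv; apply: x0; rewrite inE.
rewrite !inE ffunE !eqxx /=; apply: (face_sub KC xK).
rewrite subUset subsetUl; apply: subset_trans (subsetUr _ _).
by apply/subsetP => w; rewrite !inE ffunE; case: ifP; rewrite ?eqxx.
Qed.

Lemma cone_link v (x : vec V) : cone (link K v) x <-> coneT K [set v] x /\ x v = 0.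
Proof.
split=> [/coneP[x0]|[Kx xv]].
  by rewrite inE => /andP[/suppP xv xK]; split=> //; split=> // w _.
suff -> : x = drop_coord v x by exact: cone_drop.
by apply/ffunP => w; rewrite ffunE; case: eqP => // ->.
Qed.

Lemma coneT_add_unit v (x : vec V) t : coneT K [set v] x -> coneT K [set v] (x + scale t (@unitv R V v)).
Proof.
move=> [x0 xK]; split=> [w wv|].
  by rewrite !ffunE (_ : w == v = false) ?mulr0 ?addr0 ?x0 //; apply: contraNF wv => /eqP->; rewrite inE.
apply: (face_sub KC xK); apply/subsetP => w; rewrite !inE !ffunE.
by case: eqP => //= _; rewrite mulr0 addr0.
Qed.

Lemma drop_coord_add v x : x = drop_coord v x + scale (x v) (@unitv R V v).
Proof.
apply/ffunP => w; rewrite !ffunE; case: eqP => [->|_]; first by rewrite add0r mulr1.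
by rewrite mulr0 addr0.
Qed.

Lemma drop_coord_unit v x t : drop_coord v (x + scale t (@unitv R V v)) = drop_coord v x.
Proof. by apply/ffunP => w; rewrite !ffunE; case: eqP => // _; rewrite mulr0 addr0. Qed.

(** The tangent cone at [v] is the cone over the link times the line of the coordinate [v], which
    becomes the coordinate [ord0]. *)
Lemma link_coneT n v : [set v] \in K -> iso (@cone R V (link K v)) (@all_vec R 'I_n) ->
  iso (@coneT R V K [set v]) (@all_vec R 'I_n.+1).
Proof.
move=> vK [f [g [fpl gpl fP gP]]].
pose ins (j : 'I_n) := @unitv R 'I_n.+1 (lift ord0 j).
pose del (j : 'I_n.+1) : vec 'I_n := if unlift ord0 j is Some k then unitv R k else 0.
have delE (x : vec 'I_n.+1) j : combination del x j = x (lift ord0 j).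
  rewrite ffunE (bigD1 (lift ord0 j)) //= /del liftK ffunE eqxx mulr1 big1 ?addr0 // => k.
  case: unliftP => [k' ->|-> _]; last by rewrite ffunE mulr0.
  by rewrite (inj_eq lift_inj) ffunE eq_sym => /negPf->; rewrite mulr0.
have insE (y : vec 'I_n) j : combination ins y (lift ord0 j) = y j.
  rewrite ffunE (bigD1 j) //= /ins ffunE eqxx mulr1 big1 ?addr0 // => k kj.
  by rewrite ffunE (inj_eq lift_inj) eq_sym (negPf kj) mulr0.
have ins0 (y : vec 'I_n) : combination ins y ord0 = 0.
  by rewrite ffunE big1 // => k _; rewrite ffunE (negPf (neq_lift _ _)) mulr0.
pose E w : vec 'I_n.+1 := if w == v then unitv R ord0 else 0.
have EE (x : vec V) : combination E x = scale (x v) (unitv R ord0).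
  apply/ffunP => j; rewrite ffunE (bigD1 v) //= /E eqxx big1 ?addr0 ?ffunE // => w /negPf->.
  by rewrite ffunE mulr0.
have E0 x : combination E x ord0 = x v by rewrite EE !ffunE eqxx mulr1.
have El x j : combination E x (lift ord0 j) = 0.
  by rewrite EE !ffunE eq_sym (negPf (neq_lift _ _)) mulr0.
pose E' (j : 'I_n.+1) : vec V := if j == ord0 then unitv R v else 0.
have EE' (y : vec 'I_n.+1) : combination E' y = scale (y ord0) (unitv R v).
  apply/ffunP => j; rewrite ffunE (bigD1 ord0) //= /E' eqxx big1 ?addr0 ?ffunE // => w /negPf->.
  by rewrite ffunE mulr0.
exists (fun x => combination E x + combination ins (f (drop_coord v x))).
exists (fun y => g (combination del y) + combination E' y); split.
- apply: pl_add (pl_comb _ _) _.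
  apply: (@pl_comp _ _ _ _ _ (@all_vec R 'I_n) (fun x => f (drop_coord v x))) => //; last exact: pl_comb.
  apply: (@pl_comp _ _ _ _ _ (cone (link K v))) => //; first exact: cone_drop.
  by apply: eq_pl (pl_comb _ _) => x _; rewrite drop_coordE.
- apply: pl_add _ (pl_comb _ _).
  by apply: (@pl_comp _ _ _ _ _ (@all_vec R 'I_n)) => //; exact: pl_comb.
- move=> x Tx; split=> //.
  have [_ gf] := fP _ (cone_drop Tx).
  have -> : combination del (combination E x + combination ins (f (drop_coord v x))) = f (drop_coord v x).
    by apply/ffunP => j; rewrite delE ffunE insE El add0r.
  rewrite gf EE' ffunE ins0 addr0 E0; exact/esym/drop_coord_add.
move=> y _; have [Lg fg] := gP (combination del y) I.
have [Tg gv] := (cone_link _ _).1 Lg.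
split=> //; first by rewrite EE'; exact: coneT_add_unit.
have -> : drop_coord v (g (combination del y) + combination E' y) = g (combination del y).
  by rewrite EE' drop_coord_unit; apply/ffunP => w; rewrite ffunE; case: eqP => // ->.
rewrite fg; apply/ffunP => j; rewrite ffunE.
case: (unliftP ord0 j) => [k ->|->]; first by rewrite El insE delE add0r.
by rewrite E0 ins0 addr0 ffunE gv EE' !ffunE eqxx mulr1 add0r.
Qed.

(** The given isomorphism need not respect the line of [v]. Its derivative at the unit vector of [v]
    does, by the last clause of [tangent_iso], and therefore passes to the quotients by the lines of
    [e] and [q]. *)
Lemma coneT_link n v : [set v] \in K -> iso (@coneT R V K [set v]) (@all_vec R 'I_n.+1) ->
  iso (@cone R V (link K v)) (@all_vec R 'I_n).
Proof.
move=> vK [f0 [g0 fg0]]; pose e : vec V := unitv R v.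
have Ke : coneT K [set v] e.
  split=> [w _|]; first by rewrite ffunE ler0n.
  by rewrite supp_unit setUid.
have Kt x : tangent (@coneT R V K [set v]) e x <-> coneT K [set v] x.
  by rewrite (coneT_tangent KC _ Ke) supp_unit setUid.
have [f [g [[fpl gpl fP gP] fe]]] := tangent_iso fg0 (@coneT_conical _ _ _) (@all_vec_conical _) Ke
  (coneT_conic KC Ke) (@all_vec_conic _ _).
set q := f0 e in fe.
have {}fpl : pl (coneT K [set v]) f by apply: pl_sub fpl => x /Kt.
have {}fP x : coneT K [set v] x -> g (f x) = x by move=> /Kt/fP[].
have {}gP y : coneT K [set v] (g y) /\ f (g y) = y.
  by have [/Kt] := gP y ((all_vec_tangent _ _).2 I).
have {}gpl : pl (@all_vec R 'I_n.+1) g by apply: pl_sub gpl => x _; exact/all_vec_tangent.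
have {}fe x t : coneT K [set v] x -> f (x + scale t e) = f x + scale t q.
  by move=> Kx; apply: fe; apply/Kt => //; exact: coneT_add_unit.
have ge y t : g (y + scale t q) = g y + scale t e.
  by have [Kg {1}<-] := gP y; rewrite -fe ?fP //; exact: coneT_add_unit.
have K0 : coneT K [set v] 0.
  by split=> [w _|]; rewrite ?ffunE // supp0 setU0.
have [i qi] : exists i, q i != 0.
  apply/existsP; apply: contraT; rewrite negb_exists => /forallP q0.
  have qq : q = 0 by apply/ffunP => i; rewrite ffunE; apply/eqP; have := q0 i; rewrite negbK.
  have := fP _ Ke; rewrite -[e]add0r -[e]scale1 fe // qq -(scale0 q) scaleA mulr0 scale0 addr0 fP //.
  by move=> /ffunP/(_ v); rewrite !ffunE eqxx mulr1 add0r => /eqP; rewrite eq_sym oner_eq0.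
(* The quotient of R^(n+1) by the line through q, with a section. *)
pose pr (j : 'I_n.+1) : vec 'I_n := [ffun k => (j == lift i k)%:R - (j == i)%:R * q (lift i k) / q i].
have prE (y : vec 'I_n.+1) k : combination pr y k = y (lift i k) - y i * q (lift i k) / q i.
  rewrite ffunE; under eq_bigr do rewrite ffunE mulrBr.
  rewrite sumrB; congr (_ - _).
    rewrite (bigD1 (lift i k)) //= eqxx mulr1 big1 ?addr0 // => j /negPf->; exact: mulr0.
  rewrite (bigD1 i) //= eqxx mul1r big1 ?addr0 ?mulrA // => j /negPf->.
  by rewrite !mul0r mulr0.
pose ins (k : 'I_n) : vec 'I_n.+1 := unitv R (lift i k).
have insE y k : combination ins y (lift i k) = y k.
  rewrite ffunE (bigD1 k) //= /ins ffunE eqxx mulr1 big1 ?addr0 // => k' kk.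
  by rewrite ffunE (inj_eq lift_inj) eq_sym (negPf kk) mulr0.
have ins0 y : combination ins y i = 0.
  by rewrite ffunE big1 // => k _; rewrite ffunE (negPf (neq_lift _ _)) mulr0.
have pr_ins y : combination pr (combination ins y) = y.
  by apply/ffunP => k; rewrite prE insE ins0 !mul0r subr0.
have pr_q t : combination pr (scale t q) = 0.
  by apply/ffunP => k; rewrite prE !ffunE mulrAC mulfK // subrr.
have ins_pr y : y = combination ins (combination pr y) + scale (y i / q i) q.
  apply/ffunP => j; rewrite !ffunE; case: (unliftP i j) => [k ->|->].
    by rewrite -[\sum_u _](ffunE (fun v => \sum_u combination pr y u * ins u v)) insE prE mulrAC subrK.
  by rewrite -[\sum_u _](ffunE (fun v => \sum_u combination pr y u * ins u v)) ins0 add0r divfK.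
exists (fun x => combination pr (f x)), (fun y => drop_coord v (g (combination ins y))); split.
- apply: (@pl_comp _ _ _ _ _ (@all_vec R 'I_n.+1)) => //; last exact: pl_comb.
  by apply: pl_sub fpl => x /cone_link[].
- apply: (@pl_comp _ _ _ _ _ (coneT K [set v])) => [y _|//|]; first by have [] := gP (combination ins y).
    by apply: (@pl_comp _ _ _ _ _ (@all_vec R 'I_n.+1)) => //; exact: pl_comb.
  by apply: eq_pl (pl_comb _ _) => x _; rewrite drop_coordE.
- move=> x /cone_link[Kx xv]; split=> //.
  have := ins_pr (f x) => /(congr1 g); rewrite ge fP // => /(congr1 (drop_coord v)).
  rewrite drop_coord_unit => <-; apply/ffunP => w; rewrite ffunE; case: eqP => // ->; exact/esym.
move=> y _; have [Kg fg] := gP (combination ins y); split; first exact: cone_drop.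
have := fg; rewrite {1}[g _](drop_coord_add v) fe; last by case/cone_link: (cone_drop Kg).
by move=> /(congr1 (combination pr)); rewrite combD pr_q addr0 pr_ins.
Qed.

End Links.

End ConeIso.

(** * Invariance under piecewise linear isomorphism, relabelling and gluing *)

Section Relabelling.
Variable R : realType.
Local Notation vec V := {ffun V -> R}.

(** The unit vector of [v] is carried to a point [q] of the open simplex [supp q], and
    differentiating there identifies the two tangent cones. The cone at [q] arises as well from the
    tangent cone at a vertex [w] of [supp q], differentiated once more at [q]. *)
Lemma coneT_all_vec_invariant n (V W : finType) (K : {set {set V}}) (L : {set {set W}}) :
  is_complex K -> is_complex L -> iso (@cone R V K) (@cone R W L) ->
  (forall w, [set w] \in L -> iso (@coneT R W L [set w]) (@all_vec R 'I_n)) ->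
  forall v, [set v] \in K -> iso (@coneT R V K [set v]) (@all_vec R 'I_n).
Proof.
move=> KC LC [f [g fg]] HL v vK; have [fpl gpl fP gP] := fg.
pose e : vec V := unitv R v.
have Ke : cone K e.
  by apply/coneP; rewrite supp_unit; split=> // w; rewrite ffunE ler0n.
have [Lq gq] := fP _ Ke; set q := f e in Lq gq.
have [w wq] : exists w, w \in supp q.
  apply/set0Pn; apply/negP => /eqP q0.
  have {}q0 : q = 0 by apply/ffunP => w; rewrite ffunE; apply/suppP; rewrite q0 inE.
  have := gq; rewrite q0 (pl0 gpl); last exact: cone0.
  by move=> /ffunP/(_ v); rewrite !ffunE eqxx => /eqP; rewrite eq_sym oner_eq0.
have [q0 qL] := (coneP _ _).1 Lq.
have wL : [set w] \in L by apply: (face_sub LC qL); rewrite sub1set.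
have wq' : [set w] :|: supp q = supp q by apply/setUidPr; rewrite sub1set.
have Lwq : coneT L [set w] q by split=> [u _|]; [exact: q0 | rewrite wq'].
have [f1 [g1 [iso1 _]]] := tangent_iso fg (@coneT_conical _ _ _ _) (@coneT_conical _ _ _ _) Ke
  (coneT_conic KC Ke) (coneT_conic LC Lq).
have [f2 [g2 fg2]] := HL w wL.
have [f3 [g3 [iso3 _]]] := tangent_iso fg2 (@coneT_conical _ _ _ _) (@all_vec_conical _ _) Lwq
  (coneT_conic LC Lwq) (@all_vec_conic _ _ _).
have I1 : iso (@coneT R V K [set v]) (@coneT R W L (supp q)).
  apply: iso_ext (ex_intro _ _ (ex_intro _ _ iso1)) => x.
    by rewrite (coneT_tangent KC _ Ke) set0U supp_unit.
  by rewrite (coneT_tangent LC _ Lq) set0U.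
apply: iso_trans I1 _; apply: iso_ext (ex_intro _ _ (ex_intro _ _ iso3)) => x.
  by rewrite (coneT_tangent LC _ Lwq) wq'.
exact: all_vec_tangent.
Qed.

Lemma imset_complex (U W : finType) (e : U -> W) (K : {set {set U}}) :
  is_complex K -> is_complex [set e @: s | s : {set U} in K].
Proof.
move=> [K0 KC]; split; first by apply/imsetP; exists set0; rewrite ?imset0.
move=> _ t /imsetP[s sK ->] ts; apply/imsetP; exists [set u in s | e u \in t].
  by apply: KC sK _; apply/subsetP => u; rewrite inE => /andP[].
apply/setP => w; apply/idP/imsetP => [wt|[u]]; last by rewrite inE => /andP[_ ?] ->.
by have /imsetP[u us wu] := subsetP ts w wt; exists u; rewrite // inE us -wu.
Qed.

Definition push (U W : finType) (e : U -> W) (x : vec U) : vec W :=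
  combination (fun u => unitv R (e u)) x.

Section Push.
Variables (U W : finType) (e : U -> W).
Hypothesis eI : injective e.

Lemma pushE (x : vec U) u : push e x (e u) = x u.
Proof.
rewrite ffunE (bigD1 u) //= ffunE eqxx mulr1 big1 ?addr0 // => u' u'u.
by rewrite ffunE (inj_eq eI) eq_sym (negPf u'u) mulr0.
Qed.

Lemma push_out (x : vec U) w : w \notin codom e -> push e x w = 0.
Proof.
move=> we; rewrite ffunE big1 // => u _; rewrite ffunE.
by case: eqP => [wu|]; rewrite ?mulr0 //; case/negP: we; rewrite wu codom_f.
Qed.

Lemma supp_push (x : vec U) : supp (push e x) = e @: supp x.
Proof.
apply/setP => w; apply/idP/imsetP => [|[u ux ->]]; last by rewrite inE pushE; rewrite inE in ux.
rewrite inE; have [/codomP[u ->]|/push_out->] := boolP (w \in codom e); last by rewrite eqxx.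
by rewrite pushE => xu; exists u; rewrite ?inE.
Qed.

Lemma push_inj : injective (push e).
Proof. by move=> x y xy; apply/ffunP => u; rewrite -!pushE xy. Qed.

Lemma push_ge0 (x : vec U) : (forall u, 0 <= x u) -> forall w, 0 <= push e x w.
Proof. by move=> x0 w; apply: comb_ge0 => // u _; rewrite ffunE ler0n. Qed.

Lemma cone_push (K : {set {set U}}) (y : vec W) :
  cone [set e @: s | s : {set U} in K] y <-> exists2 x, cone K x & y = push e x.
Proof.
split=> [/coneP[y0 /imsetP[s sK ys]]|[x /coneP[x0 xK] ->]]; last first.
  by apply/coneP; split; [exact: push_ge0 | rewrite supp_push; exact: imset_f].
pose x : vec U := [ffun u => y (e u)].
have yx : y = push e x.
  apply/ffunP => w; have [/codomP[u ->]|wn] := boolP (w \in codom e); first by rewrite pushE ffunE.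
  rewrite push_out //; apply/suppP; rewrite ys; apply: contra wn => /imsetP[u _ ->]; exact: codom_f.
exists x => //; apply/coneP; split=> [u|]; first by rewrite ffunE.
by move: ys; rewrite yx supp_push => /(imset_inj eI) ->.
Qed.

Lemma push_iso (K : {set {set U}}) : is_complex K ->
  exists g, isof (cone K) (cone [set e @: s | s : {set U} in K]) (push e) g.
Proof.
move=> KC; apply: comb_iso => // [x Kx|x y _ _|_ /cone_push[x Kx ->]]; last by exists x.
  by apply/cone_push; exists x.
exact: push_inj.
Qed.

End Push.

(** An additive set inside the cone over [K0] lies in the cone of a single face, hence in one of the
    pieces, so the functionals and linear maps of all the pieces suffice. *)
Lemma pl_glue (I U W : finType) (K : I -> {set {set U}}) (K0 : {set {set U}})
    (f : I -> vec U -> vec W) (h : vec U -> vec W) :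
  is_complex K0 -> (forall s, s \in K0 <-> exists i, s \in K i) ->
  (forall i, is_complex (K i)) -> (forall i, pl (cone (K i)) (f i)) ->
  (forall i x, cone (K i) x -> h x = f i x) -> pl (cone K0) h.
Proof.
move=> K0C K0E KC fpl hf.
have /choice[hA hAP] : forall i, exists hA : seq (vec U) * seq {ffun U -> vec W},
    forall C : vec U -> Prop, (forall x, C x -> cone (K i) x) -> additive_set C ->
      signed hA.1 C -> exists2 A, A \in hA.2 & forall x, C x -> f i x = combination A x.
  by move=> i; have [hs [As H]] := fpl i; exists (hs, As).
exists (flatten [seq (hA i).1 | i : I]), ([ffun=> 0] :: flatten [seq (hA i).2 | i : I]).
move=> C CK Ca Cs.
have [[x0 Cx0]|noC] := pselect (exists x, C x); last first.
  by exists [ffun=> 0]; rewrite ?inE ?eqxx // => x Cx; case: noC; exists x.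
have [s sK Csub] := additive_in_face CK Ca (ex_intro _ _ Cx0).
have [i si] := (K0E s).1 sK.
have CKi x : C x -> cone (K i) x.
  by move=> Cx; apply: (cone_face (KC i) si); [exact: cone_ge0 (CK _ Cx) | exact: Csub].
have [A Ain fA] : exists2 A, A \in (hA i).2 & forall x, C x -> f i x = combination A x.
  apply: hAP => //; apply: signed_sub Cs => h0 hin.
  by apply/flattenP; exists (hA i).1 => //; exact: image_f.
exists A; last by move=> x Cx; rewrite (hf i) ?fA //; auto.
by rewrite inE; apply/orP; right; apply/flattenP; exists (hA i).2 => //; exact: image_f.
Qed.

Lemma iso_glue (I U W : finType) (K : I -> {set {set U}}) (L : I -> {set {set W}})
    (K0 : {set {set U}}) (L0 : {set {set W}}) (f : I -> vec U -> vec W) (g : I -> vec W -> vec U) :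
  is_complex K0 -> is_complex L0 ->
  (forall s, s \in K0 <-> exists i, s \in K i) -> (forall s, s \in L0 <-> exists i, s \in L i) ->
  (forall i, is_complex (K i)) -> (forall i, is_complex (L i)) ->
  (forall i, isof (cone (K i)) (cone (L i)) (f i) (g i)) ->
  (forall i j x, cone (K i) x -> cone (K j) x -> f i x = f j x) ->
  (forall i j y, cone (L i) y -> cone (L j) y -> g i y = g j y) ->
  iso (@cone R U K0) (@cone R W L0).
Proof.
move=> K0C L0C KE LE KC LC fg fE gE.
have cK (x : vec U) : cone K0 x <-> exists i, cone (K i) x.
  split=> [/coneP[x0 /KE[i xi]]|[i /coneP[x0 xi]]]; first by exists i; apply/coneP.
  by apply/coneP; split=> //; apply/KE; exists i.
have cL (x : vec W) : cone L0 x <-> exists i, cone (L i) x.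
  split=> [/coneP[x0 /LE[i xi]]|[i /coneP[x0 xi]]]; first by exists i; apply/coneP.
  by apply/coneP; split=> //; apply/LE; exists i.
have /choice[F FP] : forall x, exists y, forall i, cone (K i) x -> y = f i x.
  move=> x; have [[i xi]|nx] := pselect (exists i, cone (K i) x).
    by exists (f i x) => j xj; apply: fE.
  by exists 0 => i xi; case: nx; exists i.
have /choice[G GP] : forall y, exists x, forall i, cone (L i) y -> x = g i y.
  move=> x; have [[i xi]|nx] := pselect (exists i, cone (L i) x).
    by exists (g i x) => j xj; apply: gE.
  by exists 0 => i xi; case: nx; exists i.
exists F, G; split.
- by apply: (pl_glue K0C KE KC (f := f)) => [i|i x]; [have [] := fg i | exact: FP].
- by apply: (pl_glue L0C LE LC (f := g)) => [i|i x]; [have [] := fg i | exact: GP].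
- move=> x /cK[i xi]; have [_ _ /(_ _ xi)[Lx gx] _] := fg i.
  by rewrite (FP _ _ xi); split; [apply/cL; exists i | rewrite (GP _ _ Lx)].
- move=> x /cL[i xi]; have [_ _ _ /(_ _ xi)[Lx gx]] := fg i.
  by rewrite (GP _ _ xi); split; [apply/cK; exists i | rewrite (FP _ _ Lx)].
Qed.

End Relabelling.

(** * Simplicial refinements *)

Section Refinement.
Variable R : realType.
Local Notation vec V := {ffun V -> R}.

(** The conical form of [subdivision]. The vectors [a u] are not normalized, so new vertices can be
    placed by linear formulas; [subdivision_of_refines] normalizes them at the end. *)
Definition refines (U V : finType) (K : {set {set V}}) (M : {set {set U}}) (a : U -> vec V) :=
  [/\ is_complex M, forall x, cone M x -> cone K (combination a x),
      forall x y, cone M x -> cone M y -> combination a x = combination a y -> x = y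
    & forall z, cone K z -> exists2 x, cone M x & combination a x = z].

Lemma refines_id (V : finType) (K : {set {set V}}) : is_complex K -> refines K K (@unitv R V).
Proof.
by move=> KC; split=> // [x|x y _ _|z Kz]; rewrite ?comb_delta //; exists z; rewrite ?comb_delta.
Qed.

Lemma refines_trans (U U' V : finType) (K : {set {set V}}) (M : {set {set U}}) (M' : {set {set U'}})
    (a : U -> vec V) (b : U' -> vec U) :
  refines K M a -> refines M M' b -> refines K M' (fun u => combination a (b u)).
Proof.
move=> [MC aM aI aS] [MC' bM bI bS].
split=> // [x Mx|x y Mx My|z /aS[y /bS[x Mx <-] <-]]; rewrite -?comb_comb; auto.
by exists x; rewrite // comb_comb.
Qed.

Section EdgeSubdivision.
Variables (U : finType) (M : {set {set U}}) (u w : U) (al be : R).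
Hypotheses (MC : is_complex M) (uw : u != w) (al0 : 0 < al) (be0 : 0 < be).

Definition old_vertices (s : {set option U}) : {set U} := [set z | Some z \in s].

(** The stellar subdivision of the edge, with [None] as its new vertex: no simplex contains both
    ends, and a simplex containing [None] comes from a simplex of [M] containing the edge. *)
Definition edge_subdivision : {set {set option U}} :=
  [set s : {set option U} | ~~ ([set u; w] \subset old_vertices s) &&
    ((if None \in s then [set u; w] :|: old_vertices s else old_vertices s) \in M)].

Definition edge_map (z : option U) : vec U :=
  if z is Some z then unitv R z else scale al (unitv R u) + scale be (unitv R w).

Lemma edge_mapE x z : combination edge_map x z =
  x (Some z) + (if z == u then al * x None else if z == w then be * x None else 0).
Proof.
rewrite ffunE (bigD1 None) //= addrC; congr (_ + _); last first.
  rewrite !ffunE; case: eqP => [->|_]; first by rewrite (negPf uw) mulr1 mulr0 addr0 mulrC.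
  by case: eqP; rewrite ?mulr0 ?mulr1 ?add0r ?mulr0 // mulrC.
rewrite (bigD1 (Some z)) //= ffunE eqxx mulr1 big1 ?addr0 // => -[y|] //= yz.
have /negPf zy : z != y by apply: contraNneq yz => ->.
by rewrite ffunE zy mulr0.
Qed.

Lemma edge_subdivision_complex : [set u; w] \in M -> is_complex edge_subdivision.
Proof.
move=> eM; split.
  rewrite inE in_set0; have -> : old_vertices set0 = set0 by apply/setP => z; rewrite !inE.
  case: MC => -> _; rewrite andbT; apply/negP => /subsetP/(_ u).
  by rewrite !inE eqxx => /(_ isT).
move=> s t; rewrite !inE => /andP[es sM] ts.
have ots : old_vertices t \subset old_vertices s.
  by apply/subsetP => z; rewrite !inE => /(subsetP ts).
rewrite (contra _ es) /=; last by move=> /subset_trans/(_ ots).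
case: ifP => [/(subsetP ts) Ns|_].
  by move: sM; rewrite Ns => /face_sub; apply=> //; exact: setUS.
by apply: (face_sub MC sM); case: ifP => _ //; apply: subset_trans ots (subsetUr _ _).
Qed.

Lemma refines_edge_subdivision : [set u; w] \in M -> refines M edge_subdivision edge_map.
Proof.
move=> eM; have M'C := edge_subdivision_complex eM.
split=> // [x /coneP[x0 xM]|x y /coneP[x0 xM] /coneP[y0 yM] xy|z /coneP[z0 zM]].
- apply/coneP; split=> [z|].
    by rewrite edge_mapE addr_ge0 //; do 2?case: ifP => _ //; rewrite mulr_ge0 // ltW.
  move: xM; rewrite inE => /andP[_ xM]; apply: (face_sub MC xM).
  apply/subsetP => z; rewrite inE edge_mapE; have [xN|/suppP xN] := boolP (None \in supp x).
    by rewrite !inE; case: (z =P u) => //= _; case: (z =P w) => //= _; rewrite addr0.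
  by rewrite xN !mulr0 2!if_same addr0 inE [_ \in supp x]inE.
(* If [y'] had the larger coordinate at [None], both ends of the edge would have positive
   coordinates in [x'], which no simplex of the subdivision allows. *)
- have key (x' y' : vec (option U)) : supp x' \in edge_subdivision -> (forall z, 0 <= y' z) ->
      combination edge_map x' = combination edge_map y' -> x' None >= y' None.
    rewrite inE => /andP[xe _] y'0 xy'; rewrite leNgt -subr_gt0; apply/negP => lt.
    have xu := congr1 (fun g : vec U => g u) xy'; have xw := congr1 (fun g : vec U => g w) xy'.
    move: xu xw; rewrite /= !edge_mapE !eqxx [w == u]eq_sym (negPf uw) => xu xw.
    case/negP: xe; apply/subsetP => z; rewrite !inE => /orP[]/eqP->; apply/eqP => x'0.
      have := mulr_gt0 al0 lt; move: xu; rewrite x'0; have := y'0 (Some u); lra.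
    have := mulr_gt0 be0 lt; move: xw; rewrite x'0; have := y'0 (Some w); lra.
  have xyN : x None = y None.
    by apply: le_anti; rewrite (key x y) // (key y x).
  apply/ffunP => -[z|] //.
  have := congr1 (fun g : vec U => g z) xy; rewrite /= !edge_mapE xyN; exact: addIr.
(* The largest multiple of the new vertex that can be split off from [z]; it exhausts the coordinate
   at one end of the edge. *)
pose t := Num.min (z u / al) (z w / be).
have t0 : 0 <= t by rewrite le_min !divr_ge0 // ltW.
have tu : al * t <= z u by rewrite mulrC -ler_pdivlMr // ge_min lexx.
have tw : be * t <= z w by rewrite mulrC -ler_pdivlMr // ge_min lexx orbT.
pose x : vec (option U) := [ffun y => if y is Some y then
  z y - (if y == u then al * t else if y == w then be * t else 0) else t].
exists x; last by apply/ffunP => y; rewrite edge_mapE !ffunE subrK.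
apply/coneP; split=> [[y|]|]; rewrite ?ffunE //.
  by case: eqP => [->|_]; [|case: eqP => [->|_]]; rewrite ?subr_ge0 // subr0.
have zsub : old_vertices (supp x) \subset supp z.
  apply/subsetP => y; rewrite !inE ffunE; apply: contra_neq => zy.
  have := tu; have := tw; case: eqP => [yu|_]; last case: eqP => [yw|_].
  - rewrite -yu zy => _; have := mulr_ge0 (ltW al0) t0; lra.
  - rewrite -yw zy; have := mulr_ge0 (ltW be0) t0; lra.
  - by rewrite zy subr0.
rewrite inE; apply/andP; split.
  apply/negP => /subsetP es; have := es u; have := es w.
  rewrite !inE !ffunE !eqxx [w == u]eq_sym (negPf uw) orbT => /(_ isT) xw /(_ isT) xu.
  have [tE|tE] : t = z u / al \/ t = z w / be by rewrite /t; case: leP; auto.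
    have E : al * t = z u by rewrite tE mulrC divfK // gt_eqF.
    by rewrite E subrr eqxx in xu.
  have E : be * t = z w by rewrite tE mulrC divfK // gt_eqF.
  by rewrite E subrr eqxx in xw.
rewrite inE ffunE; case: ifP => [tn0|_]; last exact: face_sub zM zsub.
have tp : 0 < t by rewrite lt_def tn0.
apply: (face_sub MC zM); rewrite subUset zsub andbT; apply/subsetP => y.
rewrite !inE => /orP[]/eqP->; rewrite gt_eqF //.
  by apply: lt_le_trans tu; rewrite mulr_gt0.
by apply: lt_le_trans tw; rewrite mulr_gt0.
Qed.

End EdgeSubdivision.

Definition sign_fits (U V : finType) (M : {set {set U}}) (a : U -> vec V) (h : vec V) : Prop :=
  forall s u w, s \in M -> u \in s -> w \in s -> 0 < dot h (a u) -> 0 <= dot h (a w).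

(** An edge on which [h] changes sign is subdivided at the zero of [h]. The new vertex belongs to no
    bad pair, so the number of bad pairs drops, and functionals that fitted before still do because
    the new vertex is a positive combination of the two ends. The clause on cardinalities keeps the
    dimension for [face_card_le]. *)
Lemma refine_sign (V : finType) (K : {set {set V}}) (h : vec V) (U : finType)
    (M : {set {set U}}) (a : U -> vec V) : refines K M a ->
  exists (U' : finType) (M' : {set {set U'}}) (a' : U' -> vec V),
    [/\ refines K M' a', sign_fits M' a' h, forall k, sign_fits M a k -> sign_fits M' a' k
      & forall s, s \in M -> exists2 s', s' \in M' & (#|s| <= #|s'|)%N].
Proof.
pose bad (T : finType) (L : {set {set T}}) (b : T -> vec V) :=
  [set p : T * T | ([set p.1; p.2] \in L) && ((0 < dot h (b p.1)) && (dot h (b p.2) < 0))].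
have [N] := ubnP #|bad U M a|; elim: N U M a => // N IH U M a badN KM; have [MC _ _ _] := KM.
have [bad0|[[u w]]] := set_0Vmem (bad U M a).
  exists U, M, a; split=> // [s u w sM us ws hu|s sM]; last by exists s.
  rewrite leNgt; apply/negP => hw.
  have : (u, w) \in bad U M a.
    by rewrite inE hu hw (face_sub MC sM) // subUset !sub1set us.
  by rewrite bad0 inE.
move=> uwbad; have := uwbad; rewrite inE /= => /and3P[eM hu hw].
have uw : u != w by apply: contraTneq hu => ->; rewrite -leNgt ltW.
(* With these coefficients [h] takes the value - h(w) h(u) + h(u) h(w) = 0 at the new vertex. *)
pose al := - dot h (a w); pose be := dot h (a u).
have [al0 be0] : 0 < al /\ 0 < be by rewrite oppr_gt0.
have ref := refines_edge_subdivision MC uw al0 be0 eM.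
have := IH _ _ _ _ (refines_trans KM ref).
set M1 := edge_subdivision M u w; set a1 := fun z => combination a _.
have a1S z : a1 (Some z) = a z by rewrite /a1 comb_unit.
have a1N : a1 None = scale al (a u) + scale be (a w) by rewrite /a1 combD !combZ !comb_unit.
have h1N k : dot k (a1 None) = al * dot k (a u) + be * dot k (a w).
  by rewrite a1N dotD !dotZ.
case=> [|U' [M' [a' [ref' fit' keep' size']]]].
  rewrite -ltnS; apply: leq_trans badN; rewrite ltnS.
  rewrite (cardsD1 (u, w) (bad U M a)) uwbad add1n ltnS.
  pose e (p : U * U) := (Some p.1, Some p.2).
  rewrite -(card_imset (mem (bad U M a :\ (u, w))) (f := e)); last first.
    by move=> [? ?] [? ?] [-> ->].
  apply/subset_leq_card/subsetP => -[y z]; rewrite !inE /= => /andP[yzM /andP[hy hz]].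
  have h0 : dot h (a1 None) = 0 by rewrite h1N /al /be; lra.
  case: y z hy hz yzM => [y|] [z|]; rewrite ?h0 ?ltxx //; rewrite !a1S => hy hz.
  have yz : old_vertices [set Some y; Some z] = [set y; z] by apply/setP => t; rewrite !inE.
  rewrite yz /= => /andP[ne yzM]; apply/imsetP; exists (y, z) => //.
  rewrite !inE yzM hy hz !andbT; apply: contra ne => /eqP[-> ->]; exact: subxx.
exists U', M', a'; split=> // [k fit|s sM].
  apply: keep' => s x y; rewrite /M1 inE => /andP[_].
  have fitS t x' y' : t \in M -> x' \in t -> y' \in t -> 0 < dot k (a x') -> 0 <= dot k (a y').
    by move=> tM xt yt; exact: fit tM xt yt.
  case: ifP => Ns sM; last first.
    case: x y => [x|] [y|]; rewrite ?Ns // => xs ys; rewrite !a1S.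
    by apply: fitS sM _ _; rewrite inE.
  set t := _ :|: _ in sM.
  have [ut wt] : u \in t /\ w \in t by rewrite !inE !eqxx orbT.
  have ts z : Some z \in s -> z \in t by move=> zs; rewrite !inE zs !orbT.
  case: x y => [x|] [y|] // xs ys; rewrite ?h1N ?a1S.
  - by apply: fitS sM _ _; exact: ts.
  - by move=> kx; rewrite addr_ge0 // mulr_ge0 ?(fitS _ _ _ sM (ts _ xs) _ kx) // ltW.
  - case: (ltrP 0 (dot k (a u))) => ku; first by move=> _; exact: (fitS _ _ _ sM ut (ts _ ys) ku).
    case: (ltrP 0 (dot k (a w))) => kw; first by move=> _; exact: (fitS _ _ _ sM wt (ts _ ys) kw).
    by nra.
  - exact: ltW.
have [s1 s1M ss1] : exists2 s1, s1 \in M1 & (#|s| <= #|s1|)%N.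
  have old1 (t : {set U}) : old_vertices (Some @: t) = t.
    by apply/setP => z; rewrite inE mem_imset //; exact: Some_inj.
  have N1 (t : {set U}) : None \notin Some @: t by apply/imsetP => -[].
  have [es|es] := boolP ([set u; w] \subset s); last first.
    exists (Some @: s); last by rewrite card_imset //; exact: Some_inj.
    by rewrite /M1 inE old1 es (negPf (N1 _)).
  have oldD : old_vertices (None |: Some @: (s :\ u)) = s :\ u.
    by rewrite -[RHS]old1; apply/setP => z; rewrite !inE.
  have us : u \in s by apply: (subsetP es); rewrite !inE eqxx.
  (* A simplex containing the edge keeps its number of vertices when [None] replaces [u]. *)
  exists (None |: Some @: (s :\ u)).
    rewrite /M1 inE oldD !inE eqxx /=; apply/andP; split.
      by apply/negP => /subsetP/(_ u); rewrite !inE eqxx => /(_ isT).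
    apply: (face_sub MC sM); rewrite subUset es; exact: subD1set.
  rewrite cardsU1 N1 card_imset; last exact: Some_inj.
  by rewrite (cardsD1 u s) us.
by have [s' s'M s's] := size' _ s1M; exists s' => //; exact: leq_trans s's.
Qed.

End Refinement.

(** * Spheres and vector spaces *)

Section Spheres.
Variable R : realType.
Local Notation vec V := {ffun V -> R}.

Lemma refine_signs (V : finType) (K : {set {set V}}) (hs : seq (vec V)) : is_complex K ->
  exists (U : finType) (M : {set {set U}}) (a : U -> vec V),
    [/\ refines K M a, forall h, h \in hs -> sign_fits M a h
      & forall s, s \in K -> exists2 s', s' \in M & (#|s| <= #|s'|)%N].
Proof.
move=> KC; elim: hs => [|h hs [U [M [a [ref fit size]]]]].
  by exists V, K, (@unitv R V); split=> [||s sK]; [exact: refines_id | | exists s].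
have [U' [M' [a' [ref' fit' keep size']]]] := refine_sign h ref.
exists U', M', a'; split=> // [k|s /size[s1 /size'[s2 s2M s12] ss1]].
  by rewrite inE => /orP[/eqP->|/fit/keep].
by exists s2 => //; exact: leq_trans ss1 s12.
Qed.

Lemma supp_in_unit (V : finType) (s : {set V}) v : v \in s -> supp_in s (unitv R v).
Proof.
by move=> vs; split=> [w|]; [rewrite ffunE ler0n | rewrite supp_unit sub1set].
Qed.

Lemma supp_in_cone (V : finType) (K : {set {set V}}) s (x : vec V) :
  is_complex K -> s \in K -> supp_in s x -> cone K x.
Proof. by move=> KC sK [x0 xs]; exact: (cone_face KC sK). Qed.

(** Once every functional of [f] fits [M], none changes sign on the cone of a simplex, so [f] is a
    single linear map there. *)
Lemma pl_linear_refinement (V W : finType) (K : {set {set V}}) (f : vec V -> vec W) :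
  is_complex K -> pl (cone K) f ->
  exists (U : finType) (M : {set {set U}}) (a : U -> vec V),
    [/\ refines K M a, forall x, cone M x -> f (combination a x) = combination (fun u => f (a u)) x
      & forall s, s \in K -> exists2 s', s' \in M & (#|s| <= #|s'|)%N].
Proof.
move=> KC [hs [As H]]; have [U [M [a [ref fit size]]]] := refine_signs hs KC.
exists U, M, a; split=> // x /coneP[x0 xM]; have [MC aM _ _] := ref.
pose s := supp x.
have [|||A _ fA] := H (fun z => exists2 y, supp_in s y & z = combination a y).
- by move=> _ [y ys ->]; apply: aM; exact: supp_in_cone ys.
- move=> _ _ [y [y0 ys] ->] [y' [y0' ys'] ->]; exists (y + y'); rewrite ?combD //; split.
    by move=> u; rewrite ffunE addr_ge0.
  by apply: subset_trans (suppD _ _) _; rewrite subUset ys.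
- move=> h hin.
  have dotE y : supp_in s y -> dot h (combination a y) = \sum_(u in s) dot h (a u) * y u.
    move=> [_ ys]; rewrite dot_comb /dot [LHS](bigID (mem s)) /= [X in _ + X]big1 ?addr0.
      by apply: eq_bigr => u _; rewrite ffunE.
    by move=> u us; rewrite (suppP y u _) ?mulr0 //; apply: contra us; exact: (subsetP ys).
  have [[u [us hu]]|no] := pselect (exists u, u \in s /\ 0 < dot h (a u)).
    left=> _ [y ys ->]; rewrite dotE //; apply: sumr_ge0 => w ws; apply: mulr_ge0; last by case: ys.
    exact: (fit _ hin _ _ _ xM us ws hu).
  right=> _ [y ys ->]; rewrite dotE //; apply: sumr_le0 => w ws.
  apply: mulr_le0_ge0; last by case: ys.
  by rewrite leNgt; apply/negP => hw; apply: no; exists w.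
rewrite fA; last by exists x.
rewrite comb_comb; apply: eq_comb => u xu; rewrite fA //.
by exists (unitv R u); [apply: supp_in_unit; rewrite inE | rewrite comb_unit].
Qed.

Lemma comb_inj_card (U W : finType) (s : {set U}) (a : U -> vec W) :
  (forall x y, supp_in s x -> supp_in s y -> combination a x = combination a y -> x = y) ->
  (#|s| <= #|W|)%N.
Proof.
move=> inj; rewrite leqNgt; apply/negP => lt.
pose A : 'M[R]_(#|s|, #|W|) := \matrix_(i, j) a (enum_val i) (enum_val j).
have : kermx A != 0.
  rewrite kermx_eq0; apply/negP => /eqP rk; have := rank_leq_col A.
  by rewrite rk leqNgt lt.
case/rowV0Pn => k kA k0; move/sub_kermxP: kA => kA.
pose y : vec U := [ffun u => \sum_(i | enum_val i == u) k 0 i].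
have yE (i : 'I_#|s|) : y (enum_val i) = k 0 i.
  by rewrite ffunE (eq_bigl (pred1 i)) ?big_pred1_eq // => j /=; rewrite (inj_eq enum_val_inj).
have yout u : u \notin s -> y u = 0.
  move=> us; rewrite ffunE big_pred0 // => i; apply: contraNF us => /eqP<-; exact: enum_valP.
have y0 : combination a y = 0.
  apply/ffunP => w; rewrite !ffunE.
  have := congr1 (fun v : 'rV[R]__ => v 0 (enum_rank w)) kA; rewrite /= mxE [RHS]mxE => kAw.
  rewrite -[RHS]kAw.
  rewrite (bigID (mem s)) /= [X in _ + X]big1 ?addr0; last by move=> u /yout->; rewrite mul0r.
  by rewrite big_enum_val /=; apply: eq_bigr => i _; rewrite yE mxE enum_rankK.
pose yp : vec U := [ffun u => Num.max 0 (y u)].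
pose ym : vec U := [ffun u => Num.max 0 (- y u)].
have ypm : y = yp - ym by apply/ffunP => u; rewrite !ffunE max_subN.
have yps : supp_in s yp.
  split=> [u|]; first by rewrite ffunE le_max lexx.
  by apply/subsetP => u; rewrite inE ffunE; apply: contraNT => /yout->; rewrite maxxx.
have yms : supp_in s ym.
  split=> [u|]; first by rewrite ffunE le_max lexx.
  by apply/subsetP => u; rewrite inE ffunE; apply: contraNT => /yout->; rewrite oppr0 maxxx.
have yz : y = 0.
  rewrite ypm (inj _ _ yps yms) ?subrr //; apply/eqP.
  by rewrite -subr_eq0 -combB -ypm y0.
by case/eqP: k0; apply/rowP => i; rewrite -yE yz mxE ffunE.
Qed.

(** The piecewise linear form of invariance of dimension: after refinement [f] is linear and
    injective on the cone of a simplex with at least as many vertices as [s], whose images are then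
    linearly independent. *)
Lemma face_card_le (V W : finType) (K : {set {set V}}) (f : vec V -> vec W) s :
  is_complex K -> pl (cone K) f ->
  (forall x y, cone K x -> cone K y -> f x = f y -> x = y) -> s \in K -> (#|s| <= #|W|)%N.
Proof.
move=> KC fpl finj sK; have [U [M [a [[MC aM aI aS] lin size]]]] := pl_linear_refinement KC fpl.
have [s' s'M ss'] := size s sK; apply: leq_trans ss' _.
apply: (@comb_inj_card _ _ _ (fun u => f (a u))) => x y xs ys.
have Mx := supp_in_cone MC s'M xs; have My := supp_in_cone MC s'M ys.
by rewrite -!lin // => /finj/aI; apply; auto.
Qed.

(** A realization consists of the points with coordinate sum 1, so the vectors are divided by their
    sums. This only multiplies the coefficients by positive factors, which [d] absorbs. *)
Lemma subdivision_of_refines (U V : finType) (K : {set {set V}}) (M : {set {set U}}) (a : U -> vec V) :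
  is_complex K -> refines K M a ->
  subdivision K M (fun u => scale (\sum_v a u v)^-1 (a u)).
Proof.
move=> KC [MC aM aI aS].
pose b u := scale (\sum_v a u v)^-1 (a u).
have Ku s u : s \in M -> u \in s -> cone K (a u).
  move=> sM us; rewrite -(comb_unit a u); apply: aM.
  by apply: (supp_in_cone MC sM); exact: supp_in_unit.
have au0 s u : s \in M -> u \in s -> 0 < \sum_v a u v.
  move=> sM us; rewrite lt_def sumr_ge0 ?andbT; last by move=> v _; exact: cone_ge0 (Ku _ _ sM us) v.
  apply/eqP => sum0.
  have a0 : a u = 0.
    apply/ffunP => v; rewrite ffunE; apply/eqP; move/eqP: sum0; rewrite psumr_eq0.
      by move/allP/(_ v); rewrite mem_index_enum => /(_ isT).
    by move=> w _; exact: cone_ge0 (Ku _ _ sM us) w.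
  have : unitv R u = 0.
    apply: aI; [|exact: cone0|by rewrite comb_unit comb0].
    by apply: (supp_in_cone MC sM); exact: supp_in_unit.
  by move=> /ffunP/(_ u); rewrite !ffunE eqxx => /eqP; rewrite oner_eq0.
pose d (x : vec U) : vec U := [ffun u => x u * (\sum_v a u v)^-1].
have bE x : combination b x = combination a (d x).
  by apply/ffunP => v; rewrite !ffunE; apply: eq_bigr => u _; rewrite !ffunE mulrA.
have dM x : cone M x -> cone M (d x).
  move=> /coneP[x0 xM]; apply: (cone_face MC xM) => [u|]; last first.
    by apply/subsetP => u; rewrite !inE ffunE; apply: contra_neq => ->; rewrite mul0r.
  rewrite ffunE; have [us|/suppP->] := boolP (u \in supp x); last by rewrite mul0r.
  by rewrite mulr_ge0 // invr_ge0 ltW // (au0 _ _ xM).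
have bsum x : cone M x -> \sum_v combination b x v = \sum_u x u.
  move=> /coneP[x0 xM]; under eq_bigr do rewrite ffunE.
  rewrite exchange_big; apply: eq_bigr => u _; rewrite -mulr_sumr.
  have [us|/suppP->] := boolP (u \in supp x); last by rewrite !mul0r.
  under eq_bigr do rewrite ffunE.
  by rewrite -mulr_sumr mulVf ?mulr1 // gt_eqF // (au0 _ _ xM).
have realE (T : finType) (L : {set {set T}}) (x : vec T) :
    realization L x <-> cone L x /\ \sum_v x v = 1.
  split=> [[x0 x1 xL]|[/coneP[x0 xL] x1]]; last by split.
  by split=> //; apply/coneP.
split=> // [s sM|].
  pose x : vec U := [ffun u => (u \in s)%:R].
  have xs : supp_in s x.
    split=> [u|]; first by rewrite ffunE ler0n.
    by apply/subsetP => u; rewrite inE ffunE pnatr_eq0 eqb0 negbK.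
  have /coneP[_ axK] := aM _ (supp_in_cone MC sM xs).
  exists (supp (combination a x)) => // u v us; rewrite ffunE => auv.
  have {}auv : a u v != 0 by apply: contra_neq auv => ->; rewrite mulr0.
  rewrite inE ffunE (bigD1 u) //= gt_eqF // ltr_wpDr //.
    apply: sumr_ge0 => w _; rewrite ffunE; case: (boolP (w \in s)) => ws; last by rewrite mul0r.
    by rewrite mul1r; exact: cone_ge0 (Ku _ _ sM ws) v.
  by rewrite ffunE us mul1r lt_def auv; exact: cone_ge0 (Ku _ _ sM us) v.
split.
- move=> x /realE[Mx x1]; apply/realE; rewrite bsum //; split=> //.
  by rewrite bE; apply/aM/dM.
- move=> x y /set_mem/realE[Mx x1] /set_mem/realE[My y1]; rewrite !bE => /(aI _ _ (dM _ Mx) (dM _ My)) dxy.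
  apply/ffunP => u; have [us|/suppP xu] := boolP (u \in supp x).
    have := congr1 (fun z : vec U => z u) dxy; rewrite !ffunE; apply: mulIf.
    by rewrite invr_eq0 gt_eqF // (au0 (supp x)) //; case/coneP: Mx.
  have [us|/suppP yu] := boolP (u \in supp y); last by rewrite xu yu.
  have := congr1 (fun z : vec U => z u) dxy; rewrite !ffunE; apply: mulIf.
  by rewrite invr_eq0 gt_eqF // (au0 (supp y)) //; case/coneP: My.
move=> z /realE[Kz z1]; have [x Mx xz] := aS z Kz.
pose y : vec U := [ffun u => x u * \sum_v a u v].
have [x0 xM] := (coneP _ _).1 Mx.
have My : cone M y.
  apply: (cone_face MC xM) => [u|].
    rewrite ffunE; have [us|/suppP->] := boolP (u \in supp x); last by rewrite mul0r.
    by rewrite mulr_ge0 // ltW // (au0 _ _ xM).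
  by apply/subsetP => u; rewrite !inE ffunE; apply: contra_neq => ->; rewrite mul0r.
have dy : d y = x.
  apply/ffunP => u; rewrite !ffunE; have [us|/suppP->] := boolP (u \in supp x); last by rewrite !mul0r.
  by rewrite mulfK // gt_eqF // (au0 _ _ xM).
exists y; last by rewrite bE dy.
by apply/realE; split=> //; rewrite -bsum // bE dy xz.
Qed.

End Spheres.

(** * Combinatorial spheres as complexes whose cone is R^n *)

Section RealizationCones.
Variable R : realType.
Local Notation vec V := {ffun V -> R}.

Lemma realizationP (T : finType) (L : {set {set T}}) (x : vec T) :
  realization L x <-> cone L x /\ \sum_v x v = 1.
Proof.
split=> [[x0 x1 xL]|[/coneP[x0 xL] x1]]; last by split.
by split=> //; apply/coneP.
Qed.

Lemma realization_unit (U : finType) (M : {set {set U}}) s u :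
  is_complex M -> s \in M -> u \in s -> realization M (unitv R u).
Proof.
move=> MC sM us; apply/realizationP; split; first by apply: (supp_in_cone MC sM); exact: supp_in_unit.
by rewrite (bigD1 u) //= ffunE eqxx big1 ?addr0 // => v /negPf vu; rewrite ffunE vu.
Qed.

Lemma pl_map_of_subdivisions (U V W : finType) (K : {set {set V}}) (L : {set {set W}})
    (M : {set {set U}}) (a : U -> vec V) (b : U -> vec W) :
  subdivision K M a -> subdivision L M b ->
  exists2 f, pl_map K L f & forall x, realization M x -> f (combination a x) = combination b x.
Proof.
move=> aS bS; have [MC aK [aM aI aJ]] := aS; have [_ bK [bM bI bJ]] := bS.
have /choice[f fP] : forall z, exists y, forall x, realization M x -> combination a x = z -> y = combination b x.
  move=> z; have [[x [Mx xz]]|no] := pselect (exists x, realization M x /\ combination a x = z).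
    exists (combination b x) => x' Mx' x'z; congr combination.
    by apply: aI; rewrite ?inE ?x'z //; exact/mem_set.
  by exists 0 => x Mx xz; case: no; exists x.
have fE x : realization M x -> f (combination a x) = combination b x.
  by move=> Mx; exact: fP.
exists f => //; split; first by move=> z /aJ[x Mx <-]; rewrite fE //; exact: bM.
exists U, M, a; split=> // x Mx; rewrite fE //; apply: eq_comb => u xu.
have Mu : realization M (unitv R u).
  have [_ _ xM] := Mx; by apply: realization_unit xM _ => //; rewrite inE.
by rewrite /= -[in RHS](comb_unit a u) fE // comb_unit.
Qed.

(** A refinement [M] of [K] on which [f] is linear is carried by [f] to a refinement of [L]; after
    normalization it is a common subdivision, from which both maps are read off. *)
Lemma pl_homeomorphic_of_iso (V W : finType) (K : {set {set V}}) (L : {set {set W}}) :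
  is_complex K -> is_complex L -> iso (@cone R V K) (@cone R W L) -> pl_homeomorphic R K L.
Proof.
move=> KC LC [f [g [fpl gpl fP gP]]].
have [U [M [a [KM lin _]]]] := pl_linear_refinement KC fpl; have [MC aM aI aS] := KM.
have LM : refines L M (fun u => f (a u)).
  split=> // [x Mx|x y Mx My|z Lz].
  - by rewrite -lin //; exact: (fP _ (aM _ Mx)).1.
  - rewrite -!lin // => /(congr1 g); rewrite !(fP _ _).2; auto.
  have [Kg gz] := gP z Lz; have [x Mx xz] := aS _ Kg.
  by exists x; rewrite // -lin // xz.
have aS' := subdivision_of_refines KC KM; have bS' := subdivision_of_refines LC LM.
have [f' f'pl f'E] := pl_map_of_subdivisions aS' bS'.
have [g' g'pl g'E] := pl_map_of_subdivisions bS' aS'.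
have [_ _ [_ _ aJ]] := aS'; have [_ _ [_ _ bJ]] := bS'.
exists f', g'; split=> // [_ /aJ[x Mx <-]|_ /bJ[x Mx <-]].
  by rewrite f'E ?g'E.
by rewrite g'E ?f'E.
Qed.

Lemma cone_realization (T : finType) (L : {set {set T}}) (x : vec T) : cone L x ->
  x = 0 \/ exists c y, [/\ 0 < c, realization L y & x = scale c y].
Proof.
move=> Lx; have [x0 xL] := (coneP _ _).1 Lx.
have [s0|s0] := eqVneq (\sum_v x v) 0.
  left; apply/ffunP => v; rewrite ffunE; apply/eqP; move/eqP: s0; rewrite psumr_eq0 //.
  by move/allP/(_ v); rewrite mem_index_enum => /(_ isT).
have sp : 0 < \sum_v x v by rewrite lt_def s0 sumr_ge0.
right; exists (\sum_v x v), (scale (\sum_v x v)^-1 x); split=> //.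
  apply/realizationP; split; first by apply: coneT_scale; rewrite ?invr_gt0.
  by under eq_bigr do rewrite ffunE; rewrite -mulr_sumr mulVf.
by rewrite scaleA divff // scale1.
Qed.

Lemma refines_of_subdivision (U V : finType) (K : {set {set V}}) (M : {set {set U}}) (a : U -> vec V) :
  is_complex K -> subdivision K M a -> refines K M a.
Proof.
move=> KC [MC _ [aM aI aJ]].
have sumE x : cone M x -> \sum_v combination a x v = \sum_u x u.
  move=> /cone_realization[->|[c [y [c0 My ->]]]].
    by rewrite comb0 !big1 // => u _; rewrite ffunE.
  have /realizationP[_ ay1] := aM _ My; have /realizationP[_ y1] := My.
  rewrite combZ; under eq_bigr do rewrite ffunE.
  under [in RHS]eq_bigr do rewrite ffunE.
  by rewrite -!mulr_sumr ay1 y1.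
split=> // [x /cone_realization[->|[c [y [c0 My ->]]]]|x y Mx My xy|z /cone_realization[->|[c [y [c0 /aJ[x Mx <-] ->]]]]].
- by rewrite comb0; exact: cone0.
- by rewrite combZ; apply: coneT_scale => //; have /realizationP[] := aM _ My.
- have sxy := sumE _ Mx; rewrite xy sumE // in sxy.
  have sum0 (c : R) (z : vec U) : realization M z -> \sum_u scale c z u = c.
    move=> /realizationP[_ z1]; under eq_bigr do rewrite ffunE.
    by rewrite -mulr_sumr z1 mulr1.
  have sum00 : \sum_(u : U) (0 : vec U) u = 0 by rewrite big1 // => u _; rewrite ffunE.
  case: (cone_realization Mx) xy sxy => [->|[c [x' [c0 Mx' ->]]]] xy;
  case: (cone_realization My) xy => [->//|[d [y' [d0 My' ->]]]] xy; rewrite ?sum0 ?sum00 //.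
  + by move=> d00; rewrite d00 ltxx in d0.
  + by move=> c00; rewrite -c00 ltxx in c0.
  move=> dc; rewrite dc in xy *; congr scale; apply: aI; try exact/mem_set.
  move: xy; rewrite !combZ => /(congr1 (scale c^-1)).
  by rewrite !scaleA mulVf ?gt_eqF // !scale1.
- by exists 0; [exact: cone0 | exact: comb0].
exists (scale c x); last by rewrite combZ.
by apply: coneT_scale => //; have /realizationP[] := Mx.
Qed.

(** The radial extension of [f]: [g] recovers the coordinates with respect to a subdivision on which
    [f] is affine. *)
Lemma cone_map_of_pl_map (V W : finType) (K : {set {set V}}) (L : {set {set W}}) f :
  is_complex K -> @pl_map R V W K L f ->
  exists2 F, pl (cone K) F & F 0 = 0 /\ forall c x, 0 < c -> realization K x -> F (scale c x) = scale c (f x).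
Proof.
move=> KC [fKL [U [M [a [KMa lin]]]]].
have [MC aM aI aS] := refines_of_subdivision KC KMa.
have [g [_ gpl aP gP]] := @comb_iso R _ _ _ _ _ MC aM aI aS.
exists (fun x => combination (f \o a) (g x)).
  by apply: (@pl_comp _ _ _ _ _ (cone M)) => // [x /gP[]//|]; exact: pl_comb.
split.
  have := (aP 0 (cone0 R MC)).2; rewrite comb0 => ->; exact: comb0.
move=> c x c0 Kx; have [_ _ [_ _ aJ]] := KMa.
have [y My <-] := aJ x Kx; rewrite -combZ (aP _ _).2.
  by rewrite combZ lin.
by apply: coneT_scale => //; have /realizationP[] := My.
Qed.

Lemma iso_of_pl_homeomorphic (V W : finType) (K : {set {set V}}) (L : {set {set W}}) :
  is_complex K -> is_complex L -> pl_homeomorphic R K L -> iso (@cone R V K) (@cone R W L).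
Proof.
move=> KC LC [f [g [fpl gpl gf fg]]].
have [F Fpl [F0 FE]] := cone_map_of_pl_map KC fpl.
have [G Gpl [G0 GE]] := cone_map_of_pl_map LC gpl.
have scaleM (T : finType) (N : {set {set T}}) (x : vec T) : cone N x ->
    x = 0 \/ exists c y, [/\ 0 < c, realization N y & x = scale c y].
  move=> Lx; have [x0 xL] := (coneP _ _).1 Lx.
  have [s0|s0] := eqVneq (\sum_v x v) 0.
    left; apply/ffunP => v; rewrite ffunE; apply/eqP; move/eqP: s0; rewrite psumr_eq0 //.
    by move/allP/(_ v); rewrite mem_index_enum => /(_ isT).
  have sp : 0 < \sum_v x v by rewrite lt_def s0 sumr_ge0.
  right; exists (\sum_v x v), (scale (\sum_v x v)^-1 x); split=> //.
    apply/realizationP; split; first by apply: coneT_scale; rewrite ?invr_gt0.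
    by under eq_bigr do rewrite ffunE; rewrite -mulr_sumr mulVf.
  by rewrite scaleA divff // scale1.
have [fKL _] := fpl; have [gLK _] := gpl.
exists F, G; split=> // [_ /cone_realization[->|[c [x [c0 Kx ->]]]]|_ /cone_realization[->|[c [x [c0 Kx ->]]]]].
- by rewrite F0; split; [exact: cone0 | ].
- rewrite FE // GE ?gf //; last exact: fKL.
  by split=> //; apply: coneT_scale => //; have /realizationP[] := fKL _ Kx.
- by rewrite G0; split; [exact: cone0 | ].
rewrite GE // FE ?fg //; last exact: gLK.
by split=> //; apply: coneT_scale => //; have /realizationP[] := gLK _ Kx.
Qed.

Lemma bd_simplex_complex n : is_complex (bd_simplex n).
Proof.
split; first by rewrite inE properEcard sub0set cards0 cardsT card_ord.
by move=> s t; rewrite !inE => sT ts; exact: sub_proper_trans sT.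
Qed.

(** The unit vectors together with minus their sum span a complete fan of R^n, whose cones
    correspond to the proper subsets of these n + 1 vectors. *)
Lemma bd_simplex_iso n : iso (@cone R _ (bd_simplex n)) (@all_vec R 'I_n).
Proof.
pose a (i : 'I_n.+1) : vec 'I_n := if unlift ord_max i is Some j then unitv R j else [ffun=> -1].
have aE x j : combination a x j = x (lift ord_max j) - x ord_max.
  rewrite ffunE (bigD1 ord_max) //= /a unlift_none ffunE mulrN1 addrC; congr (_ - _).
  rewrite (bigD1 (lift ord_max j)) /=; last by rewrite eq_sym neq_lift.
  rewrite liftK ffunE eqxx mulr1 big1 ?addr0 // => i; case: unliftP => [k ->|->]; last by rewrite eqxx.
  by rewrite (inj_eq lift_inj) ffunE [j == k]eq_sym => /andP[_ /negPf->]; rewrite mulr0.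
have zero (x : vec 'I_n.+1) : cone (bd_simplex n) x -> exists i, x i = 0.
  by move=> /coneP[_]; rewrite inE properE => /andP[_ /subsetPn[i _ /suppP xi]]; exists i.
suff [g H] : exists g, isof (cone (bd_simplex n)) (@all_vec R 'I_n) (combination a) g.
  by exists (combination a), g.
apply: comb_iso => // [|x y Kx Ky xy|z _].
- exact: bd_simplex_complex.
- suff key (u v : vec 'I_n.+1) : cone (bd_simplex n) u -> cone (bd_simplex n) v ->
      combination a u = combination a v -> u ord_max <= v ord_max.
    have xym : x ord_max = y ord_max by apply: le_anti; rewrite !key.
    apply/ffunP => i; case: (unliftP ord_max i) => [j ->|->//].
    have := congr1 (fun w : vec 'I_n => w j) xy; rewrite /= !aE xym; exact: addIr.
  move=> Ku Kv uv; have [i vi] := zero _ Ku; have v0 := cone_ge0 Kv.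
  case: (unliftP ord_max i) vi => [j ->|->] vi; last by rewrite vi.
  have := congr1 (fun w : vec 'I_n => w j) uv; rewrite /= !aE vi.
  by have := v0 (lift ord_max j); lra.
(* Subtracting the minimum makes all coefficients nonnegative and one of them zero. Including 0 in
   the minimum makes [- m], the coefficient at [ord_max], nonnegative. *)
pose m := \big[Num.min/0]_j z j.
have m0 : m <= 0 by rewrite /m; exact: bigmin_le_id.
have mz j : m <= z j by exact: bigmin_le.
have mE : m = 0 \/ exists j, m = z j.
  rewrite /m; elim/big_ind: _ => [|x y xP yP|j _]; [by left | by case: leP | by right; exists j].
pose x : vec 'I_n.+1 := [ffun i => if unlift ord_max i is Some j then z j - m else - m].
exists x; last by apply/ffunP => j; rewrite aE !ffunE liftK unlift_none opprK subrK.
apply/coneP; split=> [i|].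
  by rewrite ffunE; case: unliftP => [j _|_]; rewrite ?subr_ge0 ?oppr_ge0.
rewrite inE properE subsetT /=; apply/subsetPn.
case: mE => [m00|[j mj]].
  by exists ord_max; rewrite // inE ffunE unlift_none m00 oppr0 eqxx.
by exists (lift ord_max j); rewrite // inE ffunE liftK mj subrr eqxx.
Qed.

Lemma comb_sphere_iso n (V : finType) (K : {set {set V}}) :
  comb_sphere_pred R n K <-> is_complex K /\ iso (@cone R V K) (@all_vec R 'I_n).
Proof.
split=> -[KC H]; split=> //.
  apply: iso_trans (bd_simplex_iso n); exact: (iso_of_pl_homeomorphic KC (@bd_simplex_complex n)).
apply: pl_homeomorphic_of_iso => //; first exact: bd_simplex_complex.
by apply: iso_trans H _; apply: iso_sym; exact: bd_simplex_iso.
Qed.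

Lemma sphere_face_le n (V : finType) (K : {set {set V}}) s :
  is_complex K -> iso (@cone R V K) (@all_vec R 'I_n) -> s \in K -> (#|s| <= n)%N.
Proof.
move=> KC [f [g [fpl _ fP _]]] sK; rewrite -[n]card_ord.
apply: (face_card_le KC fpl) => // x y Kx Ky /(congr1 g).
by rewrite !(fP _ _).2.
Qed.

(** The vectors of the tangent cone at a maximal simplex [s] are supported in [s], yet this cone is
    isomorphic to R^n. The cone over [bd_simplex n], which has a face with n vertices, embeds in it,
    so n <= #|s|. *)
Lemma sphere_facet_card n (V : finType) (K : {set {set V}}) s :
  is_complex K -> iso (@cone R V K) (@all_vec R 'I_n) ->
  maxset (fun t : {set V} => t \in K) s -> #|s| = n.
Proof.
move=> KC Ki smax; have sK := maxsetp smax.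
apply/eqP; rewrite eqn_leq (sphere_face_le KC Ki sK) /=.
have [f [g fg]] := iso_trans (bd_simplex_iso n) (iso_sym (coneT_all_vec KC Ki sK)).
have [fpl _ fP _] := fg.
have fs x : cone (bd_simplex n) x -> supp (f x) \subset s.
  move=> /fP[[_ sx] _]; apply/setUidPl; exact: (maxsetsup smax sx (subsetUl _ _)).
pose r (v : V) : vec 'I_#|s| := [ffun i => (enum_val i == v)%:R].
have rE x i : combination r x i = x (enum_val i).
  rewrite ffunE (bigD1 (enum_val i)) //= ffunE eqxx mulr1 big1 ?addr0 // => v vi.
  by rewrite ffunE eq_sym (negPf vi) mulr0.
pose face : {set 'I_n.+1} := [set~ ord_max].
have faceB : face \in bd_simplex n.
  by rewrite inE properEcard subsetT cardsT cardsC1 card_ord /= leqnn.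
have := @face_card_le R _ _ _ (fun x => combination r (f x)) face (bd_simplex_complex n).
rewrite cardsC1 !card_ord; apply=> //.
  apply: (@pl_comp _ _ _ _ _ (coneT K s)) fpl _ => [x /fP[]//|]; exact: pl_comb.
move=> x y Bx By xy; have [_ <-] := fP x Bx; have [_ <-] := fP y By; congr g.
apply/ffunP => v; have [vs|vs] := boolP (v \in s).
  by have := congr1 (fun z : vec 'I_#|s| => z (enum_rank_in vs v)) xy; rewrite /= !rE enum_rankK_in.
by rewrite !(suppP _ v _) //; apply: contra vs; apply: (subsetP (fs _ _)).
Qed.

End RealizationCones.

(** * Chambers *)

Section Barycentric.
Variable R : realType.
Local Notation vec V := {ffun V -> R}.

Definition comparable_sets (T : finType) (s t : {set T}) := (s \subset t) || (t \subset s).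

(* The barycentric subdivision of F. *)
Definition chains (T : finType) (F : {set {set T}}) : {set {set {set T}}} :=
  [set C : {set {set T}} | [forall w in C, (w \in F) && (w != set0)] &&
           [forall w in C, forall w' in C, comparable_sets w w']].

Section Chains.
Variables (T : finType) (F : {set {set T}}).

Lemma chainsP (C : {set {set T}}) :
  reflect ((forall w, w \in C -> w \in F /\ w != set0) /\
           (forall w w', w \in C -> w' \in C -> (w \subset w') || (w' \subset w)))
    (C \in chains F).
Proof.
rewrite inE; apply: (iffP andP) => -[H1 H2]; split.
- by move=> w wC; apply/andP; move/forall_inP: H1; apply.
- by move=> w w' wC w'C; move/forall_inP/(_ _ wC)/forall_inP: H2; apply.
- by apply/forall_inP => w /H1[-> ->].
- by apply/forall_inP => w wC; apply/forall_inP => w' w'C; exact: H2.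
Qed.

Lemma chains_complex : is_complex (chains F).
Proof.
split; first by apply/chainsP; split=> [w|w w']; rewrite inE.
move=> s t /chainsP[H1 H2] /subsetP ts; apply/chainsP.
by split=> [w /ts/H1|w w' /ts ws /ts w's]; [| exact: H2].
Qed.

End Chains.

Definition indicator (T : finType) (w : {set T}) : vec T := [ffun c => (c \in w)%:R].

(** The coefficients of a layer decomposition: a nonnegative function is written as a sum of
    multiples of indicators of sets forming a chain, which are its superlevel sets. *)
Definition nested (T : finType) (y : vec {set T}) :=
  [/\ forall w, 0 <= y w, y set0 = 0 &
      forall w w', w \in supp y -> w' \in supp y -> (w \subset w') || (w' \subset w)].

Section Layers.
Variable T : finType.
Implicit Types (y : vec {set T}) (z : vec T).

Local Notation bary := (combination (@indicator T)).

Lemma baryE y c : bary y c = \sum_(w : {set T} | c \in w) y w.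
Proof.
rewrite ffunE [RHS]big_mkcond; apply: eq_bigr => w _; rewrite ffunE.
by case: ifP; rewrite ?mulr1 ?mulr0.
Qed.

Lemma bary_ge y (w : {set T}) c : (forall w, 0 <= y w) -> c \in w -> y w <= bary y c.
Proof.
move=> y0 cw; rewrite baryE (bigD1 w) //= lerDl sumr_ge0 //.
Qed.

Lemma bary_ge0 y c : (forall w, 0 <= y w) -> 0 <= bary y c.
Proof. by move=> y0; rewrite baryE sumr_ge0. Qed.

Lemma bary_le_sum y c : (forall w, 0 <= y w) -> bary y c <= \sum_w y w.
Proof.
move=> y0; rewrite baryE [leRHS](bigID (fun w : {set T} => c \in w)) /= lerDl sumr_ge0 //.
Qed.

Lemma bary_eq_sum y c : (forall w, w \in supp y -> c \in w) -> bary y c = \sum_w y w.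
Proof.
move=> yc; rewrite baryE [RHS](bigID (fun w : {set T} => c \in w)) /= [X in _ + X]big1 ?addr0 //.
by move=> w cw; apply/suppP; apply: contra cw; exact: yc.
Qed.

Lemma largest_set (S : {set {set T}}) w0 : w0 \in S ->
  (forall w w', w \in S -> w' \in S -> (w \subset w') || (w' \subset w)) ->
  exists2 m, m \in S & forall w, w \in S -> w \subset m.
Proof.
move=> w0S H; have [m mS mmax] := @arg_maxnP _ w0 (mem S) (fun w => #|w|) w0S.
exists m => // w wS; have /orP[//|mw] := H w m wS mS.
by have /eqP-> : m == w by rewrite eqEcard mw; exact: mmax.
Qed.

Lemma smallest_set (S : {set {set T}}) w0 : w0 \in S ->
  (forall w w', w \in S -> w' \in S -> (w \subset w') || (w' \subset w)) ->
  exists2 m, m \in S & forall w, w \in S -> m \subset w.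
Proof.
move=> w0S H; have [m mS mmin] := @arg_minnP _ w0 (mem S) (fun w => #|w|) w0S.
exists m => // w wS; have /orP[//|mw] := H m w mS wS.
by have /eqP<- : w == m by rewrite eqEcard mw; exact: mmin.
Qed.

Lemma nested0 : nested (0 : vec {set T}).
Proof. by split=> [w||w w']; rewrite ?ffunE ?supp0 ?inE. Qed.

(** The largest set of the chain is the support of the function, and its coefficient is the value
    taken outside the next smaller set. Peeling off this layer drives the induction in
    [bary_inj]. *)
Lemma nested_top y : nested y -> y != 0 ->
  exists w, [/\ w \in supp y, supp (bary y) = w & exists2 c, c \in w & bary y c = y w].
Proof.
move=> [y0 yn yc] ynz.
have [w0 w0y] : exists w, w \in supp y.
  apply/set0Pn; apply: contra ynz => /eqP s0; apply/eqP/ffunP => w; rewrite ffunE.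
  by apply/suppP; rewrite s0 inE.
have [m my mmax] := largest_set w0y yc.
have mp : 0 < y m by rewrite lt_def y0 andbT; rewrite inE in my.
exists m; split=> //.
  apply/setP => c; rewrite inE baryE; apply/idP/idP => [|cm].
    apply: contraNT => cm; rewrite big1 // => w cw; apply/suppP.
    by apply: contra cm => /mmax/subsetP; apply.
  by rewrite gt_eqF // (lt_le_trans mp) // (bigD1 m) //= lerDl sumr_ge0.
have [w1 w1y|no] := pickP (mem (supp y :\ m)).
  have [|m1 m1y m1max] := @largest_set (supp y :\ m) _ w1y.
    by move=> w w' /setD1P[_ wy] /setD1P[_ w'y]; exact: yc.
  have /setD1P[m1m m1y'] := m1y.
  have /subsetPn[c cm cm1] : ~~ (m \subset m1).
    by apply: contra m1m => mm1; rewrite eqEsubset mm1 mmax.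
  exists c => //; rewrite baryE (bigD1 m) //= big1 ?addr0 // => w /andP[cw wm].
  apply/suppP; apply: contra cm1 => wy; apply: (subsetP (m1max w _)) cw.
  by rewrite !inE wm; rewrite inE in wy.
have /set0Pn[c cm] : m != set0 by apply: contraTneq mp => ->; rewrite yn ltxx.
exists c => //; rewrite baryE (bigD1 m) //= big1 ?addr0 // => w /andP[cw wm].
by apply/suppP; have := no w; rewrite !inE wm /= => ->.
Qed.

Lemma bary0 y : nested y -> bary y = 0 -> y = 0.
Proof.
move=> yn b0; apply/eqP; apply: contraT => /(nested_top yn)[w [wy _ [c _]]].
by rewrite b0 ffunE => yw; move: wy; rewrite inE -yw eqxx.
Qed.

Lemma bary_inj y y' : nested y -> nested y' -> bary y = bary y' -> y = y'.
Proof.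
have [n] := ubnP #|supp y|; elim: n y y' => // n IH y y' lt yn yn' yy'.
have [y0|ynz] := eqVneq y 0; first by rewrite y0 comb0 in yy' *; rewrite (bary0 yn').
have y'nz : y' != 0 by apply: contraNneq ynz => y'0; apply/eqP/bary0; rewrite // yy' y'0 comb0.
have [w [wy wE [c cw cE]]] := nested_top yn ynz.
have [w' [w'y wE' [c' cw' cE']]] := nested_top yn' y'nz.
have ww' : w' = w by rewrite -wE -wE' yy'.
rewrite {}ww' in w'y wE' cE' cw'.
have [y0 ys yc] := yn; have [y0' ys' yc'] := yn'.
have yw : y w = y' w.
  have le1 : y w <= y' w by rewrite -cE' -yy' bary_ge.
  have le2 : y' w <= y w by rewrite -cE yy' bary_ge.
  by apply: le_anti; rewrite le1.
pose drop (u : vec {set T}) := u - scale (u w) (unitv R w).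
have dropE u v : drop u v = if v == w then 0 else u v.
  by rewrite !ffunE; case: eqP => [->|]; rewrite ?mulr1 ?subrr // mulr0 subr0.
have drop_supp u : supp (drop u) = supp u :\ w.
  by apply/setP => v; rewrite !inE dropE; case: (v =P w); rewrite ?eqxx.
have drop_nested u : nested u -> nested (drop u).
  move=> [u0 us uc]; split=> [v||v v']; rewrite ?dropE ?us ?if_same //; first by case: ifP.
  by rewrite drop_supp => /setD1P[_ vu] /setD1P[_ vu']; exact: uc.
have dd : drop y = drop y'.
  apply: IH (drop_nested _ yn) (drop_nested _ yn') _.
    by move: lt; rewrite drop_supp (cardsD1 w) wy.
  by rewrite /drop !combB yy' yw.
apply/ffunP => v; have := congr1 (fun u : vec {set T} => u v) dd.
by rewrite /= !dropE; case: eqP => [->|].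
Qed.

(** Subtracting the smallest positive value times the indicator of the support removes a point from
    the support, and all later layers lie inside the old support. *)
Lemma bary_surj z : (forall c, 0 <= z c) ->
  exists2 y, nested y /\ bary y = z & forall w, w \in supp y -> w \subset supp z.
Proof.
have [n] := ubnP #|supp z|; elim: n z => // n IH z lt z0.
have [zz|[c0 c0z]] := set_0Vmem (supp z).
  exists 0; last by move=> w; rewrite supp0 inE.
  split; first exact: nested0.
  by rewrite comb0; apply/ffunP => c; rewrite ffunE; apply/esym/suppP; rewrite zz inE.
have [m mz mmin] := @Order.TotalTheory.arg_minP _ R _ c0 (mem (supp z)) z c0z.
have {}mz : m \in supp z := mz.
pose z' : vec T := z - scale (z m) (indicator (supp z)).
have z'E c : z' c = if c \in supp z then z c - z m else 0.
  by rewrite !ffunE; case: ifP => [_|/negbT/suppP->]; rewrite ?mulr1 ?mulr0 ?subrr.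
have z'0 c : 0 <= z' c by rewrite z'E; case: ifP => // cz; rewrite subr_ge0 mmin.
have sub : supp z' \subset supp z :\ m.
  apply/subsetP => c; rewrite [c \in supp z']inE z'E !inE.
  by case: (eqVneq c m) => [->|_]; [rewrite subrr if_same eqxx | case: ifP; rewrite ?eqxx].
have [|y [[y0 ys yc] yz] ysub] := IH z' _ z'0.
  by apply: leq_ltn_trans (subset_leq_card sub) _; move: lt; rewrite (cardsD1 m) mz.
have ssub w : w \in supp y -> w \subset supp z.
  by move=> /ysub/subset_trans; apply; apply: subset_trans sub (subD1set _ _).
have z0m : 0 <= z m by [].
pose y1 : vec {set T} := y + scale (z m) (unitv R (supp z)).
have y1s w : w \in supp y1 -> w \in supp y \/ w = supp z.
  move=> /(subsetP (suppD _ _)); rewrite inE => /orP[|]; first by left.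
  by rewrite inE !ffunE; case: (w =P supp z) => [->|_]; [right | rewrite mulr0 eqxx].
have y1sub w : w \in supp y1 -> w \subset supp z by case/y1s => [/ssub|->].
exists y1 => //; split; first split=> [w||w w' wy wy'].
- by rewrite !ffunE addr_ge0 // mulr_ge0 // ler0n.
- rewrite !ffunE ys add0r; case: eqP => [sz|]; last by rewrite mulr0.
  by move: c0z; rewrite -sz inE.
- case: (y1s w wy) => [wy1|->]; last by rewrite y1sub ?orbT.
  by case: (y1s w' wy') => [wy2|->]; [exact: yc | rewrite ssub].
rewrite combD yz combZ comb_unit /z'; exact: subrK.
Qed.

Lemma bary_supp y : (forall w, 0 <= y w) -> supp (bary y) = \bigcup_(w in supp y) w.
Proof.
move=> y0; apply/setP => c; apply/idP/bigcupP => [|[w wy cw]].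
  rewrite inE baryE; apply: contra_neqP => no; apply: big1 => w cw; apply/suppP.
  by apply/negP => wy; apply: no; exists w.
rewrite inE gt_eqF //; apply: lt_le_trans (bary_ge y0 cw).
by rewrite lt_def y0 andbT; rewrite inE in wy.
Qed.

(** Layers are taken from the largest set down until their total weight is [h], one layer being
    divided between [a] and [b] if necessary. In [position_surj], [b] becomes the outer part of a
    point of the collar and [a] its inner part. *)
Lemma cut y h : nested y -> 0 <= h -> h <= \sum_w y w ->
  exists a b, [/\ nested a, nested b, a + b = y, \sum_w b w = h &
    forall w w', w \in supp a -> w' \in supp b -> w \subset w'].
Proof.
have [n] := ubnP #|supp y|; elim: n y h => // n IH y h lt yn h0 hy.
have [y0|ynz] := eqVneq y 0.
  exists 0, 0; rewrite y0 addr0; split=> // [|||w w']; try exact: nested0.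
    have sum0 : \sum_w (0 : vec {set T}) w = 0 by rewrite big1 // => w _; rewrite ffunE.
    by move: hy; rewrite y0 sum0 => hy; apply: le_anti; rewrite h0 hy.
  by rewrite supp0 inE.
have [y0 ys yc] := yn.
have [w0 w0y] : exists w, w \in supp y.
  apply/set0Pn; apply: contra ynz => /eqP s0; apply/eqP/ffunP => w; rewrite ffunE.
  by apply/suppP; rewrite s0 inE.
have [m my mmax] := largest_set w0y yc.
have sum_unit t : \sum_w (scale t (unitv R m)) w = t.
  by rewrite (bigD1 m) //= !ffunE eqxx mulr1 big1 ?addr0 // => w /negPf wm; rewrite !ffunE wm mulr0.
have mn0 : m != set0 by apply: contraTneq my => ->; rewrite inE ys eqxx.
have nested_sub (u v : vec {set T}) t : (forall w, v w = u w + t * (w == m)%:R) ->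
    (forall w, 0 <= v w) -> nested u -> supp u \subset supp y -> nested v.
  move=> vE v0 [u0 us uc] uy; split=> // [|w w'].
    by rewrite vE us add0r eq_sym (negPf mn0) mulr0.
  have vy w1 : w1 \in supp v -> w1 \in supp y.
    rewrite inE vE; have [->//|_] := eqVneq w1 m; rewrite mulr0 addr0 => uw.
    by apply: (subsetP uy); rewrite inE.
  by move=> /vy wy /vy w'y; exact: yc.
have [hm|hm] := lerP h (y m).
  exists (y - scale h (unitv R m)), (scale h (unitv R m)); split=> //; last 1 first.
  - move=> w w' wa; rewrite inE !ffunE; have [->|] := eqVneq w' m; last by rewrite mulr0 eqxx.
    move=> _; apply: mmax; move: wa; rewrite !inE !ffunE; have [->|_] := eqVneq w m.
      by move=> _; rewrite inE in my.
    by rewrite mulr0 subr0.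
  - apply: (nested_sub y _ (- h)) => // w; first by rewrite !ffunE mulNr.
    by rewrite !ffunE; have [->|_] := eqVneq w m; rewrite ?mulr1 ?mulr0 ?subr0 ?subr_ge0.
  - apply: (nested_sub 0 _ h) => [w|w||]; rewrite ?supp0 ?sub0set //; last exact: nested0.
      by rewrite !ffunE add0r.
    by rewrite !ffunE mulr_ge0 // ler0n.
  - exact: subrK.
pose y' := y - scale (y m) (unitv R m).
have y'E w : y' w = if w == m then 0 else y w.
  by rewrite !ffunE; case: eqP => [->|]; rewrite ?mulr1 ?subrr // mulr0 subr0.
have y's : supp y' = supp y :\ m.
  by apply/setP => v; rewrite !inE y'E; case: (v =P m); rewrite ?eqxx.
have y'n : nested y'.
  apply: (nested_sub y _ (- y m)) => // w; first by rewrite !ffunE mulNr.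
  by rewrite y'E; case: ifP.
have [|||a [b [an bn ab bh abs]]] := IH y' (h - y m) _ y'n.
- by rewrite y's; move: lt; rewrite (cardsD1 m) my.
- by rewrite subr_ge0 ltW.
- by under eq_bigr do rewrite ffunE -scaleN1 ffunE mulN1r; rewrite sumrB sum_unit lerB.
have [a0 _ _] := an; have [b0 _ _] := bn.
have ay w : w \in supp a -> w \in supp y.
  move=> wa; have : w \in supp y' by rewrite -ab suppD_ge0 // inE wa.
  by rewrite y's => /setD1P[].
have bsub : supp b \subset supp y.
  apply/subsetP => w wb; have : w \in supp y' by rewrite -ab suppD_ge0 // inE wb orbT.
  by rewrite y's => /setD1P[].
exists a, (b + scale (y m) (unitv R m)); split=> //.
- apply: (nested_sub b _ (y m)) => // w; first by rewrite !ffunE.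
  by rewrite !ffunE addr_ge0 // mulr_ge0 // ler0n.
- by rewrite addrA ab subrK.
- by under eq_bigr do rewrite ffunE; rewrite big_split /= bh sum_unit subrK.
move=> w w' wa /(subsetP (suppD _ _)); rewrite inE => /orP[|]; first exact: abs.
rewrite inE !ffunE; have [->|_] := eqVneq w' m; last by rewrite mulr0 eqxx.
by move=> _; apply/mmax/ay.
Qed.

Lemma nested_cone (F : {set {set T}}) y : cone (chains F) y <->
  nested y /\ (forall w, w \in supp y -> w \in F).
Proof.
split=> [/coneP[y0 /chainsP[yF yc]]|[[y0 ys yc] yF]].
  split=> [|w /yF[]//]; split=> //.
  by apply/suppP/negP => /yF[_]; rewrite eqxx.
apply/coneP; split=> //; apply/chainsP; split=> // w wy; split; first exact: yF.
by apply: contraTneq wy => ->; rewrite inE ys eqxx.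
Qed.

Lemma cone_bary (F : {set {set T}}) y : is_complex F -> cone (chains F) y -> cone F (bary y).
Proof.
move=> FC /nested_cone[yn yF]; have [y0 _ _] := yn; have [->|ynz] := eqVneq y 0.
  rewrite comb0; exact: cone0.
have [w [/yF wF wE _]] := nested_top yn ynz.
by apply/coneP; rewrite wE; split=> // c; exact: bary_ge0.
Qed.

Lemma chains_iso (F : {set {set T}}) : is_complex F -> iso (@cone R _ (chains F)) (@cone R _ F).
Proof.
move=> FC; suff [g H] : exists g, isof (cone (chains F)) (cone F) bary g by exists bary, g.
apply: comb_iso => [|y|y y' /nested_cone[yn _] /nested_cone[yn' _]|z Fz].
- exact: chains_complex.
- exact: cone_bary.
- exact: bary_inj.
have [z0 zF] := (coneP _ _).1 Fz; have [y [yn yz] ysub] := bary_surj z0.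
by exists y => //; apply/nested_cone; split=> // w /ysub; exact: face_sub.
Qed.

End Layers.
End Barycentric.

(** * The chamber and its cubical counterpart *)

Section Chamber.
Variable R : realType.
Local Notation vec V := {ffun V -> R}.
Variable X : finType.
Local Notation cvert := (X + {set {set X}})%type.
Local Notation bary := (combination (@indicator R X)).
Local Notation bary2 := (combination (@indicator R {set X})).

Definition inner (s : {set cvert}) : {set X} := [set c | inl c \in s].
Definition outer (s : {set cvert}) : {set {set {set X}}} := [set C | inr C \in s].

(* The cone over F, with apex inr set0, together with a collar whose outer side is
   the barycentric subdivision of the cubical complex dual to chains F. *)
Definition chamber (F : {set {set X}}) : {set {set cvert}} :=
  [set s : {set cvert} | [&& inner s \in F, outer s :\ set0 \in chains (chains F),
    [forall C in outer s, forall w in C, inner s \subset w]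
    & (set0 \in outer s) ==> (outer s == [set set0])]].

(** The order complex of [chains F] with the empty chain included: the barycentric subdivision of
    the dual cubical cell, with its centre at [inr set0]. *)
Definition cubical_chamber (F : {set {set X}}) : {set {set cvert}} :=
  [set s : {set cvert} | (inner s == set0) && (outer s :\ set0 \in chains (chains F))].

Lemma inner_sub (s t : {set cvert}) : s \subset t -> inner s \subset inner t.
Proof. by move/subsetP=> st; apply/subsetP => c; rewrite !inE => /st. Qed.
Lemma outer_sub (s t : {set cvert}) : s \subset t -> outer s \subset outer t.
Proof. by move/subsetP=> st; apply/subsetP => c; rewrite !inE => /st. Qed.

Lemma chamberP (F : {set {set X}}) (s : {set cvert}) :
  reflect [/\ inner s \in F, outer s :\ set0 \in chains (chains F),
    forall C w, C \in outer s -> w \in C -> inner s \subset w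
    & set0 \in outer s -> outer s = [set set0]] (s \in chamber F).
Proof.
rewrite [s \in _]inE; apply: (iffP and4P) => -[sF sC sw s0]; split=> //.
- by move=> C w Cs wC; move/forall_inP/(_ _ Cs)/forall_inP: sw; apply.
- by move=> H; apply/eqP; move/implyP: s0; apply.
- by apply/forall_inP => C Cs; apply/forall_inP => w; exact: sw.
- by apply/implyP => /s0->.
Qed.

Lemma chamber_complex F : is_complex F -> is_complex (chamber F).
Proof.
move=> FC; have i0 : inner set0 = set0 by apply/setP => c; rewrite !inE.
have o0 : outer set0 = set0 by apply/setP => c; rewrite !inE.
split.
  apply/chamberP; rewrite i0 o0 set0D; split=> [||C w|]; try by rewrite inE.
    by case: FC.
  by case: (chains_complex (chains F)).
move=> s t /chamberP[sF sC sw s0] ts; have it := inner_sub ts; have ot := outer_sub ts.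
apply/chamberP; split.
- exact: face_sub sF it.
- by apply: (face_sub (chains_complex _) sC); exact: setSD.
- by move=> C w Ct wC; apply: subset_trans it (sw C w _ wC); exact: (subsetP ot).
- move=> t0; apply/eqP; rewrite eqEsubset sub1set t0 andbT -s0 //; exact: (subsetP ot).
Qed.

Lemma cubical_chamber_complex F : is_complex (cubical_chamber F).
Proof.
split.
  rewrite inE; apply/andP; split; first by apply/eqP/setP => c; rewrite !inE.
  have -> : outer set0 :\ set0 = set0 by apply/setP => c; rewrite !inE andbF.
  by case: (chains_complex (chains F)).
move=> s t; rewrite [s \in _]inE [t \in _]inE => /andP[/eqP si sC] ts; apply/andP; split.
  by rewrite -subset0 -si; exact: inner_sub.
by apply: (face_sub (chains_complex _) sC); apply: setSD; exact: outer_sub.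
Qed.

Definition inner_part (x : vec cvert) : vec X := [ffun c => x (inl c)].
Definition outer_part (x : vec cvert) : vec {set {set X}} :=
  [ffun C => if C == set0 then 0 else x (inr C)].

Definition assemble (x : vec X) (w : vec {set {set X}}) (t : R) : vec cvert :=
  [ffun z => match z with inl c => x c | inr C => if C == set0 then t else w C end].

Lemma inner_assemble x w t : inner_part (assemble x w t) = x.
Proof. by apply/ffunP => c; rewrite !ffunE. Qed.
Lemma outer_assemble x (w : vec {set {set X}}) t : w set0 = 0 -> outer_part (assemble x w t) = w.
Proof. by move=> w0; apply/ffunP => C; rewrite !ffunE; case: eqP => [->|//]; rewrite w0. Qed.
Lemma apex_assemble x w t : assemble x w t (inr set0) = t.
Proof. by rewrite ffunE eqxx. Qed.

Lemma parts_eq x y : inner_part x = inner_part y -> outer_part x = outer_part y ->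
  x (inr set0) = y (inr set0) -> x = y.
Proof.
move=> /ffunP xi /ffunP xo xa; apply/ffunP => -[c|C]; first by have := xi c; rewrite !ffunE.
by have := xo C; rewrite !ffunE; case: eqP => [->|//].
Qed.

Lemma supp_inner x : supp (inner_part x) = inner (supp x).
Proof. by apply/setP => c; rewrite !inE ffunE. Qed.
Lemma supp_outer x : supp (outer_part x) = outer (supp x) :\ set0.
Proof. by apply/setP => C; rewrite !inE ffunE; case: (C =P set0); rewrite ?eqxx. Qed.

Lemma part_ge0 (x : vec cvert) : (forall z, 0 <= x z) ->
  (forall c, 0 <= inner_part x c) /\ (forall C, 0 <= outer_part x C).
Proof. by move=> x0; split=> z; rewrite ffunE //; case: ifP. Qed.

Lemma assemble_ge0 (x : vec X) (w : vec {set {set X}}) t : (forall c, 0 <= x c) -> (forall C, 0 <= w C) -> 0 <= t ->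
  forall z, 0 <= assemble x w t z.
Proof. by move=> x0 w0 t0 [c|C]; rewrite ffunE //; case: ifP. Qed.

Lemma cone_chamber F (x : vec cvert) : cone (chamber F) x <->
  [/\ forall z, 0 <= x z, cone F (inner_part x), cone (chains (chains F)) (outer_part x),
      forall C w, C \in supp (outer_part x) -> w \in C -> supp (inner_part x) \subset w
    & x (inr set0) = 0 \/ outer_part x = 0].
Proof.
split=> [/coneP[x0 /chamberP[xF xC xw x00]]|[x0 /coneP[_ xF] /coneP[_ xC] xw x00]].
  have [i0 o0] := part_ge0 x0; split=> //.
  - by apply/coneP; rewrite supp_inner.
  - by apply/coneP; rewrite supp_outer.
  - by rewrite supp_inner supp_outer => C w /setD1P[_]; exact: xw.
  have [/x00 xo|] := boolP (set0 \in outer (supp x)); last by rewrite inE => /suppP->; left.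
  right; apply/ffunP => C; rewrite [RHS]ffunE; apply/suppP.
  by rewrite supp_outer xo setDv inE.
rewrite supp_inner supp_outer in xF xC xw.
apply/coneP; split=> //; apply/chamberP; split=> //.
  move=> C w Cx wC; apply: (xw C w) => //; rewrite in_setD1 Cx andbT.
  by apply: contraTneq wC => ->; rewrite inE.
case: x00 => [xa|xo]; first by rewrite !inE xa eqxx.
move=> x00; apply/eqP; rewrite eqEsubset sub1set x00 andbT -setD_eq0.
by rewrite -supp_outer xo supp0.
Qed.

Lemma cone_cubical_chamber F (x : vec cvert) : cone (cubical_chamber F) x <->
  [/\ forall z, 0 <= x z, inner_part x = 0 & cone (chains (chains F)) (outer_part x)].
Proof.
split=> [/coneP[x0]|[x0 xi /coneP[_ xC]]].
  rewrite inE => /andP[/eqP xi xC]; have [i0 o0] := part_ge0 x0; split=> //.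
    by apply/ffunP => c; rewrite [RHS]ffunE; apply/suppP; rewrite supp_inner xi inE.
  by apply/coneP; rewrite supp_outer.
by apply/coneP; split=> //; rewrite inE -supp_inner xi supp0 eqxx -supp_outer.
Qed.

(* The coordinate None is a height: the chamber is cut into the cone over F from
   its centre (below height 0) and a collar of F (above it). *)
Definition position (z : cvert) : vec (option X) :=
  match z with
  | inl c => unitv R (Some c)
  | inr C => [ffun o => if o is Some c then bary (indicator R C) c
                        else if C == set0 then -1 else #|C|%:R]
  end.

Lemma indicator0 (T : finType) : indicator R (set0 : {set T}) = 0.
Proof. by apply/ffunP => c; rewrite !ffunE inE. Qed.

Lemma bary2_outer (x : vec cvert) : bary2 [ffun C => x (inr C)] = bary2 (outer_part x).
Proof.
apply/ffunP => w; rewrite !ffunE; apply: eq_bigr => C _; rewrite !ffunE.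
by case: eqP => [->|//]; rewrite inE !mulr0.
Qed.

Lemma sum_bary2 (w : vec {set {set X}}) : \sum_v bary2 w v = \sum_C w C * #|C|%:R.
Proof.
under eq_bigr do rewrite ffunE; rewrite exchange_big; apply: eq_bigr => C _.
rewrite -mulr_sumr; congr (_ * _); rewrite -sum1_card natr_sum [RHS]big_mkcond.
by apply: eq_bigr => v _; rewrite ffunE; case: ifP.
Qed.

Lemma position_some (x : vec cvert) c : combination position x (Some c) = inner_part x c + bary (bary2 (outer_part x)) c.
Proof.
rewrite ffunE big_sumType /=; congr (_ + _).
  rewrite (bigD1 c) //= ffunE eqxx mulr1 big1 ?addr0 ?ffunE // => d dc.
  by rewrite ffunE (inj_eq Some_inj) eq_sym (negPf dc) mulr0.
rewrite -bary2_outer comb_comb [RHS]ffunE; apply: eq_bigr => C _.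
by rewrite !ffunE.
Qed.

Lemma position_none (x : vec cvert) :
  combination position x None = \sum_w bary2 (outer_part x) w - x (inr set0).
Proof.
rewrite ffunE big_sumType /= big1 ?add0r; last by move=> c _; rewrite ffunE mulr0.
rewrite sum_bary2 (bigD1 set0) //= ffunE eqxx mulrN1 addrC; congr (_ - _).
rewrite [RHS](bigD1 set0) //= cards0 mulr0 add0r; apply: eq_bigr => C /negPf C0.
by rewrite !ffunE C0.
Qed.

(** For a function [bary y] the sum of [y] is its largest value. Over the cone of [F] the region
    thus consists of the points whose height is at most the largest coordinate; both models
    triangulate it. *)
Definition chamber_region (F : {set {set X}}) (p : vec (option X)) : Prop :=
  exists y, [/\ cone (chains F) y, forall c, p (Some c) = bary y c & p None <= \sum_w y w].

Section ChamberMaps.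
Variable F : {set {set X}}.
Hypothesis FC : is_complex F.

Lemma cone_bary2 w : cone (chains (chains F)) w -> cone (chains F) (bary2 w).
Proof. by apply: cone_bary; exact: chains_complex. Qed.

Lemma supp_bary2 (w : vec {set {set X}}) v : (forall C, 0 <= w C) -> v \in supp (bary2 w) ->
  exists2 C, C \in supp w & v \in C.
Proof. by move=> w0; rewrite bary_supp // => /bigcupP. Qed.

Lemma position_region (x : vec cvert) : cone (chamber F) x -> chamber_region F (combination position x).
Proof.
move=> /cone_chamber[x0 xF xC xw _].
have [i0 iF] := (coneP _ _).1 xF.
have [a [an ax] asub] := bary_surj i0.
have Cy := cone_bary2 xC; have [yn yF] := (nested_cone _ _).1 Cy.
set y := bary2 _ in Cy yn yF; have [y0 ys yc] := yn; have [a0 as_ ac] := an.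
have asy w w' : w \in supp a -> w' \in supp y -> w \subset w'.
  move=> /asub wx /supp_bary2[|C Cx w'C]; first by have [] := part_ge0 x0.
  exact: subset_trans wx (xw C w' Cx w'C).
exists (a + y); split.
- apply/nested_cone; split; first split=> [w||w w'].
  + by rewrite ffunE addr_ge0.
  + by rewrite ffunE as_ ys addr0.
  + rewrite suppD_ge0 // => /setUP[] wa /setUP[] wb.
    * exact: ac.
    * by rewrite asy.
    * by rewrite orbC asy.
    * exact: yc.
  + move=> w; rewrite suppD_ge0 // => /setUP[/asub wx|/yF//].
    exact: face_sub iF wx.
- by move=> c; rewrite position_some combD [RHS]ffunE ax.
- rewrite position_none; under [leRHS]eq_bigr do rewrite ffunE.
  rewrite big_split /= -/y; have := x0 (inr set0); have : 0 <= \sum_w a w by exact: sumr_ge0.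
  by lra.
Qed.

(** The inner part is a function of the position alone: below height 0 it is the whole point, and in
    the collar it is the excess of each coordinate over the height. This reduces injectivity to the
    outer part. *)
Lemma position_inner (x : vec cvert) c : cone (chamber F) x ->
  inner_part x c = Num.min (combination position x (Some c))
    (Num.max 0 (combination position x (Some c) - combination position x None)).
Proof.
move=> /cone_chamber[x0 xF xC xw xa]; have [i0 o0] := part_ge0 x0.
have Cy := cone_bary2 xC; have y0 := cone_ge0 Cy.
rewrite position_some position_none; set y := bary2 _ in Cy y0 *.
have bs := bary_le_sum c y0; have b0 := bary_ge0 c y0; have ic := i0 c.
case: xa => [->|xo].
  have [cx|/suppP cx] := boolP (c \in supp (inner_part x)); last first.
    by rewrite cx; case: (lerP 0 (0 + bary y c - (\sum_w y w - 0))) => h; case: leP => h'; lra.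
  have -> : bary y c = \sum_w y w.
    apply: bary_eq_sum => w /supp_bary2[//|C Cx wC]; exact: (subsetP (xw C w Cx wC)).
  have s0 : 0 <= \sum_w y w by exact: sumr_ge0.
  by case: (lerP 0 (inner_part x c + \sum_w y w - (\sum_w y w - 0))) => h; case: leP => h'; lra.
have yz : y = 0 by rewrite /y xo comb0.
have -> : \sum_w y w = 0 by rewrite yz big1 // => w _; rewrite ffunE.
have -> : bary y c = 0 by rewrite yz comb0 ffunE.
have xa0 := x0 (inr set0).
by case: (lerP 0 (inner_part x c + 0 - (0 - x (inr set0)))) => h; case: leP => h'; lra.
Qed.

Lemma outer_eq (x y : vec cvert) : cone (chains (chains F)) (outer_part x) ->
  cone (chains (chains F)) (outer_part y) ->
  combination position x = combination position y -> inner_part x = inner_part y -> x = y.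
Proof.
move=> xC yC xy xyi.
have byy : bary (bary2 (outer_part x)) = bary (bary2 (outer_part y)).
  apply/ffunP => c; have := congr1 (fun p : vec (option X) => p (Some c)) xy.
  by rewrite /= !position_some xyi => /addrI.
have [xn _] := (nested_cone _ _).1 (cone_bary2 xC); have [yn _] := (nested_cone _ _).1 (cone_bary2 yC).
have b2 := bary_inj xn yn byy.
have [xn' _] := (nested_cone _ _).1 xC; have [yn' _] := (nested_cone _ _).1 yC.
apply: parts_eq => //; first exact: bary_inj b2.
have := congr1 (fun p : vec (option X) => p None) xy; rewrite /= !position_none b2.
by move=> /addrI/oppr_inj.
Qed.

Lemma position_inj (x y : vec cvert) : cone (chamber F) x -> cone (chamber F) y ->
  combination position x = combination position y -> x = y.
Proof.
move=> Kx Ky xy; have [_ _ xC _ _] := (cone_chamber _ _).1 Kx.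
have [_ _ yC _ _] := (cone_chamber _ _).1 Ky; apply: outer_eq => //.
by apply/ffunP => c; rewrite !position_inner // xy.
Qed.

Lemma bary2_surj y : cone (chains F) y -> exists2 w, cone (chains (chains F)) w & bary2 w = y.
Proof.
move=> Fy; have [y0 yF] := (coneP _ _).1 Fy; have [w [wn wy] ws] := bary_surj y0.
by exists w => //; apply/nested_cone; split=> // C /ws; apply: face_sub yF; exact: chains_complex.
Qed.

Lemma cone_chains0 (G : {set {set X}}) (w : vec {set {set X}}) : cone (chains (chains G)) w -> w set0 = 0.
Proof. by move=> /nested_cone[[]]. Qed.

(** Up to height 0 the point lies in the cone with apex [inr set0]. Above it, cutting the layers at
    the height separates the outer part from the inner one. *)
Lemma position_surj p : chamber_region F p -> exists2 x, cone (chamber F) x & combination position x = p.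
Proof.
move=> [y [Fy py ph]]; have [yn yF] := (nested_cone _ _).1 Fy.
have [h0|h0] := lerP (p None) 0.
  exists (assemble (bary y) 0 (- p None)).
    apply/cone_chamber; rewrite inner_assemble outer_assemble; last by rewrite ffunE.
    split.
    - apply: assemble_ge0 => [c|C|]; [|by rewrite ffunE | by rewrite oppr_ge0].
      by apply: bary_ge0; case: yn.
    - exact: cone_bary.
    - exact: (cone0 _ (chains_complex _)).
    - by move=> C w; rewrite supp0 inE.
    - by right.
  apply/ffunP => -[c|].
    rewrite position_some inner_assemble outer_assemble; last by rewrite ffunE.
    by rewrite !comb0 [X in _ + X]ffunE addr0 py.
  rewrite position_none apex_assemble outer_assemble; last by rewrite ffunE.
  by rewrite comb0 opprK big1 ?add0r // => w _; rewrite ffunE.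
have [a [b [an bn ab bh abs]]] := cut yn (ltW h0) ph.
have [a0 _ _] := an; have [b0 _ _] := bn.
have supy w : w \in supp a :|: supp b -> w \in F.
  by move=> wab; apply: yF; rewrite -ab suppD_ge0.
have Fa : cone (chains F) a by apply/nested_cone; split=> // w wa; apply: supy; rewrite inE wa.
have Fb : cone (chains F) b by apply/nested_cone; split=> // w wb; apply: supy; rewrite inE wb orbT.
have [w Fw wb] := bary2_surj Fb; have w0 := cone_ge0 Fw; have ws := cone_chains0 Fw.
exists (assemble (bary a) w 0).
  apply/cone_chamber; rewrite inner_assemble outer_assemble //; split=> //.
  - by apply: assemble_ge0 => // c; exact: bary_ge0.
  - exact: cone_bary.
  - move=> C v Cw vC; rewrite bary_supp //; apply/bigcupsP => u ua; apply: abs ua _.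
    by rewrite -wb bary_supp //; apply/bigcupP; exists C.
  - by left; rewrite apex_assemble.
apply/ffunP => -[c|].
  by rewrite position_some inner_assemble outer_assemble // wb py -ab combD [RHS]ffunE.
by rewrite position_none apex_assemble outer_assemble // wb subr0 bh.
Qed.

Lemma position_cubical_region (x : vec cvert) : cone (cubical_chamber F) x -> chamber_region F (combination position x).
Proof.
move=> /cone_cubical_chamber[x0 xi xC]; exists (bary2 (outer_part x)); split.
- exact: cone_bary2.
- by move=> c; rewrite position_some xi [X in X + _]ffunE add0r.
- by rewrite position_none lerBlDr lerDl.
Qed.

Lemma position_cubical_inj (x y : vec cvert) : cone (cubical_chamber F) x -> cone (cubical_chamber F) y ->
  combination position x = combination position y -> x = y.
Proof.
move=> /cone_cubical_chamber[x0 xi xC] /cone_cubical_chamber[y0 yi yC] xy.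
by apply: outer_eq => //; rewrite xi yi.
Qed.

Lemma position_cubical_surj p : chamber_region F p ->
  exists2 x, cone (cubical_chamber F) x & combination position x = p.
Proof.
move=> [y [Fy py ph]]; have [w Fw wy] := bary2_surj Fy; have w0 := cone_ge0 Fw.
have ws := cone_chains0 Fw.
(* The apex has height -1, so its weight is the depth of the point below the roof of the region. *)
exists (assemble 0 w (\sum_w y w - p None)).
  apply/cone_cubical_chamber; rewrite inner_assemble outer_assemble //; split=> //.
  by apply: assemble_ge0 => // [c|]; rewrite ?ffunE // subr_ge0.
apply/ffunP => -[c|].
  by rewrite position_some inner_assemble outer_assemble // wy py [X in X + _]ffunE add0r.
by rewrite position_none apex_assemble outer_assemble // wy opprB addrC subrK.
Qed.

End ChamberMaps.
End Chamber.

(** * Gluing chambers along walls *)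

Section Gluing.
Variable R : realType.
Local Notation vec V := {ffun V -> R}.
Variables (V X : finType) (F : V -> {set {set X}}).
Variables (Phi : {set X} -> V -> V) (B : V -> {set {set X}}).
Implicit Types (v : V) (w r : {set X}) (C D : {set {set X}}).
Hypotheses (PhiK : forall w, involutive (Phi w))
  (PhiC : forall w w' v, w \subset w' -> Phi w (Phi w' v) = Phi w' (Phi w v))
  (BPhi : forall w v u, (u \in B (Phi w v)) = (u == w) (+) (u \in B v))
  (FPhi : forall w v r, w \in F v -> w \subset r -> (r \in F (Phi w v)) = (r \in F v))
  (FC : forall v, is_complex (F v)).

Definition orbit_rel C : rel V := fun v v' => [exists w in C, v' == Phi w v].
Definition orb C v : {set V} := [set v' | connect (orbit_rel C) v v'].

Lemma orbit_sym C : connect_sym (orbit_rel C).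
Proof.
apply: sym_connect_sym => v v'; apply/exists_inP/exists_inP => -[w wC /eqP->];
  by exists w; rewrite // PhiK.
Qed.

Lemma orb_refl C v : v \in orb C v. Proof. by rewrite inE connect0. Qed.

Lemma orb_eq C v v' : v' \in orb C v -> orb C v' = orb C v.
Proof.
rewrite inE => vv'; apply/setP => u; rewrite !inE; exact/esym/(same_connect (@orbit_sym C) vv').
Qed.

Lemma orb_eqP C v v' : orb C v = orb C v' <-> v' \in orb C v.
Proof. by split=> [->|/orb_eq//]; exact: orb_refl. Qed.

Lemma orb_Phi C w v : w \in C -> Phi w v \in orb C v.
Proof. by move=> wC; rewrite inE connect1 //; apply/exists_inP; exists w. Qed.

Lemma orb_ind C v (P : V -> Prop) : P v -> (forall w u, w \in C -> P u -> P (Phi w u)) ->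
  forall u, u \in orb C v -> P u.
Proof.
move=> Pv PP u; rewrite inE => /connectP[p]; elim: p v Pv => [|y p IH] v Pv /=; first by move=> _ ->.
by move=> /andP[/exists_inP[w wC /eqP->] pth] /(IH _ _ pth); apply; exact: PP.
Qed.

Lemma orb_sub C D v : D \subset C -> orb D v \subset orb C v.
Proof.
move=> /subsetP DC; apply/subsetP; apply: orb_ind => [|w u wD uC]; first exact: orb_refl.
by rewrite -(orb_eq uC) orb_Phi // DC.
Qed.

Lemma orb0 v : orb set0 v = [set v].
Proof.
apply/setP => u; rewrite [RHS]inE; apply/idP/eqP => [|->]; last exact: orb_refl.
by apply: (@orb_ind _ v (fun u => u = v)) => // w u'; rewrite inE.
Qed.

Lemma orb_bits C v v' w : w \notin C -> v' \in orb C v -> (w \in B v') = (w \in B v).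
Proof.
move=> wC; apply: (@orb_ind _ v (fun v' => (w \in B v') = (w \in B v))) => // w' u w'C <-; rewrite BPhi.
by case: eqP wC => [->|//]; rewrite w'C.
Qed.

Definition comparable_family C :=
  forall w w', w \in C -> w' \in C -> (w \subset w') || (w' \subset w).

Lemma PhiC' C w w' v : comparable_family C -> w \in C -> w' \in C -> Phi w (Phi w' v) = Phi w' (Phi w v).
Proof. by move=> Cc wC w'C; have /orP[/PhiC->//|/PhiC->] := Cc w w' wC w'C. Qed.

Lemma orb_split C w v v' : comparable_family C -> w \in C -> v' \in orb C v ->
  v' \in orb (C :\ w) v \/ v' \in orb (C :\ w) (Phi w v).
Proof.
move=> Cc wC; have push u y : y \in orb (C :\ w) u -> Phi w y \in orb (C :\ w) (Phi w u).
  apply: (@orb_ind _ u (fun y => Phi w y \in orb (C :\ w) (Phi w u))) => [|w' z w'C zO].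
    exact: orb_refl.
  have /setD1P[_ w'C'] := w'C.
  by rewrite (PhiC' _ Cc wC w'C') -(orb_eq zO) orb_Phi.
apply: (@orb_ind _ v (fun v' => v' \in orb (C :\ w) v \/ v' \in orb (C :\ w) (Phi w v)))
  => [|w' u w'C [uO|uO]]; first by left; exact: orb_refl.
  have [->|ww'] := eqVneq w' w; first by right; exact: push.
  by left; rewrite -(orb_eq uO) orb_Phi // !inE ww'.
have [->|ww'] := eqVneq w' w; first by left; rewrite -[v](PhiK w); exact: push.
by right; rewrite -(orb_eq uO) orb_Phi // !inE ww'.
Qed.

(** The crossings of a chain commute and the bits record their parities, so two chambers around [C]
    that differ only in bits of [D] are joined by crossing walls of [D]. *)
Lemma orb_agree C D v v' : comparable_family C -> D \subset C -> v' \in orb C v ->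
  (forall w, w \in C -> w \notin D -> (w \in B v') = (w \in B v)) -> v' \in orb D v.
Proof.
have [n] := ubnP #|C|; elim: n C => // n IH C lt Cc DC v'C agree.
have [CD|] := boolP (C \subset D).
  by rewrite (_ : D = C) //; apply/eqP; rewrite eqEsubset DC.
case/subsetPn => w wC wD; have ww : w \notin C :\ w by rewrite !inE eqxx.
have [v'w|v'w] := orb_split Cc wC v'C; last first.
  have := agree w wC wD; rewrite (orb_bits ww v'w) BPhi eqxx.
  by case: (w \in B v).
apply: IH v'w _.
- by move: lt; rewrite (cardsD1 w) wC.
- by move=> u u' /setD1P[_ uC] /setD1P[_ u'C]; exact: Cc.
- by rewrite subsetD1 DC.
by move=> u /setD1P[_ uC]; exact: agree.
Qed.

Lemma orb_bits_exist C v (E : {set {set X}}) :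
  exists2 v', v' \in orb C v & forall w, w \in C -> (w \in B v') = (w \in E).
Proof.
pose bad v' := [set w in C | (w \in B v') != (w \in E)].
have [n] := ubnP #|bad v|; elim: n v => // n IH v lt.
have [bad0|[w]] := set_0Vmem (bad v).
  exists v; first exact: orb_refl.
  move=> w wC; apply/eqP; apply: contraT => h.
  have : w \in bad v by rewrite inE wC h.
  by rewrite bad0 inE.
move=> wbad; have := wbad; rewrite inE => /andP[wC wb].
have [|v' v'O v'E] := IH (Phi w v).
  have sub : bad (Phi w v) \subset bad v :\ w.
    apply/subsetP => u; rewrite !inE BPhi => /andP[uC].
    have [->|uw] := eqVneq u w; last by rewrite uC.
    by move: wb; case: (w \in B v); case: (w \in E).
  by apply: leq_ltn_trans (subset_leq_card sub) _; move: lt; rewrite (cardsD1 w) wbad.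
by exists v' => //; rewrite -(orb_eq (orb_Phi v wC)).
Qed.

Lemma chains_comparable v C : C \in chains (F v) -> comparable_family C.
Proof. by case/chainsP. Qed.

Lemma chains_Phi w v D : w \in D -> D \in chains (F v) -> D \in chains (F (Phi w v)).
Proof.
move=> wD /chainsP[DF Dc]; apply/chainsP; split=> // u uD; have [uF u0] := DF u uD.
have [wF _] := DF w wD; split=> //; have /orP[wu|uw] := Dc _ _ wD uD.
  by rewrite FPhi.
by apply: (face_sub (FC _) _ uw); rewrite FPhi.
Qed.

Lemma chains_orb C D v v' : C \subset D -> v' \in orb C v -> D \in chains (F v) -> D \in chains (F v').
Proof. by move=> /subsetP CD v'O DF; apply: (@orb_ind C v (fun v' => D \in chains (F v'))) v'O => // w u /CD wD; exact: chains_Phi. Qed.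

(* inl (v, c) is the vertex c of the sphere of the chamber v; inr (orb C v, C) is
   shared by all chambers reached from v through the walls in C, and is the
   centre of v for C = set0. *)
Definition gvert : finType := (V * X + {set V} * {set {set X}})%type.

Definition local_vertex v (z : X + {set {set X}}) : gvert :=
  match z with inl c => inl (v, c) | inr C => inr (orb C v, C) end.

Lemma local_vertex_inj v : injective (local_vertex v).
Proof. by move=> [c|C] [c'|C'] //= [] // => [->|_ ->]. Qed.

Definition local_chamber v : {set {set gvert}} := [set local_vertex v @: s | s : {set _} in chamber (F v)].
Definition local_cubical v : {set {set gvert}} :=
  [set local_vertex v @: s | s : {set _} in cubical_chamber (F v)].

Definition glued : {set {set gvert}} := [set s | [exists v, s \in local_chamber v]].
Definition cubical : {set {set gvert}} := [set s | [exists v, s \in local_cubical v]].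

Lemma gluedP s : s \in glued <-> exists v, s \in local_chamber v.
Proof. by rewrite inE; split=> [/existsP|H]; last apply/existsP. Qed.
Lemma cubicalP s : s \in cubical <-> exists v, s \in local_cubical v.
Proof. by rewrite inE; split=> [/existsP|H]; last apply/existsP. Qed.

Lemma local_chamber_complex v : is_complex (local_chamber v).
Proof. by apply: imset_complex; apply: chamber_complex. Qed.
Lemma local_cubical_complex v : is_complex (local_cubical v).
Proof. by apply: imset_complex; apply: cubical_chamber_complex. Qed.

Hypothesis v0 : V.

Lemma glued_complex : is_complex glued.
Proof.
split; first by apply/gluedP; exists v0; case: (local_chamber_complex v0).
move=> s t /gluedP[v sv] ts; apply/gluedP; exists v; exact: (face_sub (local_chamber_complex v) sv ts).
Qed.
Lemma cubical_complex : is_complex cubical.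
Proof.
split; first by apply/cubicalP; exists v0; case: (local_cubical_complex v0).
move=> s t /cubicalP[v sv] ts; apply/cubicalP; exists v; exact: (face_sub (local_cubical_complex v) sv ts).
Qed.

(** Positions do not depend on the chamber, so a single linear map restricts to a chart on every
    chamber. *)
Definition gposition (z : gvert) : vec (option X) :=
  match z with inl (_, c) => position R (inl c) | inr (_, C) => position R (inr C) end.

Lemma gposition_push v x : combination gposition (push (local_vertex v) x) = combination (@position R X) x.
Proof.
by rewrite /push comb_comb; apply: eq_comb => z _; rewrite comb_unit; case: z.
Qed.

Lemma local_chamber_iso v : exists g,
  isof (cone (local_chamber v)) (chamber_region (F v)) (combination gposition) g.
Proof.
have inj := @local_vertex_inj v.
apply: comb_iso => [|_ /(cone_push inj)[x Kx ->]|_ _ /(cone_push inj)[x Kx ->] /(cone_push inj)[y Ky ->]|p].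
- exact: local_chamber_complex.
- rewrite gposition_push; exact: position_region.
- by rewrite !gposition_push => /(position_inj Kx Ky)->.
move=> /(position_surj (FC v))[x Kx <-]; exists (push (local_vertex v) x); last exact: gposition_push.
by apply/(cone_push inj); exists x.
Qed.

Lemma local_cubical_iso v : exists g,
  isof (cone (local_cubical v)) (chamber_region (F v)) (combination gposition) g.
Proof.
have inj := @local_vertex_inj v.
apply: comb_iso => [|_ /(cone_push inj)[x Kx ->]|_ _ /(cone_push inj)[x Kx ->] /(cone_push inj)[y Ky ->]|p].
- exact: local_cubical_complex.
- rewrite gposition_push; exact: position_cubical_region.
- by rewrite !gposition_push => /(position_cubical_inj Kx Ky)->.
move=> /position_cubical_surj[x Kx <-]; exists (push (local_vertex v) x); last exact: gposition_push.
by apply/(cone_push inj); exists x.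
Qed.

(** Inner vertices carry the label of their chamber, so a simplex shared by two chambers has none,
    and then it is a simplex of the cubical model too. *)
Lemma chamber_overlap v v' s : v != v' -> s \in local_chamber v -> s \in local_chamber v' -> s \in local_cubical v.
Proof.
move=> vv' /imsetP[t tK ->] /imsetP[t' _ tt']; apply/imsetP; exists t => //.
have /chamberP[tF tC tw t0] := tK; rewrite inE tC andbT; apply/eqP/setP => c; rewrite [RHS]inE.
apply/negP; rewrite inE => ct; have : local_vertex v (inl c) \in local_vertex v @: t by exact: imset_f.
rewrite tt' => /imsetP[[c'|//] _ [vv]]; by rewrite vv eqxx in vv'.
Qed.

(** The centre belongs to one chamber because [orb set0 v] is [[set v]], and away from the centre a
    cubical simplex is a simplex of the collar. *)
Lemma cubical_overlap v v' s : v != v' -> s \in local_cubical v -> s \in local_cubical v' -> s \in local_chamber v.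
Proof.
move=> vv' /imsetP[t + ->] /imsetP[t' _ tt']; rewrite inE => /andP[/eqP ti tC].
have nt0 : set0 \notin outer t.
  apply/negP; rewrite inE => t0; have : local_vertex v (inr set0) \in local_vertex v @: t by exact: imset_f.
  rewrite tt' => /imsetP[[//|C] _ [+ C0]]; rewrite -C0 !orb0 => /setP/(_ v).
  by rewrite !inE eqxx (negPf vv').
apply/imsetP; exists t => //; apply/chamberP; rewrite ti; split=> //.
- by case: (FC v).
- by move=> C w _ _; exact: sub0set.
- by rewrite (negPf nt0).
Qed.

(** On each chamber the two models are charts of the same region. On what two chambers share both
    models have the same simplices, so every transition is the identity there and the transitions
    glue. *)
Lemma glued_cubical_iso : iso (@cone R _ glued) (@cone R _ cubical).
Proof.
have /choice[f fP] := local_chamber_iso; have /choice[g gP] := local_cubical_iso.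
have fg v : isof (@cone R _ (local_chamber v)) (cone (local_cubical v))
    (fun x => g v (combination gposition x)) (fun x => f v (combination gposition x)).
  exact: isof_trans (fP v) (isof_sym (gP v)).
apply: (iso_glue glued_complex cubical_complex gluedP cubicalP) fg _ _.
- exact: local_chamber_complex.
- exact: local_cubical_complex.
- move=> v v' x Kv Kv'; have [->//|vv'] := eqVneq v v'.
  have [x0 xv] := (coneP _ _).1 Kv; have [_ xv'] := (coneP _ _).1 Kv'.
  have Lv : cone (local_cubical v) x by apply/coneP; split=> //; exact: chamber_overlap vv' xv xv'.
  have Lv' : cone (local_cubical v') x.
    by apply/coneP; split=> //; apply: chamber_overlap xv' xv; rewrite eq_sym.
  have [_ _ /(_ _ Lv)[_ ->] _] := gP v; by have [_ _ /(_ _ Lv')[_ ->] _] := gP v'.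
move=> v v' x Kv Kv'; have [->//|vv'] := eqVneq v v'.
have [x0 xv] := (coneP _ _).1 Kv; have [_ xv'] := (coneP _ _).1 Kv'.
have Lv : cone (local_chamber v) x by apply/coneP; split=> //; exact: cubical_overlap vv' xv xv'.
have Lv' : cone (local_chamber v') x.
  by apply/coneP; split=> //; apply: cubical_overlap xv' xv; rewrite eq_sym.
have [_ _ /(_ _ Lv)[_ ->] _] := fP v; by have [_ _ /(_ _ Lv')[_ ->] _] := fP v'.
Qed.

Lemma cubical_vertex u : [set u] \in cubical ->
  exists v C, C \in chains (F v) /\ u = inr (orb C v, C).
Proof.
move=> /cubicalP[v /imsetP[t tK ut]]; have : u \in local_vertex v @: t by rewrite -ut inE.
case/imsetP=> -[c|C] zt ->; move: tK; rewrite inE => /andP[/eqP ti tC].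
  by move/setP/(_ c): ti; rewrite !inE zt.
exists v, C; split=> //; have [->|C0] := eqVneq C set0; first by case: (chains_complex (F v)).
have /chainsP[H _] := tC; by have [] := H C; rewrite // in_setD1 C0 inE.
Qed.

(** * Links in the cubical model *)

Section CubicalLink.
Variables (v : V) (C : {set {set X}}).
Hypothesis CF : C \in chains (F v).
Let u : gvert := inr (orb C v, C).

Definition embed v' (z : vec {set {set X}}) : vec gvert :=
  combination (fun D => unitv R (inr (orb D v', D) : gvert)) z.

Lemma embed_inl v' z p : embed v' z (inl p) = 0.
Proof. by rewrite ffunE big1 // => D _; rewrite ffunE mulr0. Qed.

Lemma embed_inr v' z O D : embed v' z (inr (O, D)) = if O == orb D v' then z D else 0.
Proof.
rewrite ffunE (bigD1 D) //= ffunE (inj_eq inr_inj) xpair_eqE eqxx andbT.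
rewrite big1 ?addr0 => [|D' /negPf DD']; first by case: eqP; rewrite ?mulr1 ?mulr0.
by rewrite ffunE (inj_eq inr_inj) xpair_eqE eq_sym [D == _]eq_sym DD' andbF mulr0.
Qed.

(** Coordinates for the link: a chamber around the vertex and weights on a chain of chains through
    [C], with [C] itself having weight 0. The chamber is not determined by the point, which is why
    signs are read from orbits in [unfold]. *)
Definition link_data v' (z : vec {set {set X}}) : Prop :=
  [/\ v' \in orb C v, forall D, 0 <= z D, z C = 0 & (C |: supp z) :\ set0 \in chains (chains (F v'))].

Lemma cone_cubical_link x : cone (link cubical u) x <->
  exists v' z, link_data v' z /\ x = embed v' z.
Proof.
split=> [/coneP[x0]|[v' [z [[v'O z0 zC zF] ->]]]].
  rewrite inE => /andP[/suppP xu /cubicalP[v' /imsetP[t tK xt]]].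
  move: tK; rewrite inE => /andP[/eqP ti tC].
  have tP a : a \in u |: supp x -> exists2 D, D \in outer t & a = inr (orb D v', D).
    rewrite xt => /imsetP[[c|D] at_ ->]; last by exists D; rewrite ?inE.
    by move/setP/(_ c): ti; rewrite !inE at_.
  have [D0 D0t [OO CD]] := tP u (setU11 _ _); rewrite -{}CD in D0t OO.
  pose z : vec {set {set X}} := [ffun D => x (inr (orb D v', D))].
  exists v', z; split; last first.
    apply/ffunP => -[p|[O D]].
      rewrite embed_inl; apply/suppP/negP => xp.
      by have [|//] := tP (inl p); rewrite in_setU xp orbT.
    rewrite embed_inr ffunE; case: eqP => [->//|OD].
    apply/suppP/negP => xp; have [|D' _ [OD' DD']] := tP (inr (O, D)); first by rewrite in_setU xp orbT.
    by case: OD; rewrite OD' DD'.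
  split; first by apply/orb_eqP.
  - by move=> D; rewrite ffunE.
  - by rewrite ffunE -OO.
  apply: (face_sub (chains_complex _) tC); apply: setSD; rewrite subUset sub1set D0t /=.
  apply/subsetP => D; rewrite inE ffunE => xD.
  have [|D' D't [_ ->]//] := tP (inr (orb D v', D)).
  by rewrite in_setU [_ \in supp x]inE xD orbT.
have OO : orb C v = orb C v' by apply/esym/orb_eq.
have x0 a : 0 <= embed v' z a by apply: comb_ge0 => // D _; rewrite ffunE ler0n.
apply/coneP; split=> //; rewrite inE; apply/andP; split.
  by apply/suppP; rewrite embed_inr zC if_same.
apply/cubicalP; exists v'; pose t : {set X + {set {set X}}} := inr @: (C |: supp z).
have to : outer t = C |: supp z by apply/setP => D; rewrite [LHS]inE mem_imset //; exact: inr_inj.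
apply/imsetP; exists t.
  rewrite inE to zF andbT; apply/eqP/setP => c; rewrite inE [RHS]inE.
  by apply/negP => /imsetP[].
rewrite -imset_comp imsetU1 /= /u OO; congr (_ |: _).
apply/setP => -[p|[O D]]; rewrite inE ?embed_inl ?embed_inr.
  by rewrite eqxx; apply/esym/negP => /imsetP[].
apply/idP/imsetP => [|[D' zD' [-> ->]]].
  by case: (O =P orb D v') => [-> zD|_]; rewrite ?eqxx //; exists D; rewrite // inE.
by rewrite eqxx; rewrite inE in zD'.
Qed.

Lemma link_comparable v' z D D' : link_data v' z -> D \in C |: supp z -> D' \in C |: supp z ->
  (D \subset D') || (D' \subset D).
Proof.
move=> [_ _ _ /chainsP[_ H]] Dz D'z; have [->|D0] := eqVneq D set0; first by rewrite sub0set.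
have [->|D'0] := eqVneq D' set0; first by rewrite sub0set orbT.
by apply: H; rewrite in_setD1 ?D0 ?D'0.
Qed.

(** Every member D of a chain through [C] is below or above [C]. [lower] indexes the former by C
    minus D and [upper] the latter by D minus C, so that each is a layer decomposition, one of a
    function on [C] and one of a function off [C]. *)
Definition lower (z : vec {set {set X}}) : vec {set {set X}} :=
  [ffun G => if (G != set0) && (G \subset C) then z (C :\: G) else 0].
Definition upper (z : vec {set {set X}}) : vec {set {set X}} :=
  [ffun G => if (G != set0) && [disjoint C & G] then z (C :|: G) else 0].

Lemma nested_lower v' z : link_data v' z -> nested (lower z).
Proof.
move=> zd; have [_ z0 zC _] := zd; split=> [G||G G']; rewrite ?ffunE ?eqxx //; first by case: ifP.
rewrite !inE !ffunE; case: ifP => [/andP[_ GC] zG|]; last by rewrite eqxx.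
case: ifP => [/andP[_ GC'] zG'|]; last by rewrite eqxx.
have : (C :\: G \subset C :\: G') || (C :\: G' \subset C :\: G).
  by apply: (link_comparable zd); rewrite in_setU [_ \in supp z]inE ?zG ?zG' orbT.
have CC (H : {set {set X}}) : H \subset C -> C :\: (C :\: H) = H by move=> HC; rewrite setDDr setDv set0U; exact/setIidPr.
by case/orP=> /(setDS C); rewrite !CC // => ->; rewrite ?orbT.
Qed.

Lemma setUCD (D : {set {set X}}) : C :|: (D :\: C) = C :|: D.
Proof. by apply/setP => w; rewrite !inE; case: (w \in C). Qed.

Lemma disjointCD (D : {set {set X}}) : [disjoint C & D :\: C].
Proof. by rewrite -setI_eq0; apply/eqP/setP => w; rewrite !inE; case: (w \in C). Qed.

Lemma nested_upper v' z : link_data v' z -> nested (upper z).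
Proof.
move=> zd; have [_ z0 zC _] := zd; split=> [G||G G']; rewrite ?ffunE ?eqxx //; first by case: ifP.
rewrite !inE !ffunE; case: ifP => [/andP[_ GC] zG|]; last by rewrite eqxx.
case: ifP => [/andP[_ GC'] zG'|]; last by rewrite eqxx.
have : (C :|: G \subset C :|: G') || (C :|: G' \subset C :|: G).
  by apply: (link_comparable zd); rewrite in_setU [_ \in supp z]inE ?zG ?zG' orbT.
have CC (H : {set {set X}}) : [disjoint C & H] -> (C :|: H) :\: C = H.
  by move=> HC; rewrite setDUl setDv set0U; apply/setDidPl; rewrite disjoint_sym.
by case/orP=> /(setSD C); rewrite !CC // => ->; rewrite ?orbT.
Qed.

Local Notation bary2 := (combination (@indicator R {set X})).

Lemma bary_lower v' z w : link_data v' z -> w \in C -> bary2 (lower z) w = \sum_(D : {set {set X}} | w \notin D) z D.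
Proof.
move=> zd wC; rewrite baryE.
transitivity (\sum_(G : {set {set X}} | (w \in G) && (G \subset C)) z (C :\: G)).
  rewrite [RHS]big_mkcondr; apply: eq_bigr => G wG; rewrite ffunE.
  by rewrite (_ : G != set0) //; apply/set0Pn; exists w.
rewrite (reindex_onto (fun D => C :\: D) (fun G => C :\: G)) /=; last first.
  by move=> G /andP[_ GC]; rewrite setDDr setDv set0U; exact/setIidPr.
rewrite [RHS](bigID (fun D : {set {set X}} => D \subset C)) /= [X in _ + X]big1 ?addr0; last first.
  move=> D /andP[wD DC]; apply/suppP/negP => zD.
  have /orP[CD|] := link_comparable zd (setU11 _ _) (subsetP (subsetUr _ _) _ zD); last by rewrite (negPf DC).
  by rewrite (subsetP CD) in wD.
apply: eq_big => [D|D /andP[_ /eqP->]//].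
rewrite !inE wC subsetDl !andbT setDDr setDv set0U; congr (_ && _).
exact: (sameP eqP (setIidPr)).
Qed.

Lemma bary_upper v' z w : link_data v' z -> w \notin C -> bary2 (upper z) w = \sum_(D : {set {set X}} | w \in D) z D.
Proof.
move=> zd wC; rewrite baryE.
transitivity (\sum_(G : {set {set X}} | (w \in G) && [disjoint C & G]) z (C :|: G)).
  rewrite [RHS]big_mkcondr; apply: eq_bigr => G wG; rewrite ffunE.
  by rewrite (_ : G != set0) //; apply/set0Pn; exists w.
rewrite (reindex_onto (fun D => D :\: C) (fun G => C :|: G)) /=; last first.
  move=> G /andP[_ GC]; rewrite setDUl setDv set0U; apply/setDidPl; by rewrite disjoint_sym.
rewrite [RHS](bigID (fun D : {set {set X}} => C \subset D)) /= [X in _ + X]big1 ?addr0; last first.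
  move=> D /andP[wD DC]; apply/suppP/negP => zD.
  have /orP[|CD] := link_comparable zd (setU11 _ _) (subsetP (subsetUr _ _) _ zD); first by rewrite (negPf DC).
  by rewrite (subsetP CD) in wC.
apply: eq_big => [D|D /andP[_ /eqP->]//].
rewrite !inE wC /= disjointCD andbT setUCD; congr (_ && _).
exact: (sameP eqP (setUidPr)).
Qed.

(** The bit of [w] as a sign. It is used for the orbit of a chain not containing [w], on which this
    bit is constant by [orb_bits]. *)
Definition wall_sign (O : {set V}) w : R := if [exists v' in O, w \in B v'] then 1 else -1.

Lemma wall_signE D v' w : w \notin D -> wall_sign (orb D v') w = if w \in B v' then 1 else -1.
Proof.
move=> wD; rewrite /wall_sign; congr (if _ then _ else _).
apply/exists_inP/idP => [[v1 v1O]|wB]; first by rewrite (orb_bits wD v1O).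
by exists v'; rewrite ?orb_refl.
Qed.

(* Unfolds the 2^|C| chambers around the vertex u: reflection in the wall w
   changes the sign of the coordinate w. *)
Definition unfold (a : gvert) : vec {set X} :=
  match a with
  | inl _ => 0
  | inr (Q, D) => [ffun w => if w \in C then if w \in D then 0 else wall_sign Q w else (w \in D)%:R]
  end.

Lemma unfoldE v' z w : link_data v' z -> combination unfold (embed v' z) w =
  if w \in C then (if w \in B v' then 1 else -1) * bary2 (lower z) w else bary2 (upper z) w.
Proof.
move=> zd; rewrite /embed comb_comb ffunE.
under eq_bigr do rewrite comb_unit /= ffunE.
case: ifP => wC.
  rewrite (bary_lower zd wC) mulr_sumr [RHS]big_mkcond; apply: eq_bigr => D _.
  have [wD|wD] /= := boolP (w \in D); first by rewrite mulr0.
  by rewrite wall_signE // mulrC.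
rewrite (bary_upper zd) ?wC // [RHS]big_mkcond; apply: eq_bigr => D _.
by case: ifP; rewrite ?mulr1 ?mulr0.
Qed.

Lemma data_off v' z D : link_data v' z -> ~~ (D \proper C) -> ~~ (C \proper D) -> z D = 0.
Proof.
move=> zd; have [_ _ zC _] := zd; move=> DC CD.
apply/suppP/negP => zD; have [DE|DE] := eqVneq D C; first by rewrite inE DE zC eqxx in zD.
have := link_comparable zd (setU11 _ _) (subsetP (subsetUr _ _) _ zD).
by move: DC CD; rewrite !properEneq [C == D]eq_sym DE /= => /negPf-> /negPf->.
Qed.

Lemma lower_proper z D : D \proper C -> lower z (C :\: D) = z D.
Proof.
move=> DC; rewrite ffunE subsetDl andbT setDDr setDv set0U (setIidPr (proper_sub DC)).
by rewrite setD_eq0 (negPf (proper_subn DC)).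
Qed.

Lemma upper_proper z D : C \proper D -> upper z (D :\: C) = z D.
Proof.
move=> CD; rewrite ffunE setD_eq0 (negPf (proper_subn CD)) /=.
by rewrite disjointCD setUCD (setUidPr (proper_sub CD)).
Qed.

Lemma unfold_inj x y : cone (link cubical u) x -> cone (link cubical u) y ->
  combination unfold x = combination unfold y -> x = y.
Proof.
move=> /cone_cubical_link[v1 [z1 [d1 ->]]] /cone_cubical_link[v2 [z2 [d2 ->]]] xy.
have [v1O z10 z1C _] := d1; have [v2O z20 z2C _] := d2.
have xyw w : combination unfold (embed v1 z1) w = combination unfold (embed v2 z2) w :=
  congr1 (fun p : vec {set X} => p w) xy.
have key w := etrans (esym (unfoldE w d1)) (etrans (xyw w) (unfoldE w d2)).
move: {xy xyw} key => key.
have n1 := nested_lower d1; have n2 := nested_lower d2.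
(* Both sides are a sign times a nonnegative number, so the numbers agree even if the signs do
   not. *)
have lowE w : w \in C -> bary2 (lower z1) w = bary2 (lower z2) w.
  move=> wC; have := key w; rewrite wC => E.
  have b1 : 0 <= bary2 (lower z1) w by apply: bary_ge0; case: n1.
  have b2 : 0 <= bary2 (lower z2) w by apply: bary_ge0; case: n2.
  by move: E b1 b2; case: ifP => _; case: ifP => _; lra.
have low_out z w : w \notin C -> bary2 (lower z) w = 0.
  move=> wC; rewrite baryE big1 // => G wG; rewrite ffunE; case: ifP => // /andP[_ /subsetP GC].
  by rewrite GC in wC.
have up_out z w : w \in C -> bary2 (upper z) w = 0.
  move=> wC; rewrite baryE big1 // => G wG; rewrite ffunE; case: ifP => // /andP[_ CG].
  by rewrite (disjointFr CG wC) in wG.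
have low : lower z1 = lower z2.
  apply: bary_inj => //; apply/ffunP => w; have [wC|wC] := boolP (w \in C); first exact: lowE.
  by rewrite !low_out.
have up : upper z1 = upper z2.
  apply: bary_inj; [exact: nested_upper d1 | exact: nested_upper d2 |].
  apply/ffunP => w; have [wC|wC] := boolP (w \in C); first by rewrite !up_out.
  by have := key w; rewrite (negPf wC).
have zz : z1 = z2.
  apply/ffunP => D; have [DC|DC] := boolP (D \proper C).
    by rewrite -!(lower_proper _ DC) low.
  have [CD|CD] := boolP (C \proper D); first by rewrite -!(upper_proper _ CD) up.
  by rewrite (data_off d1) // (data_off d2).
subst z2; apply/ffunP => -[p|[O D]]; first exact: etrans (embed_inl v1 z1 p) (esym (embed_inl v2 z1 p)).
apply: etrans (embed_inr v1 z1 O D) (etrans _ (esym (embed_inr v2 z1 O D))); have [zD|/suppP->] := boolP (D \in supp z1); last by rewrite !if_same.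
have v12 : v2 \in orb C v1 by rewrite (orb_eq v1O).
suff -> : orb D v1 = orb D v2 by [].
apply/orb_eqP; have [DC|DC] := boolP (D \proper C); last first.
  apply: (subsetP (orb_sub _ _)) v12.
  have /orP[//|DC'] := link_comparable d1 (setU11 _ _) (subsetP (subsetUr _ _) _ zD).
  move: DC; rewrite properEneq DC' andbT negbK => /eqP DC.
  by move: zD; rewrite inE DC z1C eqxx.
(* At a wall [w] of [C] outside [D] the coordinate is nonzero, because [D] has positive weight. Its
   sign then determines the bit of [w], and agreement outside [D] is what [orb_agree] asks for. *)
apply/orb_eqP/esym/orb_eqP; apply: orb_agree (chains_comparable CF) (proper_sub DC) _ _.
  exact/orb_eqP/esym/orb_eqP.
move=> w wC wD; have := key w; rewrite wC.
have : 0 < bary2 (lower z1) w.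
  apply: lt_le_trans (bary_ge (w := C :\: D) _ _); first last.
  - by rewrite inE wD.
  - by case: n1.
  by rewrite (lower_proper _ DC) lt_def z10 andbT; rewrite inE in zD.
by case: (w \in B v1); case: (w \in B v2) => //; lra.
Qed.

Lemma unfold_cone x : cone (link cubical u) x -> coneT (chains (F v)) C (combination unfold x).
Proof.
move=> /cone_cubical_link[v' [z [zd ->]]]; have [v'O z0 zC zF] := zd.
have yE w := unfoldE w zd.
split=> [w wC|].
  by rewrite yE (negPf wC); apply: bary_ge0 => G; rewrite ffunE; case: ifP.
have [M MS Mmax] := largest_set (setU11 C (supp z)) (fun D D' => link_comparable zd).
have MF : M \in chains (F v').
  have [->|M0] := eqVneq M set0; first by case: (chains_complex (F v')).
  by have [H _] := chainsP _ _ zF; have [] := H M; rewrite // in_setD1 M0.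
have CM : C \subset M by apply: Mmax; exact: setU11.
apply: (face_sub (chains_complex _) (s := M)).
  by apply: (chains_orb CM) MF; rewrite (orb_eq v'O) orb_refl.
rewrite subUset CM /=; apply/subsetP => w; rewrite [_ \in supp _]inE.
have [wC|wC] := boolP (w \in C); first by rewrite (subsetP CM).
rewrite yE (negPf wC) (bary_upper zd wC).
apply: contra_neqT => wM; apply: big1 => D wD; apply/suppP; apply: contra wM => zD.
by apply: (subsetP (Mmax D _)) wD; rewrite in_setU zD orbT.
Qed.

Lemma unfold_surj y : coneT (chains (F v)) C y ->
  exists2 x, cone (link cubical u) x & combination unfold x = y.
Proof.
move=> [y0 yF].
pose e : vec {set X} := [ffun w => if w \in C then `|y w| else 0].
pose f : vec {set X} := [ffun w => if w \in C then 0 else y w].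
have e0 w : 0 <= e w by rewrite ffunE; case: ifP.
have f0 w : 0 <= f w by rewrite ffunE; case: ifP => // /negbT/y0.
have [G [[G0 Gs Gc] Ge] GS] := bary_surj e0.
have [H [[H0 Hs Hc] Hf] HS] := bary_surj f0.
have eC : supp e \subset C by apply/subsetP => w; rewrite inE ffunE; case: ifP; rewrite ?eqxx.
have fC : supp f \subset supp y :\: C.
  by apply/subsetP => w; rewrite !inE ffunE; case: ifP; rewrite ?eqxx.
have GC D : D \in supp G -> D \subset C by move=> /GS/subset_trans; apply.
have HC D : D \in supp H -> D \subset supp y :\: C by move=> /HS/subset_trans; apply.
(* The chamber around the vertex whose bits are the signs of the coordinates of [y]. *)
have [v' v'O v'B] := orb_bits_exist C v [set w | 0 < y w].
pose z : vec {set {set X}} := [ffun D : {set {set X}} => if D \proper C then G (C :\: D)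
  else if C \proper D then H (D :\: C) else 0].
have zsupp D : D \in C |: supp z ->
    [\/ D = C, D \proper C /\ C :\: D \in supp G | C \proper D /\ D :\: C \in supp H].
  rewrite in_setU1 => /orP[/eqP->|]; first by constructor 1.
  rewrite inE ffunE; case: ifP => DC; first by constructor 2; rewrite inE.
  by case: ifP => CD; [constructor 3; rewrite inE | rewrite eqxx].
have CC (D : {set {set X}}) : D \subset C -> C :\: (C :\: D) = D.
  by move=> DC; rewrite setDDr setDv set0U; exact/setIidPr.
have DD (D : {set {set X}}) : C \subset D -> C :|: (D :\: C) = D.
  by move=> DC; rewrite setUCD; exact/setUidPr.
have zd : link_data v' z.
  split=> // [D||].
  - by rewrite ffunE; do 2?case: ifP.
  - by rewrite ffunE properxx.
  have CF' : C \in chains (F v') by exact: chains_orb (subxx _) v'O CF.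
  apply/chainsP; split=> [D /setD1P[D0 /zsupp zD]|D D' /setD1P[_ /zsupp zD] /setD1P[_ /zsupp zD']].
    split=> //; case: zD => [->//|[DC _]|[CD /HC/subsetP HD]].
      exact: (face_sub (chains_complex _) CF' (proper_sub DC)).
    apply: (chains_orb (proper_sub CD) v'O); apply: (face_sub (chains_complex _) yF).
    apply/subsetP => w wD; rewrite in_setU; case: (boolP (w \in C)) => //= wC.
    by have := HD w; rewrite !inE wC wD => /(_ isT).
  case: zD => [->|[DC DG]|[CD DH]]; case: zD' => [->|[DC' DG']|[CD' DH']].
  - by rewrite subxx.
  - by rewrite (proper_sub DC') orbT.
  - by rewrite (proper_sub CD').
  - by rewrite (proper_sub DC).
  - by have /orP[] := Gc _ _ DG DG' => /(setDS C); rewrite !CC ?(proper_sub DC) ?(proper_sub DC') // => ->; rewrite ?orbT.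
  - by rewrite (subset_trans (proper_sub DC) (proper_sub CD')).
  - by rewrite (proper_sub CD) orbT.
  - by rewrite (subset_trans (proper_sub DC') (proper_sub CD)) orbT.
  - by have /orP[] := Hc _ _ DH DH' => /(setUS C); rewrite !DD ?(proper_sub CD) ?(proper_sub CD') // => ->; rewrite ?orbT.
have low : lower z = G.
  apply/ffunP => D; rewrite ffunE; case: ifPn => [/andP[D0 DC]|nD].
    rewrite ffunE CC // ifT // properEneq subsetDl andbT.
    by apply: contra D0 => /eqP CD; rewrite -(CC D DC) CD setDv.
  apply/esym/suppP; apply: contra nD => DG; rewrite GC // andbT.
  by apply: contraTneq DG => ->; rewrite inE Gs eqxx.
have up : upper z = H.
  apply/ffunP => D; rewrite ffunE; case: ifPn => [/andP[D0 CD]|nD].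
    have DE : (C :|: D) :\: C = D.
      by rewrite setDUl setDv set0U; apply/setDidPl; rewrite disjoint_sym.
    have pCD : C \proper C :|: D.
      rewrite properEneq subsetUl andbT; apply: contra D0 => /eqP CE.
      by rewrite -DE -CE setDv.
    by rewrite ffunE DE pCD ifN // properE (proper_sub pCD) andbF.
  apply/esym/suppP; apply: contra nD => DH; apply/andP; split.
    by apply: contraTneq DH => ->; rewrite inE Hs eqxx.
  have := HC D DH; rewrite subsetD disjoint_sym; by case/andP.
exists (embed v' z); first by apply/cone_cubical_link; exists v', z.
apply/ffunP => w; rewrite (unfoldE w zd) low up Ge Hf !ffunE.
have [wC|//] := boolP (w \in C); rewrite v'B // inE.
case: (ltrP 0 (y w)) => yw; first by rewrite mul1r gtr0_norm.
by rewrite mulN1r ler0_norm // opprK.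
Qed.

Lemma cubical_link_iso : iso (@cone R _ (link cubical u)) (@coneT R _ (chains (F v)) C).
Proof.
suff [g H] : exists g, isof (cone (link cubical u)) (coneT (chains (F v)) C) (combination unfold) g.
  by exists (combination unfold), g.
apply: comb_iso.
- apply: (link_complex cubical_complex); apply/cubicalP; exists v; apply/imsetP.
  exists [set inr C]; last by rewrite imset_set1.
  rewrite inE; apply/andP; split; first by apply/eqP/setP => c; rewrite !inE.
  apply: (face_sub (chains_complex _) (s := [set C] :\ set0)); last first.
    by apply: setSD; apply/subsetP => D; rewrite !inE => /eqP[->].
  apply/chainsP; split=> [D /setD1P[D0 /set1P DC]|D D' /setD1P[_ /set1P->] /setD1P[_ /set1P->]].
    by split=> //; rewrite DC.
  by rewrite subxx.
- exact: unfold_cone.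
- exact: unfold_inj.
- exact: unfold_surj.
Qed.

End CubicalLink.

(** Links in the two models are compared through tangent cones: having tangent cone R^(n+1) at every
    vertex passes from the cubical model to the glued complex, although their vertices differ. *)
Lemma glued_sphere_links n : (forall v, iso (@cone R _ (F v)) (@all_vec R 'I_n)) ->
  forall a, [set a] \in glued -> iso (@cone R _ (link glued a)) (@all_vec R 'I_n).
Proof.
move=> FS a aK; apply: (coneT_link glued_complex aK).
apply: coneT_all_vec_invariant aK; [exact: glued_complex | exact: cubical_complex | exact: glued_cubical_iso |].
move=> b bQ; apply: (link_coneT cubical_complex bQ).
have [v [C [CF ->]]] := cubical_vertex bQ.
apply: iso_trans (cubical_link_iso CF) _; apply: coneT_all_vec CF; first exact: chains_complex.
exact: iso_trans (chains_iso R (FC v)) (FS v).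
Qed.

End Gluing.

(** * Orientations *)

Section LinkFacets.
Variables (T : finType) (K : {set {set T}}).

Lemma maxset_link (a : T) (t : {set T}) : a \in t ->
  maxset (fun s : {set T} => s \in K) t -> maxset (fun s : {set T} => s \in link K a) (t :\ a).
Proof.
move=> at_ /maxsetP[tK tmax]; apply/maxsetP; split.
  by rewrite inE setD1K // tK !inE eqxx.
move=> s; rewrite inE => /andP[as_ sK] ts.
rewrite -(tmax (a |: s) sK) ?setU1K // -(setD1K at_); exact: setUS.
Qed.

Lemma link_maxset (a : T) (s : {set T}) : maxset (fun s : {set T} => s \in link K a) s ->
  a \notin s /\ maxset (fun s : {set T} => s \in K) (a |: s).
Proof.
move=> /maxsetP[+ smax]; rewrite inE => /andP[as_ sK]; split=> //; apply/maxsetP; split=> // t tK st.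
have at_ : a \in t by apply: (subsetP st); exact: setU11.
rewrite -(setD1K at_) (smax (t :\ a)) //; first by rewrite inE setD1K // tK !inE eqxx.
by rewrite -(setU1K as_); exact: setSD.
Qed.

End LinkFacets.

Lemma orders_facet_link (T : finType) (K : {set {set T}}) (a : T) (s : seq T) :
  orders_facet (link K a) s = orders_facet K (a :: s).
Proof.
have sE : [set x in a :: s] = a |: [set x in s] by apply/setP => x; rewrite !inE.
apply/andP/andP => -[/= us smax].
  have [as_ ?] := link_maxset smax; rewrite inE in as_.
  by rewrite as_ us sE.
case/andP: us => as_ us; split=> //.
have -> : [set x in s] = [set x in a :: s] :\ a by rewrite sE setU1K // inE.
by apply: maxset_link smax; rewrite sE setU11.
Qed.

Lemma oiso_sign_of_maps (b : bool) (X Y : ocomplex) (f : carrier X -> carrier Y) (g : carrier Y -> carrier X) :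
  (forall s : {set carrier X}, s \in faces X -> f @: s \in faces Y) ->
  (forall s : {set carrier Y}, s \in faces Y -> g @: s \in faces X) ->
  (forall x, [set x] \in faces X -> g (f x) = x) -> (forall y, [set y] \in faces Y -> f (g y) = y) ->
  (forall s, orders_facet (faces X) s -> positive Y (map f s) = b (+) positive X s) ->
  oiso_sign b X Y.
Proof.
move=> fP gP gf fg pos.
have fV (x : overtex X) : [set f (val x)] \in faces Y by rewrite -imset_set1; apply/fP/(valP x).
have gV (y : overtex Y) : [set g (val y)] \in faces X by rewrite -imset_set1; apply/gP/(valP y).
pose f' x : overtex Y := exist _ (f (val x)) (fV x); pose g' y : overtex X := exist _ (g (val y)) (gV y).
exists f', g'; split.
- by move=> s /fP; rewrite -!imset_comp.
- by move=> s /gP; rewrite -!imset_comp.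
- by move=> x; apply: val_inj; apply/gf/(valP x).
- by move=> y; apply: val_inj; apply/fg/(valP y).
by move=> s /pos <-; rewrite -!map_comp.
Qed.

Section Orientation.
Variable R : realType.
Local Notation vec V := {ffun V -> R}.
Variables (V X : finType) (F : V -> {set {set X}}).
Variables (Phi : {set X} -> V -> V) (B : V -> {set {set X}}).
Variables (sg : V -> seq X -> bool) (n : nat) (v0 : V).
Implicit Types (v : V) (w r : {set X}) (C D : {set {set X}}).
Hypotheses (PhiK : forall w, involutive (Phi w))
  (PhiC : forall w w' v, w \subset w' -> Phi w (Phi w' v) = Phi w' (Phi w v))
  (BPhi : forall w v u, (u \in B (Phi w v)) = (u == w) (+) (u \in B v))
  (FPhi : forall w v r, w \in F v -> w \subset r -> (r \in F (Phi w v)) = (r \in F v))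
  (FC : forall v, is_complex (F v))
  (FS : forall v, iso (@cone R _ (F v)) (@all_vec R 'I_n))
  (sgC : forall v, coherent (OComplex (F v) (sg v)))
  (sgPhi : forall w v e, w != set0 -> orders_facet (F v) e -> w \subset e ->
     sg (Phi w v) e = ~~ sg v e)
  (n0 : (0 < n)%N).

Local Notation gvert := (gvert V X).
Local Notation glued := (glued F Phi).
Local Notation local_chamber := (local_chamber F Phi).
Local Notation local_vertex := (@local_vertex V X Phi).
Local Notation gposition := (@gposition R V X).
Local Notation orb := (@orb V X Phi).
Implicit Types (t : {set gvert}) (s : seq gvert) (a b : gvert) (e : seq X).

(** The support of the position of a vertex, the height left aside; [eta s] is the face of the
    sphere over which the vertices of [s] lie. *)
Definition shadow a : {set X} := match a with inl p => [set p.2] | inr p => cover p.2 end.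
Definition eta s : {set X} := \bigcup_(a <- s) shadow a.
Definition incident v a : bool := match a with inl p => p.1 == v | inr p => p.1 == orb p.2 v end.

Lemma gposition_ge0 a c : 0 <= gposition a (Some c).
Proof.
case: a => [[v d]|[O C]] /=; first by rewrite ffunE ler0n.
by rewrite ffunE; apply: bary_ge0 => w; rewrite ffunE ler0n.
Qed.

Lemma gposition_shadow a c : (gposition a (Some c) != 0) = (c \in shadow a).
Proof.
case: a => [[v d]|[O C]] /=; first by rewrite ffunE (inj_eq Some_inj) pnatr_eq0 eqb0 negbK inE.
rewrite ffunE -(in_set (fun c => combination (@indicator R X) (indicator R C) c != 0)) -/(supp _).
rewrite bary_supp => [|w]; last by rewrite ffunE ler0n.
rewrite /cover (_ : supp (indicator R C) = C) //; apply/setP => w.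
by rewrite inE ffunE pnatr_eq0 eqb0 negbK.
Qed.

Lemma etaP s c : reflect (exists2 a, a \in s & c \in shadow a) (c \in eta s).
Proof.
rewrite /eta; elim: s => [|a s IH]; first by rewrite big_nil inE; apply: ReflectF => -[].
rewrite big_cons inE; apply: (iffP orP) => [[ca|/IH[b bs cb]]|[b]].
- by exists a; rewrite ?inE ?eqxx.
- by exists b; rewrite // inE bs orbT.
rewrite inE => /orP[/eqP->|bs] cb; [by left | by right; apply/IH; exists b].
Qed.

Lemma incident_local v a : incident v a <-> exists z, a = local_vertex v z.
Proof.
split=> [|[[c|C] ->]] /=; try exact: eqxx.
by case: a => [[v' c]|[O C]] /= /eqP->; [exists (inl c) | exists (inr C)].
Qed.

Lemma local_chamber_incident v t a : t \in local_chamber v -> a \in t -> incident v a.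
Proof. by move=> /imsetP[s0 _ ->] /imsetP[z _ ->]; apply/incident_local; exists z. Qed.

Lemma eta_face v t s : t \in local_chamber v -> {subset s <= t} -> eta s \in F v.
Proof.
move=> /imsetP[s0 /chamberP[sF sC sw s00] ->] st.
suff [m mF mP] : exists2 m, m \in F v & forall z, z \in s0 -> shadow (local_vertex v z) \subset m.
  apply: (face_sub (FC v) mF); apply/subsetP => c /etaP[a /st/imsetP[z zs ->]].
  by apply: (subsetP (mP _ zs)).
have [o0|[C0 C0o]] := set_0Vmem (outer s0 :\ set0).
  exists (inner s0) => // -[c|C] zs; first by rewrite sub1set inE.
  have -> : C = set0.
    by apply/eqP; apply: contraT => C0; have := in_set0 C; rewrite -o0 !inE C0 zs.
  by rewrite /= /cover big_set0 sub0set.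
have [H1 H2] := chainsP _ _ sC.
have [C Co Cmax] := largest_set C0o H2.
have [/chainsP[G1 G2] /set0Pn[w0 w0C]] := H1 _ Co.
have [m mC mmax] := largest_set w0C G2.
exists m; first by have [] := G1 _ mC.
move=> [c|D] zs /=.
  rewrite sub1set; apply: (subsetP (sw C m _ mC)); last by rewrite inE.
  by move: Co; rewrite !inE => /andP[].
apply/bigcupsP => w wD; apply: mmax.
have Do : D \in outer s0 :\ set0 by rewrite !inE zs andbT; apply/set0Pn; exists w.
exact: (subsetP (Cmax D Do)).
Qed.

Local Notation facet := (maxset (fun t : {set gvert} => t \in glued)).

Let K_sphere a : [set a] \in glued -> iso (@cone R _ (link glued a)) (@all_vec R 'I_n).
Proof. exact: (glued_sphere_links PhiK PhiC BPhi FPhi FC v0 FS). Qed.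

Let KC : is_complex glued. Proof. exact: glued_complex FC v0. Qed.

Lemma extend_facet v (s0 : {set X + {set {set X}}}) z : facet (local_vertex v @: s0) -> z |: s0 \in chamber (F v) -> z \in s0.
Proof.
move=> fs zs; have := maxsetsup fs (B := local_vertex v @: (z |: s0)).
rewrite imsetU1 => H; have : local_vertex v z \in local_vertex v @: s0.
  rewrite -H ?subsetUr ?setU11 //; apply/gluedP; exists v; apply/imsetP; exists (z |: s0) => //.
  by rewrite imsetU1.
by rewrite mem_imset //; exact: local_vertex_inj.
Qed.

(** Otherwise the facet could be enlarged, by the centre if it has no outer vertex, and else by a
    colour in the smallest set of its largest chain. A vertex of either kind belongs to one chamber
    only, so a facet determines its chamber. *)
Lemma facet_center v (s0 : {set X + {set {set X}}}) : facet (local_vertex v @: s0) -> s0 \in chamber (F v) ->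
  (exists c, inl c \in s0) \/ inr set0 \in s0.
Proof.
move=> fs /chamberP[sF sC sw s00].
have [s0c|nc] := boolP (inr set0 \in s0); [by right | left].
have [o0|[C0 C0o]] := set_0Vmem (outer s0).
  have [i0|[c]] := set_0Vmem (inner s0); last by rewrite inE; exists c.
  case/negP: nc; apply: (extend_facet fs); apply/chamberP.
  have -> : inner (inr set0 |: s0) = set0 by rewrite -i0; apply/setP => c; rewrite !inE.
  have -> : outer (inr set0 |: s0) = [set set0].
    by apply/setP => C; rewrite !inE; have := in_set0 C; rewrite -o0 inE => ->; rewrite orbF.
  split=> //; first by case: (FC v).
    by rewrite setDv; case: (chains_complex (chains (F v))).
  by move=> C w; rewrite !inE => /eqP->; rewrite inE.
have out0 : outer s0 :\ set0 = outer s0.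
  by apply/setP => C; rewrite !inE; case: eqP => // ->; rewrite (negPf nc).
rewrite out0 in sC; have [H1 H2] := chainsP _ _ sC.
have [C Co Cmax] := largest_set C0o H2.
have [/chainsP[G1 G2] /set0Pn[w0 w0C]] := H1 _ Co.
have [m mC mmin] := smallest_set w0C G2.
have [mF /set0Pn[c cm]] := G1 _ mC; exists c; apply: (extend_facet fs); apply/chamberP.
have out1 : outer (inl c |: s0) = outer s0 by apply/setP => D; rewrite !inE.
have in1 : inner (inl c |: s0) = c |: inner s0 by apply/setP => d; rewrite !inE.
have sub D w : D \in outer s0 -> w \in D -> inner (inl c |: s0) \subset w.
  move=> Do wD; rewrite in1 subUset (sw D w) // andbT sub1set.
  by apply: (subsetP (mmin w _)) cm; exact: (subsetP (Cmax D Do)).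
rewrite out1 out0; split=> //.
exact: (face_sub (FC v) mF (sub C m Co mC)).
Qed.

Lemma facet_card t : facet t -> #|t| = n.+1.
Proof.
move=> ft; have tK := maxsetp ft.
have [t0|[a at_]] := set_0Vmem t.
  pose z : X + {set {set X}} := inr set0.
  have : z \in (set0 : {set X + {set {set X}}}).
    apply: (@extend_facet v0); first by rewrite imset0 -t0.
    apply/chamberP.
    have -> : inner (z |: set0) = set0 by apply/setP => c; rewrite !inE.
    have -> : outer (z |: set0) = [set set0] by apply/setP => C; rewrite !inE orbF.
    split=> //; first by case: (FC v0).
      by rewrite setDv; case: (chains_complex (chains (F v0))).
    by move=> C w; rewrite !inE => /eqP->; rewrite inE.
  by rewrite inE.
have aK : [set a] \in glued by apply: (face_sub KC tK); rewrite sub1set.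
rewrite (cardsD1 a) at_ add1n; congr S.
exact: sphere_facet_card (link_complex KC aK) (K_sphere aK) (maxset_link at_ ft).
Qed.

Lemma facet_chamber_unique v v' t : facet t -> t \in local_chamber v ->
  (forall a, a \in t -> incident v' a) -> v' = v.
Proof.
move=> ft /imsetP[s0 s0K tE]; rewrite tE in ft * => inc.
have [[c cs]|cs] := facet_center ft s0K.
  by have := inc _ (imset_f (local_vertex v) cs) => /eqP.
have := inc _ (imset_f (local_vertex v) cs); rewrite /= !orb0 => /eqP/setP/(_ v).
by rewrite !inE eqxx => /esym/eqP.
Qed.

Definition column e (j : 'I_n.+1) : option X := nth None (None :: map Some e) j.
Definition frame e s : 'M[R]_n.+1 :=
  \matrix_(i, j) gposition (nth (inr (set0, set0)) s i) (column e j).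

(* Compares the orientation of the shadow of s in the sphere F v with the
   orientation of the positions of s, in the basis formed by the height and that
   shadow. *)
Definition glued_positive s : bool :=
  [exists v, all (incident v) s && (sg v (enum (eta s)) == (\det (frame (enum (eta s)) s) < 0))].

Definition glued_oriented : ocomplex := OComplex glued glued_positive.

(** Sorted by sign, a linear relation among positions equates two points of the chart of [v], which
    is injective. *)
Lemma gposition_kernel v t1 t2 (y : vec gvert) : t1 \in local_chamber v -> t2 \in local_chamber v ->
  (forall a, 0 < y a -> a \in t1) -> (forall a, y a < 0 -> a \in t2) ->
  combination gposition y = 0 -> y = 0.
Proof.
move=> t1K t2K y1 y2 yz.
have LC := local_chamber_complex Phi FC v.
pose yp : vec gvert := [ffun a => Num.max 0 (y a)]; pose ym : vec gvert := [ffun a => Num.max 0 (- y a)].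
have yE : y = yp - ym by apply/ffunP => a; rewrite !ffunE max_subN.
have Kp : cone (local_chamber v) yp.
  apply: (cone_face LC t1K) => [a|]; first by rewrite ffunE le_max lexx.
  by apply/subsetP => a; rewrite inE ffunE; case: ltrP => [/y1//|_]; rewrite eqxx.
have Km : cone (local_chamber v) ym.
  apply: (cone_face LC t2K) => [a|]; first by rewrite ffunE le_max lexx.
  apply/subsetP => a; rewrite inE ffunE; case: ltrP => [|_]; last by rewrite eqxx.
  by rewrite oppr_gt0 => /y2.
have [g [_ _ gP _]] := local_chamber_iso R Phi FC v.
have [_ gp] := gP _ Kp; have [_ gm] := gP _ Km.
rewrite yE -[yp]gp -[X in _ - X]gm.
have -> : combination gposition yp = combination gposition ym.
  by apply/eqP; rewrite -subr_eq0 -combB -yE yz.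
exact: subrr.
Qed.

(** A relation among the rows holds in the height and in the colours of [e]; the positions vanish at
    all other colours, so it is a relation among the full positions. *)
Lemma frame_kernel e (y : 'I_n.+1 -> vec gvert) : size e = n ->
  (forall i c, c \notin e -> combination gposition (y i) (Some c) = 0) ->
  \det (\matrix_(i, j) combination gposition (y i) (column e j)) = 0 ->
  exists2 k : vec 'I_n.+1, k != 0 & combination gposition (combination y k) = 0.
Proof.
move=> se ye /eqP/det0P[k k0 kM]; exists [ffun i => k 0 i].
  apply: contra k0 => /eqP kz; apply/eqP/rowP => i; rewrite mxE.
  by have := congr1 (fun p : vec 'I_n.+1 => p i) kz; rewrite /= !ffunE.
have kE j : \sum_i k 0 i * combination gposition (y i) (column e j) = 0.
  have := congr1 (fun r : 'rV[R]__ => r 0 j) kM; rewrite /= mxE [RHS]mxE => kMj.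
  by rewrite -[RHS]kMj; apply: eq_bigr => i _; rewrite mxE.
rewrite comb_comb; apply/ffunP => o; rewrite ffunE [RHS]ffunE.
under eq_bigr do rewrite ffunE.
case: o => [c|]; last by have := kE ord0.
have [ce|ce] := boolP (c \in e); last by rewrite big1 // => i _; rewrite ye ?mulr0.
have ci : ((index c e).+1 < n.+1)%N by rewrite ltnS -se index_mem.
have := kE (Ordinal ci); rewrite /column /= (nth_map c) ?index_mem // nth_index //.
Qed.

Lemma gposition_off e s i c : {subset eta s <= e} -> (i < size s)%N -> c \notin e ->
  gposition (nth (inr (set0, set0)) s i) (Some c) = 0.
Proof.
move=> se si ce; apply/eqP; rewrite -[_ == _]negbK gposition_shadow; apply/negP => ci.
by case/negP: ce; apply: se; apply/etaP; exists (nth (inr (set0, set0)) s i) => //; exact: mem_nth.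
Qed.

Lemma frame_det_neq0 v t e s : t \in local_chamber v -> {subset s <= t} -> uniq s ->
  size s = n.+1 -> size e = n -> {subset eta s <= e} -> \det (frame e s) != 0.
Proof.
move=> tK st us ss se es; pose y (i : 'I_n.+1) : vec gvert := unitv R (nth (inr (set0, set0)) s i).
apply/eqP => d0; have [|i c ce||k k0 ky] := @frame_kernel e y.
- by [].
- by rewrite comb_unit (gposition_off es) // ss.
- rewrite -d0; congr (\det _); apply/matrixP => i j; rewrite !mxE comb_unit //.
have yE (i : 'I_n.+1) : combination y k (nth (inr (set0, set0)) s i) = k i.
  rewrite ffunE (bigD1 i) //= ffunE eqxx mulr1 big1 ?addr0 // => j ji.
  by rewrite ffunE nth_uniq ?ss // eq_sym (inj_eq val_inj) (negPf ji) mulr0.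
have yout a : combination y k a != 0 -> a \in s.
  rewrite ffunE; apply: contra_neqT => as_; rewrite big1 // => i _.
  by rewrite ffunE; case: eqP as_ => [->|]; rewrite ?mulr0 // mem_nth ?ss.
have y0 : combination y k = 0.
  apply: (gposition_kernel tK tK) ky => a ya; apply/st/yout; first by rewrite gt_eqF.
  by rewrite lt_eqF.
case/eqP: k0; apply/ffunP => i; by rewrite -yE y0 !ffunE.
Qed.

(** If the determinants had the same sign, [b] minus a positive multiple of [a] would depend
    linearly on [s]. Sorted by sign this relation equates a point of one simplex with a point of the
    other, which [gposition_kernel] excludes. *)
Lemma frame_det_opposite v t1 t2 e a b s : t1 \in local_chamber v -> t2 \in local_chamber v ->
  {subset a :: s <= t1} -> {subset b :: s <= t2} -> uniq (a :: s) -> uniq (b :: s) -> a != b ->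
  size s = n -> size e = n -> {subset eta (a :: s) <= e} -> {subset eta (b :: s) <= e} ->
  (\det (frame e (a :: s)) < 0) = ~~ (\det (frame e (b :: s)) < 0).
Proof.
move=> t1K t2K st1 st2 ua ub ab ss se ea eb.
have da : \det (frame e (a :: s)) != 0 by apply: (frame_det_neq0 t1K) => //=; rewrite ss.
have db : \det (frame e (b :: s)) != 0 by apply: (frame_det_neq0 t2K) => //=; rewrite ss.
pose lam := \det (frame e (b :: s)) / \det (frame e (a :: s)).
suff lam0 : ~ (0 < lam).
  have : lam < 0 by rewrite lt_neqAle leNgt (introN idP lam0) andbT mulf_eq0 invr_eq0 negb_or da db.
  rewrite /lam; case: (ltrgtP (\det (frame e (a :: s))) 0) da => // a0 _.
    by rewrite ltr_ndivrMr // mul0r => b0; rewrite ltNge ltW.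
  by rewrite ltr_pdivrMr // mul0r => ->.
move=> lam0.
(* [lam] makes this family dependent: by linearity in the first row its determinant is that of
   [b :: s] minus [lam] times that of [a :: s]. *)
pose y (i : 'I_n.+1) : vec gvert :=
  if unlift ord0 i is Some j then unitv R (nth (inr (set0, set0)) s j) else unitv R b - scale lam (unitv R a).
have [|i c ce||k k0 ky] := @frame_kernel e y.
- by [].
- rewrite /y; case: unliftP => [j ij|_].
    by rewrite comb_unit; apply: (gposition_off (i := j.+1) ea) => //=; rewrite ltnS ss.
  rewrite combB combZ !comb_unit !ffunE.
  by rewrite (gposition_off (i := 0) ea) // (gposition_off (i := 0) eb) // mulr0 subr0.
- have -> : \det (\matrix_(i, j) combination gposition (y i) (column e j)) =
      1 * \det (frame e (b :: s)) + (- lam) * \det (frame e (a :: s)).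
    apply: (@determinant_multilinear _ _ _ _ _ ord0).
    + apply/rowP => j; rewrite !mxE /y unlift_none combB combZ !comb_unit !ffunE /=.
      by rewrite mul1r mulNr.
    + by apply/matrixP => i j; rewrite !mxE /y liftK comb_unit.
    + by apply/matrixP => i j; rewrite !mxE /y liftK comb_unit.
  by rewrite mul1r mulNr divfK // subrr.
have yE (i : 'I_n) : combination y k (nth (inr (set0, set0)) s i) = k (lift ord0 i).
  have si : nth (inr (set0, set0)) s i \in s by rewrite mem_nth // ss.
  rewrite ffunE (bigD1 (lift ord0 i)) //= /y liftK ffunE eqxx mulr1 big1 ?addr0 // => j.
  case: unliftP => [j' -> jj|-> _].
    have ji : j' != i by apply: contraNneq jj => ->.
    have us : uniq s by case/andP: ua.
    by rewrite ffunE nth_uniq ?ss // eq_sym (inj_eq val_inj) (negPf ji) mulr0.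
  rewrite !ffunE; case: eqP => [sb|_]; first by case/andP: ub; rewrite -sb si.
  by case: eqP => [sa|_]; [case/andP: ua; rewrite -sa si | rewrite mulr0 subr0 mulr0].
have yb : combination y k b = k ord0.
  rewrite ffunE (bigD1 ord0) //= /y unlift_none !ffunE eqxx [b == a]eq_sym (negPf ab) mulr0 subr0 mulr1.
  rewrite big1 ?addr0 // => j; case: unliftP => [j' -> _|->]; last by rewrite eqxx.
  rewrite ffunE; case: eqP => [bs|]; last by rewrite mulr0.
  by case/andP: ub; rewrite bs mem_nth // ss.
have ya : combination y k a = - (lam * k ord0).
  rewrite ffunE (bigD1 ord0) //= /y unlift_none !ffunE eqxx (negPf ab) mulr1 sub0r mulrN mulrC.
  rewrite big1 ?addr0 // => j; case: unliftP => [j' -> _|->]; last by rewrite eqxx.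
  rewrite ffunE; case: eqP => [bs|]; last by rewrite mulr0.
  by case/andP: ua; rewrite bs mem_nth // ss.
have yout z : z != a -> z != b -> z \notin s -> combination y k z = 0.
  move=> za zb zs; rewrite ffunE big1 // => i _; rewrite /y; case: unliftP => [j _|_].
    by rewrite ffunE; case: eqP zs => [->|]; rewrite ?mulr0 // mem_nth ?ss.
  by rewrite !ffunE (negPf za) (negPf zb) mulr0 subr0 mulr0.
have sub1 z : z \in s -> z \in t1 by move=> zs; apply: st1; rewrite inE zs orbT.
have sub2 z : z \in s -> z \in t2 by move=> zs; apply: st2; rewrite inE zs orbT.
have at1 : a \in t1 by apply: st1; rewrite inE eqxx.
have bt2 : b \in t2 by apply: st2; rewrite inE eqxx.
have y0 : combination y k = 0.
  (* [a] and [b] have coefficients of opposite signs; the sign of [k ord0] decides which of the two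
     simplices carries the positive part. *)
  have [kp|kn] := lerP 0 (k ord0).
    apply: (gposition_kernel t2K t1K) ky => z yz.
      have [zb|zb] := eqVneq z b; first by rewrite zb.
      have [zs|zs] := boolP (z \in s); first exact: sub2.
      have [za|za] := eqVneq z a; last by rewrite yout // ltxx in yz.
      by move: yz; rewrite za ya oppr_gt0 ltNge mulr_ge0 // ltW.
    have [za|za] := eqVneq z a; first by rewrite za.
    have [zs|zs] := boolP (z \in s); first exact: sub1.
    have [zb|zb] := eqVneq z b; last by rewrite yout // ltxx in yz.
    by move: yz; rewrite zb yb ltNge kp.
  apply: (gposition_kernel t1K t2K) ky => z yz.
    have [za|za] := eqVneq z a; first by rewrite za.
    have [zs|zs] := boolP (z \in s); first exact: sub1.
    have [zb|zb] := eqVneq z b; last by rewrite yout // ltxx in yz.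
    by move: yz; rewrite zb yb ltNge ltW.
  have [zb|zb] := eqVneq z b; first by rewrite zb.
  have [zs|zs] := boolP (z \in s); first exact: sub2.
  have [za|za] := eqVneq z a; last by rewrite yout // ltxx in yz.
  by move: yz; rewrite za ya oppr_lt0 ltNge pmulr_rle0 // ltW.
case/eqP: k0; apply/ffunP => i; rewrite [RHS]ffunE.
by case: (unliftP ord0 i) => [j ->|->]; [rewrite -yE | rewrite -yb]; rewrite y0 ffunE.
Qed.

(** For a facet [m] of the sphere containing the shadow the determinant is nonzero, whereas a vertex
    of [m] outside the shadow would give a zero column. *)
Lemma eta_facet v s : facet [set a in s] -> [set a in s] \in local_chamber v -> uniq s ->
  #|eta s| = n /\ maxset (fun w : {set X} => w \in F v) (eta s).
Proof.
move=> fs sv us; have st : {subset s <= [set a in s]} by move=> a; rewrite inE.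
have [m mmax em] := maxset_exists (P := fun w : {set X} => w \in F v) (eta_face sv st).
have mn := sphere_facet_card (FC v) (FS v) mmax.
have ss : size s = n.+1 by rewrite -(facet_card fs) cardsE; exact/esym/card_uniqP.
have d0 : \det (frame (enum m) s) != 0.
  by apply: (frame_det_neq0 sv) => //; [rewrite -cardE | move=> c; rewrite mem_enum; exact: (subsetP em)].
suff -> : eta s = m by [].
apply/eqP; rewrite eqEsubset em; apply/subsetP => c cm; apply: contraNT d0 => ce.
have ci : ((index c (enum m)).+1 < n.+1)%N by rewrite ltnS -mn cardE index_mem mem_enum.
rewrite (expand_det_col _ (Ordinal ci)) big1 // => i _.
rewrite mxE /column /= (nth_map c) ?index_mem ?mem_enum // nth_index ?mem_enum //.
rewrite (_ : gposition _ _ = 0) ?mul0r //; apply/eqP; rewrite -[_ == _]negbK gposition_shadow.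
apply: contra ce => ci'; apply/etaP; exists (nth (inr (set0, set0)) s i) => //; by rewrite mem_nth // ss.
Qed.

Lemma frame_det_perm (e1 e2 : n.-tuple X) (p : 'S_n) s : e1 = [tuple tnth e2 (p i) | i < n] ->
  \det (frame e1 s) = (-1) ^+ p * \det (frame e2 s).
Proof.
move=> e12; have -> : frame e1 s = col_perm (lift_perm ord0 ord0 p) (frame e2 s).
  apply/matrixP => i j; rewrite !mxE; congr (gposition _ _).
  case: (unliftP ord0 j) => [k ->|->]; last by rewrite lift_perm_id.
  rewrite lift_perm_lift /column !lift0 /=.
  by rewrite !(nth_map (tnth e1 k)) ?size_tuple // -!tnth_nth e12 tnth_mktuple.
by rewrite col_permE det_mulmx det_perm odd_permV odd_lift_perm mulrC.
Qed.

Lemma sign_perm (p : bool) (x : R) : x != 0 -> ((-1) ^+ p * x < 0) = p (+) (x < 0).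
Proof.
move=> x0; case: p; rewrite ?expr1 ?expr0 ?mul1r ?mulN1r //= oppr_lt0.
by rewrite lt_neqAle eq_sym x0 /= leNgt.
Qed.

(** Reordering [e] changes the sign of the shadow and that of the determinant alike, and a facet
    determines its chamber, so the existential in [glued_positive] has a single candidate. *)
Lemma glued_positiveE v s e : facet [set a in s] -> [set a in s] \in local_chamber v -> uniq s ->
  uniq e -> e =i eta s -> glued_positive s = (sg v e == (\det (frame e s) < 0)).
Proof.
move=> fs sv us ue es; have st : {subset s <= [set a in s]} by move=> a; rewrite inE.
have [cn emax] := eta_facet fs sv us.
have ss : size s = n.+1 by rewrite -(facet_card fs) cardsE; exact/esym/card_uniqP.
have se : size e = n by rewrite -cn -(eq_card es); exact/esym/card_uniqP.
have sE : size (enum (eta s)) == n by rewrite -cardE cn.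
have sE' : size e == n by apply/eqP.
have /tuple_permP[p pE0] : perm_eq (Tuple sE') (Tuple sE).
  by apply: uniq_perm; rewrite ?enum_uniq // => c; rewrite /= mem_enum es.
have pE : Tuple sE' = [tuple tnth (Tuple sE) (p i) | i < n] by exact: val_inj.
have d0 : \det (frame (enum (eta s)) s) != 0.
  by apply: (frame_det_neq0 sv) => //; [exact/eqP | move=> c; rewrite mem_enum].
have oE : orders_facet (F v) (enum (eta s)).
  by rewrite /orders_facet enum_uniq /= (_ : [set x in _] = eta s) //; apply/setP => c; rewrite inE mem_enum.
have eqE : (sg v e == (\det (frame e s) < 0)) = (sg v (enum (eta s)) == (\det (frame (enum (eta s)) s) < 0)).
  have [sgp _] := sgC v.
  have -> : sg v e = odd_perm p (+) sg v (enum (eta s)).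
    exact: etrans (congr1 (sg v) pE0) (sgp n (Tuple sE) p oE).
  have -> : \det (frame e s) = (-1) ^+ p * \det (frame (enum (eta s)) s).
    exact: (frame_det_perm s pE).
  by rewrite sign_perm //; case: (odd_perm p); case: (sg v (enum _)); case: (\det (frame _ _) < 0).
rewrite eqE; apply/existsP/idP => [[v' /andP[/allP inc]]|sgE].
  have <- : v' = v by apply: (facet_chamber_unique fs sv) => a; rewrite inE; exact: inc.
  by [].
exists v; rewrite sgE andbT; apply/allP => a /st; exact: local_chamber_incident.
Qed.

Lemma facet_local t : facet t -> exists v, t \in local_chamber v.
Proof. by move=> /maxsetp/gluedP. Qed.

Lemma eta_cons a s : eta (a :: s) = shadow a :|: eta s.
Proof. by rewrite /eta big_cons. Qed.

Lemma set_cons (T : finType) (a : T) (s : seq T) : [set x in a :: s] = a |: [set x in s].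
Proof. by apply/setP => x; rewrite !inE. Qed.

Lemma glued_coherent_perm m (t : m.-tuple gvert) (p : 'S_m) : orders_facet glued t ->
  glued_positive [tuple tnth t (p i) | i < m] = odd_perm p (+) glued_positive t.
Proof.
move=> /andP[ut ft]; have [v tv] := facet_local ft.
have mn : m = n.+1 by rewrite -(facet_card ft) cardsE (card_uniqP ut) size_tuple.
subst m; set t' := [tuple tnth t (p i) | i < n.+1].
have tt' : perm_eq t' t by apply/tuple_permP; exists p.
have ut' : uniq t' by rewrite (perm_uniq tt').
have tE : [set a in t'] = [set a in t] by apply/setP => a; rewrite !inE (perm_mem tt').
have eE : eta t' = eta t by apply/setP => c; apply/etaP/etaP => -[a at_ ca]; exists a; rewrite ?(perm_mem tt') // -(perm_mem tt').
have et : enum (eta t) =i eta t by move=> c; rewrite mem_enum.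
have et' : enum (eta t) =i eta t' by move=> c; rewrite mem_enum eE.
rewrite (glued_positiveE (v := v) _ _ ut' (enum_uniq _) et') ?tE //.
rewrite (glued_positiveE (v := v) _ _ ut (enum_uniq _) et) //.
have [cn _] := eta_facet ft tv ut.
have d0 : \det (frame (enum (eta t)) t) != 0.
  apply: (frame_det_neq0 tv) => //; rewrite ?size_tuple -?cardE //.
  - by move=> a; rewrite inE.
  - by move=> c; rewrite mem_enum.
have -> : frame (enum (eta t)) t' = row_perm p (frame (enum (eta t)) t).
  by apply/matrixP => i j; rewrite !mxE -!tnth_nth tnth_mktuple.
rewrite row_permE det_mulmx det_perm sign_perm //.
by case: (odd_perm p); case: (sg v (enum _)); case: (\det (frame _ _) < 0).
Qed.

(** Only the first vertex can have [c] in its shadow, so the column of [c], placed just after the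
    height, has at most one nonzero entry. The complementary minor involves neither [a] nor [c] and
    is the same for the neighbouring facet. *)
Lemma frame_det_cofactor e c a s : size e = n.-1 -> size s = n -> c \notin eta s ->
  exists2 d, \det (frame (c :: e) (a :: s)) = gposition a (Some c) * d &
    forall b c', d = cofactor (frame (c' :: e) (b :: s)) ord0 (inord 1).
Proof.
move=> se ss cs; have n1 : (1 < n.+1)%N by [].
exists (cofactor (frame (c :: e) (a :: s)) ord0 (inord 1)).
  rewrite (expand_det_col _ (inord 1)) (bigD1 ord0) //= big1 ?addr0 => [|i i0].
    by rewrite mxE /column /= inordK.
  rewrite mxE /column inordK //= (_ : gposition _ _ = 0) ?mul0r //.
  apply/eqP; rewrite -[_ == _]negbK gposition_shadow; apply: contra cs => ci.
  apply/etaP; exists (nth (inr (set0, set0)) (a :: s) i) => //.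
  by case: (unliftP ord0 i) i0 => [j ->|->]; rewrite ?eqxx // lift0 /= mem_nth // ss.
move=> b c'; rewrite /cofactor; congr (_ * \det _); apply/matrixP => i j; rewrite !mxE.
rewrite lift0 /=; congr (gposition _ _); rewrite /column /= /bump inordK //.
by case: (nat_of_ord j).
Qed.

(** The columns of [c1] and [c2] vanish except in the row of [a], hence they are proportional. *)
Lemma det_two_columns e c1 c2 a s : size e = n -> size s = n -> uniq e -> c1 \in e -> c2 \in e ->
  c1 != c2 -> c1 \in shadow a -> c1 \notin eta s -> c2 \notin eta s -> \det (frame e (a :: s)) = 0.
Proof.
move=> se ss ue c1e c2e c12 c1a c1s c2s; apply/eqP; rewrite -det_tr; apply/det0P.
have idx c : c \in e -> exists2 j : 'I_n.+1, column e j = Some c & j = (index c e).+1 :> nat.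
  move=> ce; have ci : ((index c e).+1 < n.+1)%N by rewrite ltnS -se index_mem.
  exists (Ordinal ci); rewrite // /column /= (nth_map c) ?index_mem // nth_index //.
have [j1 j1E j1n] := idx _ c1e; have [j2 j2E j2n] := idx _ c2e.
have j12 : j2 != j1.
  apply: contra c12 => /eqP jj; apply/eqP.
  have : index c1 e = index c2 e by apply: succn_inj; rewrite -j1n -j2n jj.
  by move=> /(congr1 (nth c1 e)); rewrite !nth_index.
exists (\row_j (if j == j1 then gposition a (Some c2) else if j == j2 then - gposition a (Some c1) else 0)).
  apply/negP => /eqP/rowP/(_ j2); rewrite !mxE eqxx (negPf j12) => /eqP.
  by rewrite oppr_eq0; apply/negP; rewrite gposition_shadow.
apply/rowP => i; rewrite !mxE (bigD1 j1) //= (bigD1 j2) //= big1 ?addr0; last first.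
  by move=> j /andP[jj1 jj2]; rewrite !mxE (negPf jj1) (negPf jj2) mul0r.
rewrite !mxE !eqxx (negPf j12) j1E j2E.
case: (unliftP ord0 i) => [k ->|->]; last by rewrite /=; lra.
have z c : c \notin eta s -> gposition (nth (inr (set0, set0)) (a :: s) (lift ord0 k)) (Some c) = 0.
  move=> cs; apply/eqP; rewrite -[_ == _]negbK gposition_shadow; apply: contra cs => ci.
  by apply/etaP; exists (nth (inr (set0, set0)) (a :: s) (lift ord0 k)); rewrite // lift0 /= mem_nth // ss.
by rewrite !z // !mulr0 addr0.
Qed.

(** If the shadows agree, so do the sphere signs, and the determinants are opposite. Otherwise the
    shadows are facets of the sphere differing in one vertex, so the sphere signs are opposite,
    while the determinants are positive multiples of a common cofactor. *)
Lemma glued_coherent_same v a b s : a != b -> orders_facet glued (a :: s) -> orders_facet glued (b :: s) ->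
  [set x in a :: s] \in local_chamber v -> [set x in b :: s] \in local_chamber v ->
  glued_positive (a :: s) = ~~ glued_positive (b :: s).
Proof.
move=> ab /andP[ua fa] /andP[ub fb] av bv.
have ss : size s = n.
  by apply: succn_inj; rewrite -(facet_card fa) cardsE (card_uniqP ua).
have [ca ma] := eta_facet fa av ua; have [cb mb] := eta_facet fb bv ub.
have sa : {subset a :: s <= [set x in a :: s]} by move=> x xs; rewrite in_set.
have sb : {subset b :: s <= [set x in b :: s]} by move=> x xs; rewrite in_set.
have ee (z : {set X}) : enum z =i z by move=> c; rewrite mem_enum.
have [ab_eta|ab_eta] := eqVneq (eta (a :: s)) (eta (b :: s)).
  have eb : enum (eta (a :: s)) =i eta (b :: s) by rewrite ab_eta; exact: ee.
  rewrite (glued_positiveE fa av ua (enum_uniq _) (ee _)) (glued_positiveE fb bv ub (enum_uniq _) eb).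
  rewrite (frame_det_opposite av bv sa sb) // -?cardE //.
  - by case: (sg v _); case: (\det (frame _ (b :: s)) < 0).
  - by move=> c; rewrite ee.
  - by move=> c; rewrite eb.
have [c1 c1a c1b] : exists2 c1, c1 \in eta (a :: s) & c1 \notin eta (b :: s).
  by apply/subsetPn; apply: contra ab_eta => sub; rewrite eqEcard sub ca cb leqnn.
have c1s : c1 \notin eta s by apply: contra c1b; rewrite eta_cons inE => ->; rewrite orbT.
have c1sh : c1 \in shadow a by move: c1a; rewrite eta_cons inE (negPf c1s) orbF.
have etaE : eta (a :: s) = c1 |: eta s.
  apply/eqP; rewrite eq_sym eqEsubset; apply/andP; split.
    by rewrite subUset sub1set c1a eta_cons subsetUr.
  apply/subsetP => c2 c2a; rewrite !inE; apply: contraT; rewrite negb_or => /andP[c21 c2s].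
  have d0 : \det (frame (enum (eta (a :: s))) (a :: s)) != 0.
    apply: (frame_det_neq0 av sa ua); rewrite /= ?ss -?cardE //.
    by move=> c; rewrite ee.
  case/eqP: d0; apply: (det_two_columns (c1 := c1) (c2 := c2)); rewrite -?cardE ?ee ?enum_uniq //.
  by rewrite eq_sym.
have cs : #|eta s| = n.-1 by rewrite -ca etaE cardsU1 c1s.
have [c2 c2b c2s] : exists2 c2, c2 \in eta (b :: s) & c2 \notin eta s.
  by apply/subsetPn/negP => /subset_leq_card; rewrite cb cs -ltnS prednK // ltnn.
have c2sh : c2 \in shadow b by move: c2b; rewrite eta_cons inE (negPf c2s) orbF.
have etbE : eta (b :: s) = c2 |: eta s.
  apply/eqP; rewrite eq_sym eqEcard cardsU1 c2s cs cb subUset sub1set c2b eta_cons subsetUr /=.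
  by rewrite add1n prednK.
have c12 : c1 != c2 by apply: contraNneq c1b => ->.
pose e0 := enum (eta s).
have u1 : uniq (c1 :: e0) by rewrite /= enum_uniq mem_enum c1s.
have u2 : uniq (c2 :: e0) by rewrite /= enum_uniq mem_enum c2s.
have m1 : c1 :: e0 =i eta (a :: s) by move=> c; rewrite etaE !inE mem_enum.
have m2 : c2 :: e0 =i eta (b :: s) by move=> c; rewrite etbE !inE mem_enum.
rewrite (glued_positiveE fa av ua u1 m1) (glued_positiveE fb bv ub u2 m2).
have se0 : size e0 = n.-1 by rewrite -cardE cs.
have [d1 d1E d1P] := @frame_det_cofactor e0 c1 a s se0 ss c1s.
have [d2 d2E d2P] := @frame_det_cofactor e0 c2 b s se0 ss c2s.
have d12 : d1 = d2 by rewrite (d1P b c2) -(d2P b c2).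
have p1 : 0 < gposition a (Some c1) by rewrite lt_def gposition_shadow c1sh gposition_ge0.
have p2 : 0 < gposition b (Some c2) by rewrite lt_def gposition_shadow c2sh gposition_ge0.
rewrite d1E d2E d12 !pmulr_rlt0 //.
have [_ /(_ c1 c2 e0 c12)/= ->] := sgC v.
- by case: (sg v _); case: (d2 < 0).
- rewrite /orders_facet u1 (_ : [set x in _] = eta (a :: s)) //.
  by apply/setP => c; rewrite inE m1.
- rewrite /orders_facet u2 (_ : [set x in _] = eta (b :: s)) //.
  by apply/setP => c; rewrite inE m2.
Qed.

(** No vertex of the common face belongs to [v] alone, so the remaining vertex of the facet does. It
    is not the centre, because a simplex of the chamber containing the centre has no other outer
    vertex. *)
Lemma wall_vertex v v' a s : v != v' -> orders_facet glued (a :: s) ->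
  [set x in a :: s] \in local_chamber v -> (forall z, z \in s -> incident v' z) ->
  (exists c, a = inl (v, c)) /\
  forall z, z \in s -> exists C, C != set0 /\ z = inr (orb C v, C).
Proof.
move=> vv' /andP[ua fa] /imsetP[s0 s0K tE] inc.
have ss : size s = n.
  by apply: succn_inj; rewrite -(facet_card fa) cardsE (card_uniqP ua).
have mem_as z : z \in s0 -> local_vertex v z = a \/ local_vertex v z \in s.
  move=> zs; have : local_vertex v z \in [set x in a :: s] by rewrite tE; exact: imset_f.
  by rewrite !inE => /orP[/eqP|]; [left | right].
have inl_s c : inl (v, c) \in s -> False.
  by move=> /inc /= /eqP vE; rewrite vE eqxx in vv'.
have ctr_s : inr (orb set0 v, set0) \in s -> False.
  move=> /inc /=; rewrite !orb0 => /eqP/setP/(_ v); rewrite !inE eqxx => /esym/eqP vE.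
  by rewrite vE eqxx in vv'.
have sE z : z \in s -> exists C, C != set0 /\ z = inr (orb C v, C).
  move=> zs; have : z \in [set x in a :: s] by rewrite !inE zs orbT.
  rewrite tE => /imsetP[[c|C] _ zE]; rewrite {}zE in zs *; first by case: (inl_s c).
  by exists C; split=> //; apply/eqP => C0; rewrite C0 in zs; exact: ctr_s.
split=> //; rewrite tE in fa.
have [[c cs]|cs] := facet_center fa s0K.
  by exists c; case: (mem_as _ cs) => [<-//|/inl_s].
have aE : a = inr (orb set0 v, set0) by case: (mem_as _ cs) => [<-//|/ctr_s].
have [z zs] : exists z, z \in s by case: (s) ss n0 => [<-//|z s' _ _]; exists z; rewrite inE eqxx.
have [C [C0 zE]] := sE z zs.
have : z \in [set x in a :: s] by rewrite !inE zs orbT.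
rewrite tE => /imsetP[[c|D] Ds]; rewrite zE // => -[_ CD].
have /chamberP[_ _ _ s00] := s0K.
have := s00 _; rewrite inE => /(_ cs)/setP/(_ D); rewrite !inE Ds -CD => /esym/eqP C0'.
by rewrite C0' eqxx in C0.
Qed.

Lemma orb1 w v v' : v' \in orb [set w] v -> v' = v \/ v' = Phi w v.
Proof.
apply: (@orb_ind _ _ Phi [set w] v (fun v' => v' = v \/ v' = Phi w v)); first by left.
by move=> w' u; rewrite inE => /eqP-> [->|->]; [right | left; rewrite PhiK].
Qed.

(** The two remaining vertices are inner and have the same colour, and [v'] is obtained from [v] by
    crossing one wall. The frames are therefore equal, and only the sphere sign changes. *)
Lemma glued_coherent_other v v' a b s : v != v' -> orders_facet glued (a :: s) -> orders_facet glued (b :: s) ->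
  [set x in a :: s] \in local_chamber v -> [set x in b :: s] \in local_chamber v' ->
  glued_positive (a :: s) = ~~ glued_positive (b :: s).
Proof.
move=> vv' Fa Fb av bv.
have incs z : z \in s -> incident v' z.
  by move=> zs; apply: (local_chamber_incident bv); rewrite !inE zs orbT.
have incs' z : z \in s -> incident v z.
  by move=> zs; apply: (local_chamber_incident av); rewrite !inE zs orbT.
have [[c aE] sE] := wall_vertex vv' Fa av incs.
have [[c' bE] _] : (exists c, b = inl (v', c)) /\
    forall z, z \in s -> exists C, C != set0 /\ z = inr (orb C v', C).
  by apply: (wall_vertex (v' := v)) => //; rewrite eq_sym.
move: Fa Fb => /andP[ua fa] /andP[ub fb].
have ss : size s = n by apply: succn_inj; rewrite -(facet_card fa) cardsE (card_uniqP ua).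
have /imsetP[s0 s0K tE] := av; have /imsetP[s0' s0K' tE'] := bv.
have mem_as z : z \in s0 -> local_vertex v z = a \/ local_vertex v z \in s.
  move=> zs; have : local_vertex v z \in [set x in a :: s] by rewrite tE; exact: imset_f.
  by rewrite !inE => /orP[/eqP|]; [left | right].
have f0 : facet (local_vertex v @: s0) by rewrite -tE.
have /chamberP[sF sC sw s00] := s0K; have /chamberP[_ _ sw' _] := s0K'.
have in0 d : d \in inner s0 -> d = c.
  rewrite inE => ds; case: (mem_as _ ds); rewrite /= ?aE; first by case.
  by move=> /sE[C [_ //]].
have out_s C : C \in outer s0 -> inr (orb C v, C) \in s.
  by rewrite inE => Cs; case: (mem_as _ Cs); rewrite //= aE.
have out_n0 C : C \in outer s0 -> C != set0.
  by move=> /out_s/sE[D [D0 [_ ->]]].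
have nout0 : set0 \notin outer s0 by apply/negP => /out_n0; rewrite eqxx.
have outD : outer s0 :\ set0 = outer s0.
  by apply/setP => C; rewrite !inE; case: eqP => // ->; move: nout0; rewrite inE => /negPf->.
have out' C : C \in outer s0 -> C \in outer s0'.
  move=> /out_s Cs; have : inr (orb C v, C) \in [set x in b :: s] by rewrite !inE Cs orbT.
  by rewrite tE' => /imsetP[[//|D] Ds [_ ->]]; rewrite inE.
have c's0 : c' \in inner s0'.
  have : b \in [set x in b :: s] by rewrite !inE eqxx.
  by rewrite tE' bE => /imsetP[[d|//] ds [->]]; rewrite inE.
have c'w C w : C \in outer s0 -> w \in C -> c' \in w.
  by move=> Cs wC; apply: (subsetP (sw' C w (out' _ Cs) wC)).
have [C0 C0s] : exists C, C \in outer s0.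
  have [z zs] : exists z, z \in s by case: (s) ss n0 => [<-//|z s' _ _]; exists z; rewrite inE eqxx.
  have [C [_ zE]] := sE z zs; exists C.
  have : z \in [set x in a :: s] by rewrite !inE zs orbT.
  by rewrite tE zE => /imsetP[[//|D] Ds [_ ->]]; rewrite inE.
rewrite outD in sC; have [H1 H2] := chainsP _ _ sC.
have [C1 C1s C1min] := smallest_set C0s H2.
have [/chainsP[G1 _] /set0Pn[w wC1]] := H1 _ C1s; have [wF w0] := G1 _ wC1.
(* [c'] lies in every set of the outer chains, so the maximality of the facet in [v] forces it to be
   a vertex there already. *)
have cc' : c' = c.
  have z0 : inl c' \in s0.
    apply: (extend_facet f0); apply/chamberP.
    have -> : outer (inl c' |: s0) = outer s0 by apply/setP => D; rewrite !inE.
    have in1 : inner (inl c' |: s0) = c' |: inner s0 by apply/setP => d; rewrite !inE.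
    have sub D u : D \in outer s0 -> u \in D -> inner (inl c' |: s0) \subset u.
      by move=> Ds uD; rewrite in1 subUset sub1set (c'w D u) // (sw D u).
    rewrite outD; split=> //; exact: (face_sub (FC v) wF (sub C1 w C1s wC1)).
  by apply: in0; rewrite inE.
(* Maximality again: [[set w]] fits below all the outer chains, so the vertex of the single wall [w]
   occurs in the face shared by the two chambers. *)
have v'w : v' = Phi w v.
  have z0 : inr [set w] \in s0.
    apply: (extend_facet f0); apply/chamberP.
    have -> : inner (inr [set w] |: s0) = inner s0 by apply/setP => D; rewrite !inE.
    have -> : outer (inr [set w] |: s0) = [set w] |: outer s0 by apply/setP => D; rewrite !inE.
    have w1 : [set w] != set0 by apply/set0Pn; exists w; rewrite inE.
    have n1 : set0 \notin [set w] |: outer s0 by rewrite in_setU1 (negPf nout0) orbF eq_sym.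
    have -> : ([set w] |: outer s0) :\ set0 = [set w] |: outer s0.
      by apply/setP => D; rewrite in_setD1; case: eqP => // ->; rewrite (negPf n1).
    have wD D : D \in outer s0 -> [set w] \subset D.
      by move=> /C1min/subsetP; rewrite sub1set; apply.
    split=> //.
    - apply/chainsP; split=> [D /setU1P[->|/H1//]|D D' /setU1P[->|Ds] /setU1P[->|Ds']].
      + split=> //; apply/chainsP; split=> [u /set1P->//|u u' /set1P-> /set1P->]; by rewrite subxx.
      + by rewrite subxx.
      + by rewrite wD.
      + by rewrite wD ?orbT.
      + exact: H2.
    - move=> D u /setU1P[->|Ds] uD; last exact: sw uD.
      by move/set1P: uD => ->; exact: sw C1s wC1.
    - by rewrite (negPf n1).
  have /incs /= /eqP O : inr (orb [set w] v, [set w]) \in s by apply: out_s; rewrite inE.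
  have /orb1[vE|//] : v' \in orb [set w] v by rewrite O orb_refl.
  by rewrite vE eqxx in vv'.
have etaE : eta (b :: s) = eta (a :: s) by rewrite !eta_cons aE bE cc'.
have ee (z : {set X}) : enum z =i z by move=> d; rewrite mem_enum.
have eb : enum (eta (a :: s)) =i eta (b :: s) by rewrite etaE; exact: ee.
rewrite (glued_positiveE fa av ua (enum_uniq _) (ee _)) (glued_positiveE fb bv ub (enum_uniq _) eb).
have -> : frame (enum (eta (a :: s))) (b :: s) = frame (enum (eta (a :: s))) (a :: s).
  apply/matrixP => i j; rewrite !mxE; case: (unliftP ord0 i) => [k ->|->]; first by rewrite lift0.
  by rewrite /= aE bE cc'.
have [ca ma] := eta_facet fa av ua.
have oE : orders_facet (F v) (enum (eta (a :: s))).
  by rewrite /orders_facet enum_uniq (_ : [set x in _] = eta (a :: s)) //; apply/setP => d; rewrite inE ee.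
rewrite v'w sgPhi //; first by case: (sg v _); case: (\det _ < 0).
apply/subsetP => d dw; rewrite mem_enum; apply/etaP; exists (inr (orb C1 v, C1)).
  by rewrite inE out_s ?orbT.
by apply/bigcupP; exists w.
Qed.

Lemma glued_coherent : coherent glued_oriented.
Proof.
split=> [m t p|a b s ab Fa Fb]; first exact: glued_coherent_perm.
have /andP[_ fa] := Fa; have /andP[_ fb] := Fb.
have [v av] := facet_local fa; have [v' bv] := facet_local fb.
have [vv'|vv'] := eqVneq v v'; last exact: glued_coherent_other av bv.
by apply: (glued_coherent_same (v := v)) => //; rewrite vv'.
Qed.

Lemma glued_manifold : oriented_manifold R n glued_oriented.
Proof.
split; last exact: glued_coherent.
split; first exact: KC.
move=> [a aK]; apply/comb_sphere_iso; split; first exact: link_complex.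
exact: K_sphere.
Qed.

(** * Links of the centres *)

Definition center v : gvert := inr (orb set0 v, set0).

Lemma center_face v (r : {set X}) : r \in F v -> center v |: [set (inl (v, c) : gvert) | c in r] \in glued.
Proof.
move=> rF; apply/gluedP; exists v; apply/imsetP.
exists (inr set0 |: [set (inl c : X + {set {set X}}) | c in r]).
  apply/chamberP.
  have -> : inner (inr set0 |: [set (inl c : X + {set {set X}}) | c in r]) = r.
    by apply/setP => c; rewrite !inE mem_imset //; exact: inl_inj.
  have -> : outer (inr set0 |: [set (inl c : X + {set {set X}}) | c in r]) = [set set0].
    by apply/setP => C; rewrite !inE; case: imsetP => [[]//|_]; rewrite orbF.
  split=> //; first by rewrite setDv; case: (chains_complex (chains (F v))).
  by move=> C w /set1P->; rewrite inE.
by rewrite imsetU1 -imset_comp.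
Qed.

Lemma center_link v t : t \in link glued (center v) ->
  exists2 r, r \in F v & t = [set (inl (v, c) : gvert) | c in r].
Proof.
rewrite inE => /andP[vt /gluedP[v' /imsetP[s0 s0K tE]]].
have : center v \in local_vertex v' @: s0 by rewrite -tE setU11.
case/imsetP=> -[//|C] Cs [+ C0]; rewrite -{}C0 in Cs *; rewrite !orb0 => /set1_inj vE.
rewrite -{}vE in tE s0K; have /chamberP[sF _ _ s00] := s0K.
exists (inner s0) => //; apply/setP => a; apply/idP/imsetP => [at_|[c cs ->]].
  have : a \in center v |: t by rewrite inE at_ orbT.
  rewrite tE => /imsetP[[c|D] Ds aE]; first by exists c; rewrite ?inE.
  have := s00 _; rewrite inE => /(_ Cs)/setP/(_ D); rewrite !inE Ds => /esym/eqP D0.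
  by case/negP: vt; rewrite /center -D0 -[inr _]/(local_vertex v (inr D)) -aE.
have : inl (v, c) \in center v |: t.
  by rewrite tE; apply/imsetP; exists (inl c); rewrite //; rewrite inE in cs.
by rewrite !inE.
Qed.

(** The centre contributes height -1 and the other vertices are unit vectors, so the determinant is
    -1. This is why [glued_positive] compares the sphere sign with negativity of the determinant. *)
Lemma center_isomorphic v : isomorphic (@olink glued_oriented (center v)) (OComplex (F v) (sg v)).
Proof.
have [m mmax _] := maxset_exists (P := fun w : {set X} => w \in F v) (C := set0) (FC v).1.
(* As n > 0 the sphere has a vertex, which serves as the value of [f] on vertices that are not
   inner. *)
have [x0 _] : exists x0, x0 \in m by apply/set0Pn; rewrite -card_gt0 (sphere_facet_card (FC v) (FS v) mmax).
pose f (a : gvert) : X := if a is inl p then p.2 else x0.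
have fK (r : {set X}) : f @: [set (inl (v, c) : gvert) | c in r] = r.
  by rewrite -imset_comp -[RHS]imset_id; apply: eq_imset.
apply: (@oiso_sign_of_maps false (@olink glued_oriented (center v)) (OComplex (F v) (sg v)) f
  (fun c => inl (v, c))) => /=.
- by move=> s /center_link[r rF ->]; rewrite fK.
- by move=> r rF; rewrite inE center_face // andbT; apply/imsetP => -[].
- move=> a /center_link[r _ aE]; have : a \in [set a] by rewrite inE.
  by rewrite aE => /imsetP[c _ ->].
- by [].
move=> s; rewrite orders_facet_link => Fs; have /andP[us fs] := Fs.
have sv : [set x in center v :: s] \in local_chamber v.
  have /center_link[r rF rE] : [set x in s] \in link glued (center v).
    by rewrite inE -set_cons (maxsetp fs) andbT inE; case/andP: us.
  have := center_face rF; rewrite -rE -set_cons => /gluedP[v' sv'].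
  suff vv : v' = v by move: sv'; rewrite vv.
  have := local_chamber_incident (a := center v) sv'; rewrite !inE eqxx => /(_ isT) /=.
  by rewrite !orb0 => /eqP/set1_inj.
have [cs sE] : exists cs, s = [seq (inl (v, c) : gvert) | c <- cs].
  have /center_link[r rF rE] : [set x in s] \in link glued (center v).
    by rewrite inE -set_cons (maxsetp fs) andbT inE; case/andP: us.
  exists (map f s); rewrite -map_comp -[LHS]map_id; apply/eq_in_map => a as_ /=.
  have : a \in [set x in s] by rewrite inE.
  by rewrite rE => /imsetP[c _ ->].
have csE : map f s = cs by rewrite sE -map_comp map_id.
have ucs : uniq cs by move: us; rewrite cons_uniq => /andP[_]; rewrite sE map_inj_uniq // => c c' [].
have ecs : cs =i eta (center v :: s).
  move=> c; rewrite eta_cons /= /cover big_set0 set0U; apply/idP/etaP => [ccs|[a]].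
    by exists (inl (v, c)); rewrite ?inE // sE map_f.
  by rewrite sE => /mapP[c' c'cs ->] /set1P ->.
have ss : size cs = n.
  have [cn _] := eta_facet fs sv us; rewrite -cn -(eq_card ecs); exact/esym/card_uniqP.
rewrite csE (glued_positiveE fs sv us ucs ecs).
suff -> : \det (frame cs (center v :: s)) < 0 by case: (sg v cs).
have -> : frame cs (center v :: s) = diag_mx (\row_j (if j == ord0 then -1 else 1)).
  apply/matrixP => i j; rewrite !mxE /column sE.
  case: (unliftP ord0 i) => [i' ->|->]; case: (unliftP ord0 j) => [j' ->|->]; rewrite ?lift0 /=.
  - have [c0 c0s] : exists c0, c0 \in cs by case: (cs) ss i' => [<- []//|c cs' _ _]; exists c; rewrite inE eqxx.
    rewrite (nth_map c0) ?ss // (nth_map c0) ?ss // ffunE (inj_eq Some_inj) nth_uniq ?ss //.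
    by rewrite (inj_eq lift_inj) eq_sym.
  - have [c0 c0s] : exists c0, c0 \in cs by case: (cs) ss i' => [<- []//|c cs' _ _]; exists c; rewrite inE eqxx.
    by rewrite (nth_map c0) ?ss // ffunE.
  - have [c0 c0s] : exists c0, c0 \in cs by case: (cs) ss j' => [<- []//|c cs' _ _]; exists c; rewrite inE eqxx.
    by rewrite (nth_map c0) ?ss // ffunE indicator0 comb0 ffunE.
  - by rewrite ffunE eqxx.
rewrite det_diag (bigD1 ord0) //= mxE eqxx big1 ?mulr1 ?oppr_lt0 // => j /negPf j0.
by rewrite mxE j0.
Qed.


Lemma center_inj : injective center.
Proof. by move=> v v' [+]; rewrite !orb0 => /set1_inj. Qed.

Lemma center_vertex v : [set center v] \in glued.
Proof. by have := center_face (FC v).1; rewrite imset0 setU0. Qed.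

Definition central a : bool := if a is inr p then p.2 == set0 else false.

Lemma centralP a : [set a] \in glued -> central a -> exists v, a = center v.
Proof.
move=> /gluedP[v /imsetP[s0 _ aE]]; have : a \in local_vertex v @: s0 by rewrite -aE inE.
by move=> /imsetP[[c|C] _ ->] //= /eqP->; exists v.
Qed.


Definition relabel (h : V -> V) a : gvert :=
  match a with inl p => inl (h p.1, p.2) | inr p => inr (h @: p.1, p.2) end.

(** The choice depends on the chain only, so relabelling does not change it and [partner] can be an
    involution. The default is not reached for a nonempty chain. *)
Definition wall a : {set X} :=
  match a with inl p => [set p.2] | inr p => odflt set0 [pick w in p.2] end.

Lemma wall_mem (O : {set V}) C : C != set0 -> wall (inr (O, C)) \in C.
Proof.
case/set0Pn=> w wC /=; case: pickP => [//|/(_ w)]; by rewrite wC.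
Qed.

Lemma wall_shadow a : ~~ central a -> wall a \subset shadow a.
Proof. by case: a => [p|[O C]] //= C0; apply: (bigcup_max (wall (inr (O, C)))) (subxx _); exact: wall_mem. Qed.

(** All walls that occur in simplices through a vertex are comparable to the wall chosen there.
    Crossing the latter therefore commutes with crossing the former and maps orbits to orbits, as
    [orb_relabel] requires. *)
Lemma wall_comparable v (s0 : {set X + {set {set X}}}) z : s0 \in chamber (F v) -> z \in s0 -> ~~ central (local_vertex v z) ->
  let w := wall (local_vertex v z) in
  [/\ w \in F v, w != set0, comparable_sets (inner s0) w
    & forall D w', D \in outer s0 -> w' \in D -> comparable_sets w' w].
Proof.
move=> /chamberP[sF sC sw _] zs; have [H1 H2] := chainsP _ _ sC; case: z zs => [c|C] zs.
  move=> _ w; have ws : w \subset inner s0 by rewrite sub1set inE.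
  split; first exact: (face_sub (FC v) sF ws).
  - by apply/set0Pn; exists c; rewrite inE.
  - by rewrite /comparable_sets ws orbT.
  by move=> D w' Ds w'D; rewrite /comparable_sets (subset_trans ws (sw D w' Ds w'D)) orbT.
move=> C0 w; have wC : w \in C by exact: wall_mem.
have Co : C \in outer s0 :\ set0 by rewrite in_setD1 C0 inE.
have [/chainsP[G1 G2] _] := H1 C Co; have [wF w0] := G1 w wC; split=> //.
  by rewrite /comparable_sets (sw C w) // inE.
move=> D w' Ds w'D; have Do : D \in outer s0 :\ set0.
  by rewrite in_setD1 Ds andbT; apply/set0Pn; exists w'.
have /orP[/subsetP CD|/subsetP DC] := H2 _ _ Co Do; last exact: G2 (DC _ w'D) wC.
by have [/chainsP[_ G3] _] := H1 D Do; exact: G3 w'D (CD _ wC).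
Qed.

(** * Anti-isomorphisms of links from crossing a wall *)

Section Relabel.
Variables (h : V -> V) (w : {set X}).
Hypotheses (hK : involutive h)
  (hC : forall w' v, comparable_sets w' w -> h (Phi w' v) = Phi w' (h v))
  (hF : forall v r, w \in F v -> w \subset r -> (r \in F (h v)) = (r \in F v))
  (hS : forall v e, orders_facet (F v) e -> w \subset e -> sg (h v) e = ~~ sg v e).

Lemma relabelK : involutive (relabel h).
Proof.
case=> [[v c]|[O C]] /=; rewrite ?hK // -imset_comp; congr (inr (_, _)).
by rewrite -[RHS]imset_id; apply: eq_imset => v /=; rewrite hK.
Qed.

Lemma relabel_set_inj (t : {set gvert}) : relabel h @: (relabel h @: t) = t.
Proof. by rewrite -imset_comp -[RHS]imset_id; apply: eq_imset => a /=; rewrite relabelK. Qed.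

Lemma wall_relabel a : wall (relabel h a) = wall a. Proof. by case: a. Qed.
Lemma central_relabel a : central (relabel h a) = central a. Proof. by case: a. Qed.
Lemma shadow_relabel a : shadow (relabel h a) = shadow a. Proof. by case: a. Qed.
Lemma gposition_relabel a : gposition (relabel h a) = gposition a. Proof. by case: a => -[]. Qed.

Lemma eta_relabel s : eta (map (relabel h) s) = eta s.
Proof. by rewrite /eta big_map; apply: eq_bigr => a _; rewrite shadow_relabel. Qed.

Lemma frame_relabel e s : frame e (map (relabel h) s) = frame e s.
Proof.
apply/matrixP => i j; rewrite !mxE; have [is_|si] := ltnP i (size s).
  by rewrite (nth_map (inr (set0, set0))) // gposition_relabel.
by rewrite !nth_default ?size_map.
Qed.

Lemma orb_relabel D v : (forall w', w' \in D -> comparable_sets w' w) -> h @: orb D v = orb D (h v).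
Proof.
move=> DC; have sub v' u : u \in orb D v' -> h u \in orb D (h v').
  apply: (@orb_ind _ _ Phi D v' (fun u => h u \in orb D (h v'))) => [|w' u' w'D uO].
    exact: orb_refl.
  by rewrite hC ?DC // -(orb_eq PhiK uO) orb_Phi.
apply/setP => u; apply/imsetP/idP => [[u' /sub ? ->//]|uO].
by exists (h u); rewrite ?hK // -[v]hK sub.
Qed.

Lemma chamber_relabel v (s0 : {set X + {set {set X}}}) : s0 \in chamber (F v) -> w \in F v ->
  comparable_sets (inner s0) w ->
  (forall D w', D \in outer s0 -> w' \in D -> comparable_sets w' w) -> s0 \in chamber (F (h v)).
Proof.
move=> /chamberP[sF sC sw s00] wF sw' cw.
have FF r : r \in F v -> comparable_sets r w -> r \in F (h v).
  move=> rF /orP[rw|wr]; last by rewrite hF.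
  by apply: (face_sub (FC _) _ rw); rewrite hF.
apply/chamberP; split=> //; first exact: FF.
have [H1 H2] := chainsP _ _ sC; apply/chainsP; split=> // D Do; have [/chainsP[G1 G2] D0] := H1 D Do.
have Ds : D \in outer s0 by case/setD1P: Do.
split=> //; apply/chainsP; split=> // w' w'D; have [w'F w'0] := G1 _ w'D; split=> //.
by apply: FF => //; exact: cw w'D.
Qed.

Lemma local_relabel v (s0 : {set X + {set {set X}}}) :
  (forall D w', D \in outer s0 -> w' \in D -> comparable_sets w' w) ->
  relabel h @: (local_vertex v @: s0) = local_vertex (h v) @: s0.
Proof.
move=> cw; rewrite -imset_comp; apply: eq_in_imset => -[c|D] zs //=.
by rewrite orb_relabel // => w'; apply: cw; rewrite inE.
Qed.

Lemma glued_relabel a (t : {set gvert}) : a \in t -> wall a = w -> ~~ central a -> t \in glued ->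
  exists v, [/\ t \in local_chamber v, w \in F v & relabel h @: t \in local_chamber (h v)].
Proof.
move=> at_ aw ac /gluedP[v tv]; have /imsetP[s0 s0K tE] := tv; exists v.
move: at_; rewrite tE => /imsetP[z zs zE]; rewrite zE in aw ac.
have [wF w0 iw ow] := wall_comparable s0K zs ac; rewrite /= aw in wF w0 iw ow.
split=> //; first by rewrite -tE.
by rewrite local_relabel //; apply/imsetP; exists s0 => //; exact: chamber_relabel.
Qed.

Lemma relabel_face a (t : {set gvert}) : a \in t -> wall a = w -> ~~ central a ->
  (relabel h @: t \in glued) = (t \in glued).
Proof.
move=> at_ aw ac; have sub b (t' : {set gvert}) : b \in t' -> wall b = w -> ~~ central b ->
    t' \in glued -> relabel h @: t' \in glued.
  by move=> bt bw bc /(glued_relabel bt bw bc)[v [_ _ ?]]; apply/gluedP; exists (h v).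
apply/idP/idP => [tK|]; last exact: sub at_ aw ac.
rewrite -[t]relabel_set_inj; apply: (sub (relabel h a)) => //.
- by rewrite imset_f.
- by rewrite wall_relabel.
- by rewrite central_relabel.
Qed.

Lemma relabel_facet a (t : {set gvert}) : a \in t -> wall a = w -> ~~ central a ->
  facet t -> facet (relabel h @: t).
Proof.
move=> at_ aw ac /maxsetP[tK tmax]; apply/maxsetP; split; first by rewrite (relabel_face at_).
move=> t' t'K tt'; have att' : relabel h a \in t' by apply: (subsetP tt'); rewrite imset_f.
have t'E := relabel_set_inj t'; rewrite -t'E (tmax (relabel h @: t')) //.
  by rewrite (relabel_face att') ?wall_relabel ?central_relabel.
by rewrite -[t]relabel_set_inj imsetS.
Qed.

(** Relabelling the chambers changes neither positions nor shadows, so only the sphere sign is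
    reversed. *)
Lemma relabel_positive a s : wall a = w -> ~~ central a -> orders_facet glued (a :: s) ->
  glued_positive (map (relabel h) (a :: s)) = ~~ glued_positive (a :: s).
Proof.
move=> aw ac /andP[us fs]; have at_ : a \in [set x in a :: s] by rewrite !inE eqxx.
have [v [tv wF hv]] := glued_relabel at_ aw ac (maxsetp fs).
have fs' := relabel_facet at_ aw ac fs.
have tE : relabel h @: [set x in a :: s] = [set x in map (relabel h) (a :: s)].
  apply/setP => b; rewrite [RHS]inE; apply/imsetP/mapP => -[c]; rewrite ?inE => cs ->.
    by exists c; rewrite ?inE.
  by exists c; rewrite ?inE.
rewrite tE in fs' hv.
have us' : uniq (map (relabel h) (a :: s)) by rewrite map_inj_uniq //; exact: inv_inj relabelK.
have ee : enum (eta (a :: s)) =i eta (a :: s) by move=> d; rewrite mem_enum.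
have ee' : enum (eta (a :: s)) =i eta (map (relabel h) (a :: s)) by rewrite eta_relabel.
rewrite (glued_positiveE fs tv us (enum_uniq _) ee) (glued_positiveE fs' hv us' (enum_uniq _) ee').
rewrite frame_relabel; have [ca ma] := eta_facet fs tv us.
rewrite hS; first by case: (sg v _); case: (\det _ < 0).
- by rewrite /orders_facet enum_uniq (_ : [set x in _] = eta (a :: s)) //; apply/setP => d; rewrite inE ee.
- apply/subsetP => d dw; rewrite mem_enum; apply/etaP; exists a; rewrite ?inE ?eqxx //.
  by apply: (subsetP (wall_shadow ac)); rewrite aw.
Qed.

Lemma relabel_anti a : [set a] \in glued -> wall a = w -> ~~ central a ->
  [set relabel h a] \in glued /\
  anti_isomorphic (@olink glued_oriented a) (@olink glued_oriented (relabel h a)).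
Proof.
move=> aK aw ac; split; first by rewrite -imset_set1 (relabel_face (set11 a)).
have lk b (t : {set gvert}) : wall b = w -> ~~ central b -> t \in link glued b ->
    relabel h @: t \in link glued (relabel h b).
  move=> bw bc; rewrite [t \in _]inE [_ \in link _ _]inE => /andP[bt btK].
  rewrite mem_imset ?bt; last exact: inv_inj relabelK.
  by rewrite -imsetU1 (relabel_face (a := b)) // setU11.
apply: (@oiso_sign_of_maps true (@olink glued_oriented a) (@olink glued_oriented (relabel h a))
  (relabel h) (relabel h)) => /=.
- by move=> t; exact: lk.
- move=> t; rewrite -{2}[a](relabelK a); apply: lk; by rewrite ?wall_relabel ?central_relabel.
- by move=> b _; rewrite relabelK.
- by move=> b _; rewrite relabelK.
move=> s; rewrite orders_facet_link => Fs; exact: relabel_positive.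
Qed.

End Relabel.

Hypothesis sgPhi0 : forall v e, sg (Phi set0 v) e = sg v e.

(* No chain contains set0, so the bit of set0 is constant on orb C v: crossing
   set0, which changes nothing else, makes partner fixed point free. *)
Definition partner_map a : V -> V :=
  match a with inl _ => Phi (wall a) | inr _ => fun v => Phi set0 (Phi (wall a) v) end.
Definition partner a : gvert := relabel (partner_map a) a.

Lemma comparable_PhiC w w' v : comparable_sets w' w -> Phi w (Phi w' v) = Phi w' (Phi w v).
Proof. by move=> /orP[/PhiC->|/PhiC->]. Qed.

Lemma set0_PhiC w v : Phi set0 (Phi w v) = Phi w (Phi set0 v).
Proof. by apply: PhiC; exact: sub0set. Qed.

Lemma partner_mapK a : involutive (partner_map a).
Proof. by case: a => p v /=; rewrite ?PhiK // set0_PhiC !PhiK. Qed.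

Lemma partner_map_relabel h a : partner_map (relabel h a) = partner_map a.
Proof. by case: a. Qed.

Lemma partnerK : involutive partner.
Proof. move=> a; rewrite /partner partner_map_relabel; apply: relabelK; exact: partner_mapK. Qed.

Lemma partner_mapC a w' v : comparable_sets w' (wall a) -> partner_map a (Phi w' v) = Phi w' (partner_map a v).
Proof.
move=> cw; case: a cw => p cw; first exact: comparable_PhiC.
rewrite /partner_map (comparable_PhiC _ cw); exact: set0_PhiC.
Qed.

Lemma F_Phi0 v r : (r \in F (Phi set0 v)) = (r \in F v).
Proof. by apply: FPhi; [case: (FC v) | exact: sub0set]. Qed.

Lemma partner_mapF a v r : wall a \in F v -> wall a \subset r -> (r \in F (partner_map a v)) = (r \in F v).
Proof. by case: a => p wF wr; rewrite /partner_map ?F_Phi0; exact: FPhi. Qed.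

Lemma partner_mapS a v e : wall a != set0 -> orders_facet (F v) e -> wall a \subset e ->
  sg (partner_map a v) e = ~~ sg v e.
Proof. by case: a => p w0 Fe we; rewrite /partner_map ?sgPhi0; exact: sgPhi. Qed.

Lemma wall_vertex_neq0 a : [set a] \in glued -> ~~ central a -> wall a != set0.
Proof.
move=> /gluedP[v /imsetP[s0 s0K aE]]; have : a \in local_vertex v @: s0 by rewrite -aE inE.
by move=> /imsetP[z zs ->] ac; have [] := wall_comparable s0K zs ac.
Qed.

Lemma partner_anti a : [set a] \in glued -> ~~ central a ->
  [set partner a] \in glued /\
  anti_isomorphic (@olink glued_oriented a) (@olink glued_oriented (partner a)).
Proof.
move=> aK ac; have w0 := wall_vertex_neq0 aK ac; apply: (relabel_anti (w := wall a)) => //.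
- exact: partner_mapK.
- by move=> w' v; exact: partner_mapC.
- by move=> v r; exact: partner_mapF.
- by move=> v e; exact: partner_mapS.
Qed.

Lemma central_partner a : central (partner a) = central a.
Proof. exact: central_relabel. Qed.

Lemma partner_neq a : [set a] \in glued -> ~~ central a -> partner a != a.
Proof.
move=> aK ac; have w0 := wall_vertex_neq0 aK ac; move: aK.
move=> /gluedP[v /imsetP[s0 s0K aE]]; have : a \in local_vertex v @: s0 by rewrite -aE inE.
case/imsetP=> -[c|C] zs aE'; have [wF _ iw ow] : 
    [/\ wall a \in F v, wall a != set0, comparable_sets (inner s0) (wall a)
    & forall D w', D \in outer s0 -> w' \in D -> comparable_sets w' (wall a)].
- by rewrite aE'; apply: wall_comparable; rewrite -?aE'.
- rewrite aE' /partner /=; apply/eqP => -[vE]; have := BPhi [set c] v [set c].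
  by rewrite vE eqxx /=; case: (_ \in _).
- by rewrite aE'; apply: wall_comparable; rewrite -?aE'.
have pE : partner a = inr (orb C (partner_map a v), C).
  rewrite /partner {2}aE' /= (orb_relabel (w := wall a)) //.
  - exact: partner_mapK.
  - by move=> w' v'; exact: partner_mapC.
  - by move=> w'; apply: ow; rewrite inE.
have /chamberP[_ sC _ _] := s0K; have [H1 _] := chainsP _ _ sC.
have C0 : set0 \notin C.
  apply/negP => s0C; have Co : C \in outer s0 :\ set0.
    by rewrite in_setD1 inE zs andbT; apply/set0Pn; exists set0.
  by have [/chainsP[/(_ _ s0C)[_]]] := H1 C Co; rewrite eqxx.
apply/negP; rewrite pE {2}aE' => /eqP[/(orb_eqP PhiK) vO].
have := orb_bits BPhi C0 vO.
have aE2 : partner_map a v = Phi set0 (Phi (wall a) v) by rewrite aE'.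
rewrite aE2 !BPhi eqxx [set0 == _]eq_sym (negPf w0) /=; by case: (_ \in _).
Qed.

End Orientation.

Lemma olink_coherent (X : ocomplex) (v : carrier X) : coherent X -> coherent (olink v).
Proof.
move=> [perm_sign wall_sign]; split=> [m t p|a b s ab] /=.
  rewrite orders_facet_link => Ft.
  have -> : v :: [tuple tnth t (p i) | i < m] =
      [tuple tnth [tuple of v :: t] (lift_perm ord0 ord0 p i) | i < m.+1] :> seq _.
    have -> : v :: [tuple tnth t (p i) | i < m] = [tuple of v :: [tuple tnth t (p i) | i < m]] by [].
    congr (tval _); apply: eq_from_tnth => i; rewrite [RHS]tnth_mktuple.
    case: (unliftP ord0 i) => [j ->|->]; last by rewrite lift_perm_id.
    by rewrite lift_perm_lift !tnthS tnth_mktuple.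
  by rewrite perm_sign // odd_lift_perm.
rewrite !orders_facet_link => Fa Fb.
(* Coherence compares facets that differ in their first vertex, so [v] is exchanged with the vertex
   after it, at the cost of one sign on either side. *)
have swap c : orders_facet (faces X) [:: v, c & s] ->
    orders_facet (faces X) [:: c, v & s] /\ positive X [:: c, v & s] = ~~ positive X [:: v, c & s].
  move=> Fc; have [u Fs] := andP Fc.
  have vc : v != c by move: u; rewrite /= inE negb_or -andbA => /andP[].
  have sE : [:: c, v & s] = [tuple tnth [tuple of [:: v, c & in_tuple s]] (tperm ord0 (lift ord0 ord0) i) | i < (size s).+2] :> seq _.
    have -> : [:: c, v & s] = [tuple of [:: c, v & in_tuple s]] by [].
    congr (tval _); apply: eq_from_tnth => i; rewrite [RHS]tnth_mktuple.
    case: (unliftP ord0 i) => [j ->|->]; last by rewrite tpermL tnthS.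
    case: (unliftP ord0 j) => [k ->|->]; last by rewrite tpermR.
    by rewrite tpermD // !tnthS.
  split; last by rewrite sE perm_sign // odd_tperm.
  rewrite /orders_facet; have -> : [set x in [:: c, v & s]] = [set x in [:: v, c & s]].
    by apply/setP => x; rewrite !inE orbCA.
  rewrite Fs andbT; move: u; rewrite /= !inE !negb_or [c == v]eq_sym.
  by case/andP=> /andP[-> ->] /andP[-> ->].
have [Fa' aE] := swap _ Fa; have [Fb' bE] := swap _ Fb.
by rewrite -[LHS]negbK -[RHS]negbK -aE -bE (wall_sign _ _ _ ab Fa' Fb').
Qed.

Lemma vertex_face (T : finType) (K : {set {set T}}) (s : {set T}) :
  is_complex K -> s \in K -> exists s' : {set vertex K}, s = val @: s'.
Proof.
move=> KC sK; exists [set u | val u \in s]; apply/setP => x; apply/idP/imsetP => [xs|[u + ->]]; last by rewrite inE.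
have xK : [set x] \in K by apply: (face_sub KC sK); rewrite sub1set.
by exists (exist _ x xK); rewrite ?inE.
Qed.

Lemma vertex_seq (T : finType) (K : {set {set T}}) (s : seq T) :
  is_complex K -> [set x in s] \in K -> exists s' : seq (vertex K), s = map val s'.
Proof.
move=> KC; elim: s => [|x s IH] sK; first by exists [::].
have [|s' sE] := IH.
  by apply: (face_sub KC sK); apply/subsetP => y; rewrite !inE => ->; rewrite orbT.
have xK : [set x] \in K by apply: (face_sub KC sK); rewrite sub1set !inE eqxx.
by exists (exist _ x xK :: s'); rewrite sE.
Qed.

(** * Coloured spheres *)

Section Recolor.
Variables (Z : ocomplex) (X : finType) (e : overtex Z -> X).
Hypotheses (ZC : is_complex (faces Z)) (e_inj : injective e).

Let ofaces : {set {set overtex Z}} := [set s : {set overtex Z} | val @: s \in faces Z].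

Definition recolor_faces : {set {set X}} := [set e @: s | s : {set overtex Z} in ofaces].

(** [e] has no inverse on all of [X], so the vertices coloured by [s] are quantified; injectivity of
    [e] makes them unique. *)
Definition recolor_sign (s : seq X) : bool :=
  [exists t : (size s).-tuple (overtex Z), (map e t == s) && positive Z (map val t)].

Definition recolor := OComplex recolor_faces recolor_sign.

Let ofaces_complex : is_complex ofaces.
Proof.
split; first by rewrite inE imset0; case: ZC.
by move=> s t; rewrite !inE => sK ts; apply: (face_sub ZC sK); exact: imsetS.
Qed.

Lemma recolor_complex : is_complex recolor_faces.
Proof. exact: imset_complex ofaces_complex. Qed.

Lemma recolor_face (s : {set overtex Z}) : (e @: s \in recolor_faces) = (val @: s \in faces Z).
Proof.
apply/imsetP/idP => [[s' + /(imset_inj e_inj)->]|sK]; first by rewrite inE.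
by exists s; rewrite ?inE.
Qed.

Lemma recolor_signE (t : seq (overtex Z)) : recolor_sign (map e t) = positive Z (map val t).
Proof.
apply/existsP/idP => [[t' /andP[/eqP/(inj_map e_inj)->]//]|pt].
have st : size t == size (map e t) by rewrite size_map.
by exists (Tuple st); rewrite /= eqxx.
Qed.

Lemma recolor_facet (t : seq (overtex Z)) :
  orders_facet recolor_faces (map e t) = orders_facet (faces Z) (map val t).
Proof.
have sE (T : finType) (f : overtex Z -> T) : [set x in map f t] = f @: [set x in t].
  apply/setP => x; rewrite inE; apply/mapP/imsetP => -[u ut ->]; exists u => //; rewrite ?inE // in ut *.
rewrite /orders_facet !sE !map_inj_uniq //.
congr (_ && _); apply/maxsetP/maxsetP => -[tK tmax]; split.
- by rewrite -recolor_face.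
- move=> s sK; have [s' sE'] := vertex_face ZC sK; rewrite sE' in sK *.
  move=> /subsetP ts; have : e @: [set x in t] \subset e @: s'.
    apply/subsetP => _ /imsetP[u ut ->]; apply: imset_f.
    by have := ts _ (imset_f val ut); rewrite mem_imset //; exact: val_inj.
  by move/tmax; rewrite recolor_face => /(_ sK)/(imset_inj e_inj)->.
- by rewrite recolor_face.
move=> _ /imsetP[s + ->]; rewrite inE => sK /subsetP ts.
have : val @: [set x in t] \subset val @: s.
  apply/subsetP => _ /imsetP[u ut ->]; apply: imset_f.
  by have := ts _ (imset_f e ut); rewrite mem_imset.
by move/tmax => /(_ sK)/(imset_inj val_inj)->.
Qed.

Lemma recolor_facetP s : orders_facet recolor_faces s ->
  exists2 t, s = map e t & orders_facet (faces Z) (map val t).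
Proof.
move=> Fs; have /andP[_ /maxsetp/imsetP[t0 _ sE]] := Fs.
suff [t tE] : exists t, s = map e t by exists t; rewrite // -recolor_facet -tE.
have sub x : x \in s -> exists u, x = e u.
  move=> xs; have : x \in [set x in s] by rewrite inE.
  by rewrite sE => /imsetP[u _ ->]; exists u.
elim: (s) sub => [|x s' IH] sub; first by exists [::].
have [u xu] := sub x (mem_head _ _).
have [|t tE] := IH; first by move=> y ys; apply: sub; rewrite inE ys orbT.
by exists (u :: t); rewrite /= -xu -tE.
Qed.

Lemma recolor_coherent : coherent Z -> coherent recolor.
Proof.
move=> [Zp Zw]; split=> /= [m t p Ft|x y s xy Fx Fy].
  have [t0 tE Ft0] := recolor_facetP Ft.
  have st0 : size t0 == m by rewrite -(size_tuple t) tE size_map.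
  have tE' : t = [tuple of map e (Tuple st0)] by apply: val_inj; rewrite /= tE.
  have -> : [tuple tnth t (p i) | i < m] = map e [tuple tnth (Tuple st0) (p i) | i < m] :> seq _.
    have -> : map e [tuple tnth (Tuple st0) (p i) | i < m] = [tuple of map e [tuple tnth (Tuple st0) (p i) | i < m]] by [].
    congr (tval _); apply: eq_from_tnth => i.
    by rewrite [RHS]tnth_map !tnth_mktuple tE' tnth_map.
  rewrite tE' /= !recolor_signE.
  have <- : [tuple tnth [tuple of map val (Tuple st0)] (p i) | i < m] = map val [tuple tnth (Tuple st0) (p i) | i < m] :> seq _.
    have -> : map val [tuple tnth (Tuple st0) (p i) | i < m] = [tuple of map val [tuple tnth (Tuple st0) (p i) | i < m]] by [].
    congr (tval _); apply: eq_from_tnth => i.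
    by rewrite [RHS]tnth_map !tnth_mktuple tnth_map.
  exact: (Zp _ [tuple of map val (Tuple st0)]).
have [[|u t] //= [xu sE] Fu] := recolor_facetP Fx.
have [[|u' t'] //= [yu sE'] Fu'] := recolor_facetP Fy.
have tt' : t' = t by apply: (inj_map e_inj); rewrite -sE -sE'.
rewrite tt' in Fu'; rewrite xu yu sE -!map_cons !recolor_signE /=; apply: Zw Fu Fu'.
by apply: contra xy => /eqP/val_inj uu; rewrite xu yu uu.
Qed.

Lemma recolor_isomorphic : isomorphic recolor Z.
Proof.
have fE (c : overtex recolor) : exists u, e u = val c.
  case: c => c /= /imsetP[s _ cE]; have : c \in e @: s by rewrite -cE inE.
  by case/imsetP=> u _ ->; exists u.
have gE (u : overtex Z) : [set e u] \in recolor_faces.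
  by rewrite -imset_set1 recolor_face imset_set1; exact: valP u.
have /choice[f fP] := fE.
have valf (s : {set overtex recolor}) : val @: s = e @: (f @: s).
  by rewrite -imset_comp; apply: eq_imset => c /=; rewrite fP.
exists f, (fun u => exist _ (e u) (gE u)); split.
- by move=> s; rewrite valf recolor_face.
- move=> s sK; have -> : val @: [set (exist _ (e u) (gE u) : overtex recolor) | u in s] = e @: s.
    by rewrite -imset_comp.
  by rewrite /= recolor_face.
- by move=> c; apply: val_inj; rewrite /= fP.
- by move=> u; apply: e_inj; rewrite fP.
move=> s _; have -> : map val s = map e (map f s) by rewrite -map_comp; apply: eq_map => c /=; rewrite fP.
by rewrite /= recolor_signE.
Qed.

Lemma recolor_iso (R : realType) (V : finType) (P : {ffun V -> R} -> Prop) :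
  iso (@cone R _ (faces Z)) P -> iso (@cone R _ recolor_faces) P.
Proof.
have [g1 /isof_sym H1] := push_iso R e_inj ofaces_complex.
have [g2 H2] := push_iso R (@val_inj _ _ (overtex Z)) ofaces_complex.
apply: iso_trans; have -> : faces Z = [set val @: s | s : {set overtex Z} in ofaces].
  apply/setP => s; apply/idP/imsetP => [sK|[s' + ->]]; last by rewrite inE.
  by have [s' sE] := vertex_face ZC sK; exists s'; rewrite // inE -sE.
exact: iso_trans (ex_intro _ _ (ex_intro _ _ H1)) (ex_intro _ _ (ex_intro _ _ H2)).
Qed.

End Recolor.

(** Correcting by a transposition extends the permutation by one value at a time. It is applied to
    the bijection between two stars, which is defined on some of the colours only. *)
Lemma perm_extends (T : finType) (S : {set T}) (f : T -> T) :
  {in S &, injective f} -> exists p : {perm T}, {in S, p =1 f}.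
Proof.
have [n] := ubnP #|S|; elim: n S => // n IH S lt fS.
have [->|[x xS]] := set_0Vmem S; first by exists 1%g => y; rewrite inE.
have [||p pf] := IH (S :\ x); first by move: lt; rewrite (cardsD1 x) xS.
  by move=> y z /setD1P[_ yS] /setD1P[_ zS]; exact: fS.
exists (p * tperm (p x) (f x))%g => y yS; rewrite permM.
have [->|yx] := eqVneq y x; first by rewrite tpermL.
have py : p y = f y by apply: pf; rewrite !inE yx.
rewrite tpermD //; first by rewrite (inj_eq perm_inj) eq_sym.
by rewrite py; apply: contra yx => /eqP/fS->.
Qed.

Section Star.
Variables (Z : ocomplex) (X : finType) (e : overtex Z -> X) (v : overtex Z).
Hypotheses (ZC : is_complex (faces Z)) (e_inj : injective e).

Lemma link_vertex_face (u : overtex (olink (val v))) : [set val u] \in faces Z.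
Proof.
have := valP u; rewrite /= inE => /andP[_ uK]; apply: (face_sub ZC uK); exact: subsetUr.
Qed.

Definition star_color (u : overtex (olink (val v))) : X := e (exist _ (val u) (link_vertex_face u)).

Lemma star_color_inj : injective star_color.
Proof. by move=> u u' /e_inj/(congr1 val) /= /val_inj. Qed.

Lemma star_color_neq u : star_color u != e v.
Proof.
rewrite (inj_eq e_inj); apply/eqP => /(congr1 val) /= uv.
have := valP u; rewrite /= inE => /andP[]; by rewrite uv inE eqxx.
Qed.

Lemma star_colorE (s : {set overtex (olink (val v))}) :
  exists2 s' : {set overtex Z}, e v |: star_color @: s = e @: s' & val @: s' = val v |: val @: s.
Proof.
exists (v |: [set (exist _ (val u) (link_vertex_face u) : overtex Z) | u in s]);
  by rewrite imsetU1 -imset_comp.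
Qed.

Lemma star_face (s : {set overtex (olink (val v))}) :
  val @: s \in link (faces Z) (val v) -> e v |: star_color @: s \in recolor_faces e.
Proof.
have [s' -> s'E] := star_colorE s.
by rewrite recolor_face // s'E inE => /andP[].
Qed.

Lemma star_faceP (q : {set X}) : e v \in q -> q \in recolor_faces e ->
  exists2 s : {set overtex (olink (val v))}, val @: s \in link (faces Z) (val v) & q = e v |: star_color @: s.
Proof.
move=> vq /imsetP[s0]; rewrite inE => s0K qE; rewrite {}qE in vq *.
have vs0 : v \in s0 by rewrite mem_imset in vq.
have tK : (val @: s0) :\ val v \in link (faces Z) (val v).
  by rewrite inE !inE eqxx /= setD1K // imset_f.
have LC : is_complex (link (faces Z) (val v)) by apply: link_complex (valP v).
have [s sE] := vertex_face LC tK; exists s; first by rewrite -sE.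
have [s' -> s'E] := star_colorE s; suff -> : s0 = s' by []; apply: (imset_inj val_inj).
by rewrite s'E -sE setD1K // imset_f.
Qed.

Lemma star_sign (t : seq (overtex (olink (val v)))) :
  recolor_sign e (e v :: map star_color t) = positive Z (val v :: map val t).
Proof.
have -> : e v :: map star_color t = map e (v :: [seq (exist _ (val u) (link_vertex_face u) : overtex Z) | u <- t]).
  by rewrite /= -map_comp.
by rewrite recolor_signE //= -map_comp.
Qed.

Lemma star_facetP s : orders_facet (recolor_faces e) (e v :: s) ->
  exists2 t, s = map star_color t & orders_facet (link (faces Z) (val v)) (map val t).
Proof.
move=> /(recolor_facetP ZC e_inj)[[|u t] //= [/e_inj <- sE]]; rewrite -orders_facet_link => Ft.
have LC : is_complex (link (faces Z) (val v)) by apply: link_complex (valP v).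
have [t' tE] := vertex_seq LC (maxsetp (andP Ft).2).
exists t'; last by rewrite -tE.
rewrite sE; have -> : t = [seq (exist _ (val u) (link_vertex_face u) : overtex Z) | u <- t'].
  by apply: (inj_map val_inj); rewrite tE -map_comp.
by rewrite -map_comp.
Qed.

End Star.

Section StarFlip.
Variables (Z Z' : ocomplex) (X : finType) (e : overtex Z -> X) (e' : overtex Z' -> X).
Hypotheses (ZC : is_complex (faces Z)) (ZC' : is_complex (faces Z'))
  (e_inj : injective e) (e_inj' : injective e').

(** The anti-isomorphism of links, with [e v] sent to [e' v'], matches the two stars. Extended to a
    permutation of all colours, it lets the second sphere be repainted so that corresponding faces
    get equal colours. *)
Lemma star_flip (v : overtex Z) (v' : overtex Z') :
  anti_isomorphic (vertex_link v) (vertex_link v') ->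
  exists p : {perm X}, [/\ p (e v) = e' v',
    forall q : {set X}, e v \in q -> (q \in recolor_faces e) = (p @: q \in recolor_faces e')
    & forall s, orders_facet (recolor_faces e) (e v :: s) ->
        recolor_sign e' (map p (e v :: s)) = ~~ recolor_sign e (e v :: s)].
Proof.
move=> [f [g [fS gS gf fg pos]]].
pose c := @star_color Z X e v ZC; pose c' := @star_color Z' X e' v' ZC'.
have cI : injective c by exact: star_color_inj.
have cI' : injective c' by exact: star_color_inj.
pose phi x := if x == e v then e' v' else if [pick u | c u == x] is Some u then c' (f u) else x.
have phic u : phi (c u) = c' (f u).
  rewrite /phi (negPf (star_color_neq ZC e_inj u)); case: pickP => [u' /eqP/cI->//|/(_ u)].
  by rewrite eqxx.
have phiv : phi (e v) = e' v' by rewrite /phi eqxx.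
have [p pE] : exists p : {perm X}, {in e v |: c @: setT, p =1 phi}.
  apply: perm_extends => x y /setU1P[->|/imsetP[u _ ->]] /setU1P[->|/imsetP[u' _ ->]] //.
  - by rewrite phiv phic => /esym/eqP; rewrite (negPf (star_color_neq ZC' e_inj' _)).
  - by rewrite phiv phic => /eqP; rewrite (negPf (star_color_neq ZC' e_inj' _)).
  - by rewrite !phic => /cI'/(can_inj gf)->.
have pv : p (e v) = e' v' by rewrite pE ?setU11.
have pc u : p (c u) = c' (f u) by rewrite pE ?phic // in_setU1 imset_f ?orbT.
have ps (s : {set overtex (olink (val v))}) : p @: (e v |: c @: s) = e' v' |: c' @: (f @: s).
  by rewrite imsetU1 pv -!imset_comp; congr (_ |: _); apply: eq_imset => u /=; exact: pc.
exists p; split=> // [q vq|s].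
  apply/idP/idP => [qK|qK].
    have [s sK ->] := star_faceP ZC e_inj vq qK.
    by rewrite ps; apply: star_face => //; exact: fS sK.
  have v'q : e' v' \in p @: q by rewrite -pv imset_f.
  have [s sK qE] := star_faceP ZC' e_inj' v'q qK.
  suff -> : q = e v |: c @: (g @: s) by apply: star_face => //; exact: gS sK.
  apply: (imset_inj (@perm_inj _ p)); rewrite ps qE; suff -> : f @: (g @: s) = s by [].
  by rewrite -imset_comp -[RHS]imset_id; apply: eq_imset => u /=; rewrite fg.
move=> Fs; have [t sE Ft] := star_facetP ZC e_inj Fs.
have -> : map p (e v :: s) = e' v' :: map c' (map f t).
  by rewrite /= pv sE -!map_comp; congr (_ :: _); apply: eq_map => u /=; exact: pc.
rewrite sE (star_sign ZC e_inj) (star_sign ZC' e_inj'); exact: pos t Ft.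
Qed.

End StarFlip.

(** A facet containing [x] can be reordered to begin with [x], and the reordering costs the same
    sign in [X] and in [X']. *)
Lemma sign_of_first (b : bool) (X X' : ocomplex) (f : carrier X -> carrier X') (x : carrier X) :
  coherent X -> coherent X' ->
  (forall s, orders_facet (faces X) s -> x \in s -> orders_facet (faces X') (map f s)) ->
  (forall s, orders_facet (faces X) (x :: s) -> positive X' (map f (x :: s)) = b (+) positive X (x :: s)) ->
  forall s, orders_facet (faces X) s -> x \in s -> positive X' (map f s) = b (+) positive X s.
Proof.
move=> [Xp _] [Xp' _] fF fx s Fs xs; have sp := perm_to_rem xs.
have ss : size (x :: rem x s) == size s by rewrite (perm_size sp).
have /tuple_permP[p pE] : perm_eq (in_tuple s) (Tuple ss) by [].
have Fx : orders_facet (faces X) (x :: rem x s).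
  move: Fs; rewrite /orders_facet (perm_uniq sp); congr (_ && maxset _ _).
  by apply/setP => y; rewrite !in_set (perm_mem sp).
have -> : map f s = [tuple tnth [tuple of map f (Tuple ss)] (p i) | i < size s].
  have -> : map f s = map f (in_tuple s) by [].
  rewrite pE; have -> : map f [tuple tnth (Tuple ss) (p i) | i < size s] = [tuple of map f [tuple tnth (Tuple ss) (p i) | i < size s]] by [].
  congr (tval _); apply: eq_from_tnth => i.
  by rewrite [RHS]tnth_mktuple !tnth_map tnth_ord_tuple.
have Fx' : orders_facet (faces X') (map f (x :: rem x s)) by apply: fF Fx (mem_head _ _).
have sE : positive X s = odd_perm p (+) positive X (x :: rem x s).
  exact: etrans (congr1 (positive X) pE) (Xp _ (Tuple ss) p Fx).
rewrite sE (Xp' _ [tuple of map f (Tuple ss)] p Fx') -[LHS]/(_ (+) positive X' (map f (x :: rem x s))) fx //.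
by rewrite addbCA.
Qed.

(** * Crossing walls *)

Section Walls.
Variables (A X : finType) (F : A -> {set {set X}}) (sg : A -> seq X -> bool).
Hypothesis FC : forall a, is_complex (F a).
Implicit Types (a b : A) (w r : {set X}).

Definition flips w a b : Prop :=
  (forall r, w \subset r -> (r \in F b) = (r \in F a)) /\
  (forall e, orders_facet (F a) e -> w \subset e -> sg b e = ~~ sg a e).

Lemma flips_facet w a b e : (forall r, w \subset r -> (r \in F b) = (r \in F a)) ->
  w \subset e -> orders_facet (F a) e -> orders_facet (F b) e.
Proof.
move=> FF we /andP[ue /maxsetP[eK emax]]; rewrite /orders_facet ue /=.
have we' : w \subset [set x in e] by apply/subsetP => x xw; rewrite inE (subsetP we).
apply/maxsetP; split=> [|s]; first by rewrite FF.
by move=> sK es; apply: emax => //; rewrite -FF // (subset_trans we').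
Qed.

Local Notation family := {ffun {set X} -> {ffun A -> A}}.

(** The involutions act on all of [A], also where [w] is not a face. The third clause keeps [w] from
    appearing or disappearing, so that the faces containing [w] are preserved in every case. *)
Definition wall_family (L : family) : Prop :=
  [/\ forall w, involutive (L w), L set0 =1 id,
      forall w a, (w \in F (L w a)) = (w \in F a)
    & forall w a, w != set0 -> w \in F a -> flips w a (L w a)].

Definition reflect_family w (L : family) : family :=
  [ffun r : {set X} => if w \proper r then [ffun a => L w (L r (L w a))] else L r].

Lemma wall_family_face L w a r : wall_family L -> w \subset r -> (r \in F (L w a)) = (r \in F a).
Proof.
move=> [_ L0 LF Lf] wr; have [->|w0] := eqVneq w set0; first by rewrite L0.
have [wF|wF] := boolP (w \in F a); first by have [->] := Lf w a w0 wF.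
have nF b : w \notin F b -> (r \in F b) = false.
  by move=> wb; apply/negP => rF; case/negP: wb; exact: (face_sub (FC b) rF wr).
by rewrite !nF // LF.
Qed.

Lemma wall_family_facet L w a e : wall_family L -> w \subset e ->
  orders_facet (F a) e -> orders_facet (F (L w a)) e.
Proof. by move=> Lv we; apply: flips_facet we => r; exact: wall_family_face. Qed.

(** Conjugation by a nonempty wall reverses the orientation three times, hence once; conjugation by
    [set0] changes nothing. *)
Lemma reflect_wall_family w L : wall_family L -> wall_family (reflect_family w L).
Proof.
move=> Lv; have [LK L0 LF Lf] := Lv; split=> [r a|a|r a|r a r0 rF]; rewrite ffunE.
- by case: ifP => wr; rewrite ?ffunE ?LK.
- by rewrite properE sub0set andbF.
- case: ifP => [/proper_sub wr|_]; last exact: LF.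
  by rewrite ffunE (wall_family_face _ Lv wr) LF (wall_family_face _ Lv wr).
case: ifP => [/proper_sub wr|_]; last exact: Lf.
have H a' e : orders_facet (F a') e -> w \subset e -> w \in F a' -> w != set0 -> sg (L w a') e = ~~ sg a' e.
  by move=> Fe we wF w0; have [_] := Lf w a' w0 wF; apply.
rewrite ffunE; split=> [q rq|e Fe re].
  have wq := subset_trans wr rq.
  by rewrite (wall_family_face _ Lv wq) (wall_family_face _ Lv rq) (wall_family_face _ Lv wq).
have we : w \subset e by apply: subset_trans wr re.
have rF1 : r \in F (L w a) by rewrite wall_family_face.
have F1 := wall_family_facet Lv we Fe; have F2 := wall_family_facet Lv re F1.
have [_ /(_ e F1 re) s2] := Lf r (L w a) r0 rF1.
have [w0|w0] := eqVneq w set0; first by move: s2; rewrite w0 !L0.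
have wF : w \in F a by exact: (face_sub (FC _) rF wr).
have wF2 : w \in F (L r (L w a)) by apply: (face_sub (FC _) _ wr); rewrite LF.
by rewrite (H _ _ F2 we) // s2 (H _ _ Fe we) //; case: (sg a e).
Qed.

Definition family_ok := {L : family | `[< wall_family L >]}.
Definition chamber_label : finType := (A * family_ok * {set {set X}})%type.
Implicit Types v : chamber_label.

Lemma family_okP (L : family_ok) : wall_family (val L).
Proof. by case: L => L /= /asboolP. Qed.

Definition reflect_ok w (L : family_ok) : family_ok :=
  exist _ (reflect_family w (val L)) (introT (asboolP _) (reflect_wall_family w (family_okP L))).

Definition toggle w (C : {set {set X}}) : {set {set X}} := [set u | (u == w) (+) (u \in C)].

(* Conjugating the involutions of the larger walls makes the crossings of
   comparable walls commute; the bits make these crossings act freely. *)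
Definition cross w v : chamber_label :=
  (val v.1.2 w v.1.1, reflect_ok w v.1.2, toggle w v.2).

Lemma crossK w : involutive (cross w).
Proof.
case=> [[a L] C]; have [LK _ _ _] := family_okP L; congr (_, _, _); rewrite /=.
- by rewrite ffunE properxx LK.
- apply: val_inj; apply/ffunP => r /=; rewrite !ffunE properxx.
  by case: (w \proper r) => //; apply/ffunP => b; rewrite !ffunE !LK.
- by apply/setP => u; rewrite !inE addbA addbb.
Qed.

(** Crossing [w'] leaves the involution of a smaller [w] untouched. After crossing [w], the wall
    [w'] carries L w L w' L w, which takes [L w a] to [L w (L w' a)]: both orders lead to the same
    sphere. *)
Lemma crossC w w' v : w \subset w' -> cross w (cross w' v) = cross w' (cross w v).
Proof.
case: v => [[a L] C]; have [LK _ _ _] := family_okP L.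
have [->//|ww'] := eqVneq w w' => sub.
have pw : w \proper w' by rewrite properEneq ww'.
have npw : (w' \proper w) = false by apply/negbTE; rewrite properE sub andbF.
congr (_, _, _); rewrite /=.
- by rewrite !ffunE npw pw !ffunE LK.
- apply: val_inj; apply/ffunP => r /=; rewrite !ffunE npw pw.
  have [w'r|w'r] := boolP (w' \proper r).
    by rewrite (sub_proper_trans sub w'r); apply/ffunP => b; rewrite !ffunE !LK.
  by case: ifP.
- by apply/setP => u; rewrite !inE addbCA.
Qed.

Lemma cross_bit w v u : (u \in (cross w v).2) = (u == w) (+) (u \in v.2).
Proof. by rewrite inE. Qed.

Lemma cross_face w v r : w \subset r -> (r \in F (cross w v).1.1) = (r \in F v.1.1).
Proof. exact: wall_family_face (family_okP _). Qed.

Lemma cross_sign w v e : w != set0 -> orders_facet (F v.1.1) e -> w \subset e ->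
  sg (cross w v).1.1 e = ~~ sg v.1.1 e.
Proof.
case: v => [[a L] C] /= w0 Fe we; have [_ _ _ Lf] := family_okP L.
have /andP[_ /maxsetp eK] := Fe.
have wF : w \in F a.
  by apply: (face_sub (FC a) eK); apply/subsetP => x xw; rewrite inE (subsetP we).
by have [_ ->] := Lf w a w0 wF.
Qed.

Lemma cross0_sign v e : sg (cross set0 v).1.1 e = sg v.1.1 e.
Proof. by have [_ L0 _ _] := family_okP v.1.2; rewrite /= L0. Qed.

(** A face containing [w] contains each vertex of [w], so the involution of one chosen vertex serves
    the whole wall. *)
Lemma wall_family_exists (tau : X -> A -> A) : (forall c, involutive (tau c)) ->
  (forall c a, ([set c] \in F (tau c a)) = ([set c] \in F a)) ->
  (forall c a, [set c] \in F a -> flips [set c] a (tau c a)) -> family_ok.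
Proof.
move=> tauK tauF tauS.
pose L : family := [ffun w : {set X} => [ffun a => if [pick c in w] is Some c then tau c a else a]].
exists L; apply/asboolP; split=> [w a|a|w a|w a]; rewrite !ffunE.
- by case: pickP => //= c _; rewrite tauK.
- by case: pickP => // c; rewrite inE.
- case: pickP => // c cw; have cs : [set c] \subset w by rewrite sub1set.
  have [cF|cF] := boolP ([set c] \in F a); first by have [->] := tauS c a cF.
  have nF b : [set c] \notin F b -> (w \in F b) = false.
    by move=> cb; apply/negP => wF; case/negP: cb; exact: (face_sub (FC b) wF cs).
  by rewrite !nF // tauF.
case: pickP => [c cw _ wF|w0 /set0Pn[c]]; last by have := w0 c; move=> /= ->.
have cs : [set c] \subset w by rewrite sub1set.
have [FF SS] := tauS c a (face_sub (FC a) wF cs); split=> [r wr|e Fe we].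
  by apply: FF; exact: subset_trans cs wr.
by apply: SS => //; exact: subset_trans cs we.
Qed.

End Walls.

(** * The chambers of a balanced set of spheres *)

Section PermutedColors.
Variables (Z : ocomplex) (X : finType) (e : overtex Z -> X) (p : {perm X}).
Hypotheses (ZC : is_complex (faces Z)) (e_inj : injective e).

Lemma recolor_perm_face (q : {set X}) :
  (p @: q \in recolor_faces (fun u => p (e u))) = (q \in recolor_faces e).
Proof.
apply/imsetP/imsetP => -[s sK qE]; exists s => //; last by rewrite qE -imset_comp.
by apply: (imset_inj (@perm_inj _ p)); rewrite qE -imset_comp.
Qed.

Lemma recolor_perm_facet s : orders_facet (recolor_faces (fun u => p (e u))) s ->
  exists2 s0, s = map p s0 & orders_facet (recolor_faces e) s0.
Proof.
have pe_inj : injective (fun u => p (e u)) by move=> u u' /perm_inj/e_inj.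
move=> /(recolor_facetP ZC pe_inj)[t -> Ft]; exists (map e t); first by rewrite -map_comp.
by rewrite recolor_facet.
Qed.

Lemma recolor_perm_sign s : orders_facet (recolor_faces e) s ->
  recolor_sign (fun u => p (e u)) (map p s) = recolor_sign e s.
Proof.
have pe_inj : injective (fun u => p (e u)) by move=> u u' /perm_inj/e_inj.
move=> /(recolor_facetP ZC e_inj)[t -> _]; rewrite recolor_signE // -map_comp.
exact: (recolor_signE pe_inj).
Qed.

End PermutedColors.

Lemma orders_facet_image (T T' : finType) (K : {set {set T}}) (K' : {set {set T'}}) (p : T -> T') (x : T) s :
  bijective p -> (forall q : {set T}, x \in q -> (q \in K) = (p @: q \in K')) ->
  x \in s -> orders_facet K s -> orders_facet K' (map p s).
Proof.
move=> pb pK xs /andP[us /maxsetP[sK smax]]; have p_inj := bij_inj pb.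
have sE : [set y in map p s] = p @: [set y in s].
  apply/setP => y; rewrite inE; apply/mapP/imsetP => -[z zs ->]; exists z; rewrite ?inE // in zs *.
have xs' : x \in [set y in s] by rewrite inE.
rewrite /orders_facet map_inj_uniq // us sE /=; apply/maxsetP; split; first by rewrite -pK.
move=> t tK st; have [p' p'K pp'] := pb.
have tE : t = p @: (p' @: t).
  by rewrite -imset_comp -[LHS]imset_id; apply: eq_imset => y /=; rewrite pp'.
rewrite tE in tK st *; rewrite (smax (p' @: t)) //.
  by rewrite pK // -(mem_imset _ _ p_inj); apply: (subsetP st); exact: imset_f.
apply/subsetP => y ys; rewrite -(mem_imset _ _ p_inj); apply: (subsetP st); exact: imset_f.
Qed.

Section Colors.
Variables (R : realType) (n k : nat) (Y : 'I_k -> ocomplex).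
Hypotheses (YC : forall i, is_complex (faces (Y i))) (Yco : forall i, coherent (Y i)).

Definition color : finType := {i : 'I_k & overtex (Y i)}.
Definition tint i (u : overtex (Y i)) : color := Tagged (fun i => overtex (Y i)) u.
Arguments tint : clear implicits.

Lemma tint_inj i : injective (tint i).
Proof. by move=> u u'; exact: eq_from_Tagged. Qed.

Local Notation tinted i := (recolor (tint i)).

Definition folds (x y : color) (p : {perm color}) : Prop :=
  [/\ p x = y,
    forall q : {set color}, x \in q -> (q \in faces (tinted (tag x))) = (p @: q \in faces (tinted (tag y)))
    & forall s, orders_facet (faces (tinted (tag x))) s -> x \in s ->
        positive (tinted (tag y)) (map p s) = ~~ positive (tinted (tag x)) s].

Lemma folds_facet x y p s : folds x y p -> x \in s -> orders_facet (faces (tinted (tag x))) s ->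
  orders_facet (faces (tinted (tag y))) (map p s).
Proof. move=> [_ pK _]; apply: orders_facet_image pK; exists (p^-1)%g; [exact: permK | exact: permKV]. Qed.

Lemma folds_sym x y p : folds x y p -> folds y x (p^-1)%g.
Proof.
move=> H; have [px pK pS] := H.
have Fp s : y \in s -> orders_facet (faces (tinted (tag y))) s ->
    x \in map (p^-1)%g s /\ orders_facet (faces (tinted (tag x))) (map (p^-1)%g s).
  move=> ys Fs; split; first by rewrite -[x](permK p) px map_f.
  apply: (orders_facet_image (K := faces (tinted (tag y))) (x := y)) => // [|q yq].
    by exists p; [exact: permKV | exact: permK].
  rewrite pK; last by rewrite -[x](permK p) px imset_f.
  by rewrite -imset_comp (eq_imset (g := id)) ?imset_id // => z /=; rewrite permKV.
have pE s : map p (map (p^-1)%g s) = s by rewrite -map_comp map_id_in // => z _ /=; rewrite permKV.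
split; first by rewrite -px permK.
  move=> q yq; rewrite [RHS]pK; last by rewrite -[x](permK p) px imset_f.
  by rewrite -imset_comp (eq_imset (g := id)) ?imset_id // => z /=; rewrite permKV.
move=> s Fs ys; have [xs Fs'] := Fp s ys Fs.
by rewrite -{2}[s]pE pS // negbK.
Qed.

Lemma folds_exists (x y : color) : anti_isomorphic (union_link x) (union_link y) -> exists p, folds x y p.
Proof.
case: x => i v; case: y => j v' /= H.
have [p [pv pK pS]] := star_flip (YC i) (YC j) (@tint_inj i) (@tint_inj j) H.
exists p; split=> // s Fs xs.
have co i' : coherent (tinted i') by apply: recolor_coherent => //; exact: tint_inj.
apply: (@sign_of_first true (tinted i) (tinted j) p (tint i v)) => // s' Fs' xs'.
apply: orders_facet_image pK _ Fs' => //; exists (p^-1)%g; [exact: permK | exact: permKV].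
Qed.

End Colors.

Section PaintedSpheres.
Variables (n k : nat) (Y : 'I_k -> ocomplex) (tau : union_vertex Y -> union_vertex Y).
Hypotheses (YC : forall i, is_complex (faces (Y i))) (Yco : forall i, coherent (Y i))
  (tauK : involutive tau) (tauN : forall x, tau x <> x)
  (tauA : forall x, anti_isomorphic (union_link x) (union_link (tau x))).

Local Notation color := (color Y).

(* All recolourings occur, so that crossing a wall can preserve the colours of
   the faces containing it. *)
Definition painted : finType := ('I_k * {perm color})%type.
Implicit Type a : painted.

Definition paint a (u : overtex (Y a.1)) : color := a.2 (tint u).
Definition painted_faces a := recolor_faces (@paint a).
Definition painted_sign a := recolor_sign (@paint a).

Lemma paint_inj a : injective (@paint a).
Proof. by move=> u u' /perm_inj/tint_inj. Qed.

Lemma painted_complex a : is_complex (painted_faces a).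
Proof. exact: recolor_complex. Qed.

Lemma painted_vertex a c : ([set c] \in painted_faces a) = (tag ((a.2^-1)%g c) == a.1).
Proof.
apply/imsetP/eqP => [[s _ cE]|xa].
  have : c \in (@paint a) @: s by rewrite -cE inE.
  by case/imsetP=> u _ ->; rewrite /paint permK.
case xE : ((a.2^-1)%g c) xa => [i u] /= ia; case: a ia xE => j q /= ia; subst j => xE.
exists [set u]; last by rewrite imset_set1 /paint /tint /Tagged /= -xE permKV.
by rewrite inE imset_set1; exact: valP u.
Qed.

(** Making the folds of a pair inverse to each other is what turns [repaint] into an involution. *)
Definition fold_family (psi : color -> {perm color}) :=
  (forall x, folds x (tau x) (psi x)) /\ forall x, psi (tau x) = ((psi x)^-1)%g.

Lemma fold_family_exists : exists psi, fold_family psi.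
Proof.
have /choice[psi0 psi0P] : forall x : color, exists p, folds x (tau x : color) p.
  by move=> x; apply: folds_exists (tauA x).
pose rank (x : color) := enum_rank x : nat.
(* In each pair a fold is chosen at the colour of smaller rank and its inverse is used at the
   other. *)
exists (fun x => if (rank x < rank (tau x))%N then psi0 x else (psi0 (tau x))^-1)%g; split=> x.
  by case: ifP => // _; apply: folds_sym; rewrite -{2}[x]tauK.
have neq : rank x != rank (tau x).
  apply/eqP => /val_inj/enum_rank_inj/esym; exact: tauN.
by rewrite tauK; case: ltngtP neq => // _ _; rewrite ?invgK.
Qed.

(** [x] is the vertex painted [c]. Its star is folded onto that of [tau x], and the new painting is
    the inverse fold followed by the old painting, so that corresponding vertices keep their
    colours. *)
Definition repaint psi (c : color) a : painted :=
  let x := (a.2^-1)%g c in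
  if tag x == a.1 then (tag (tau x), ((psi x)^-1 * a.2)%g) else a.

Section Repaint.
Variable psi : color -> {perm color}.
Hypothesis psiP : fold_family psi.

Lemma repaint_origin c a : let x := (a.2^-1)%g c in tag x = a.1 ->
  repaint psi c a = (tag (tau x), ((psi x)^-1 * a.2)%g) /\ ((repaint psi c a).2^-1)%g c = tau x.
Proof.
move=> x /eqP xa; rewrite /repaint -/x xa /=; split=> //.
by rewrite fingroup.invMg invgK permM -/x; have [/(_ x)[]] := psiP.
Qed.

Lemma repaintK c : involutive (repaint psi c).
Proof.
move=> a; have [xa|xa] := eqVneq (tag ((a.2^-1)%g c)) a.1; last first.
  by rewrite [repaint psi c a]/repaint (negPf xa) /repaint (negPf xa).
have [aE cE] := repaint_origin xa; rewrite {1}/repaint cE [in X in _ == X]aE eqxx tauK xa.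
have [_ ->] := psiP; rewrite invgK aE /= mulgA mulgV mul1g; by case: (a).
Qed.

Lemma repaint_vertex c a : ([set c] \in painted_faces (repaint psi c a)) = ([set c] \in painted_faces a).
Proof.
have [xa|xa] := eqVneq (tag ((a.2^-1)%g c)) a.1; last by rewrite /repaint (negPf xa).
have [aE cE] := repaint_origin xa; rewrite !painted_vertex xa eqxx cE aE /=; exact: eqxx.
Qed.

Lemma repaint_flips c a : [set c] \in painted_faces a ->
  flips painted_faces painted_sign [set c] a (repaint psi c a).
Proof.
rewrite painted_vertex => /eqP xa; have [-> _] := repaint_origin xa.
case: a xa => i q /=; set x := (q^-1)%g c => xa; subst i.
have [/(_ x)[px pK pS] _] := psiP; set p := psi x in px pK pS *.
have bE (u : color) : q u = ((p^-1 * q)%g (p u)) by rewrite permM permK.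
have cx : c = q x by rewrite /x permKV.
have setE (r : {set color}) : r = q @: ((q^-1)%g @: r).
  by rewrite -imset_comp -[LHS]imset_id; apply: eq_imset => z /=; rewrite permKV.
have qE (r : {set color}) : q @: r = (p^-1 * q)%g @: (p @: r).
  by rewrite -imset_comp; apply: eq_imset => z /=; exact: bE.
have sqE (s : seq color) : map q s = map (p^-1 * q)%g (map p s).
  by rewrite -map_comp; apply: eq_map => z /=; exact: bE.
split=> [r|s].
  rewrite sub1set => cr; rewrite (setE r) {1}qE /painted_faces.
  rewrite [LHS]recolor_perm_face [RHS]recolor_perm_face -pK //.
  by rewrite /x imset_f.
move=> /(recolor_perm_facet (YC _) (@tint_inj _ _ _))[s0 -> Fs0] cs.
have xs0 : x \in s0.
  have : c \in map q s0 by apply: (subsetP cs); rewrite inE.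
  by rewrite cx (mem_map (@perm_inj _ q)).
have Fs1 := folds_facet (And3 px pK pS) xs0 Fs0.
rewrite {1}sqE /painted_sign [LHS](recolor_perm_sign _ (YC _) (@tint_inj _ _ _) Fs1).
rewrite (recolor_perm_sign _ (YC _) (@tint_inj _ _ _) Fs0); exact: pS Fs0 xs0.
Qed.

End Repaint.

Lemma painted_family_ok : family_ok painted_faces painted_sign.
Proof.
have [psi psiP] := cid fold_family_exists.
apply: (wall_family_exists painted_complex (tau := repaint psi)).
- exact: repaintK.
- exact: repaint_vertex.
- exact: repaint_flips.
Qed.

End PaintedSpheres.

(** * Pairing the links *)

Lemma isomorphic_facet (X Y : ocomplex) (f : overtex X -> overtex Y) (g : overtex Y -> overtex X) s :
  is_complex (faces Y) -> simplicial f -> simplicial g -> cancel f g -> cancel g f ->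
  orders_facet (faces X) (map val s) -> orders_facet (faces Y) (map val (map f s)).
Proof.
move=> YC fS gS gf fg; have f_inj := can_inj gf.
have sE (T S : finType) (h : T -> S) (t : seq T) : [set x in map h t] = h @: [set x in t].
  by apply/setP => x; rewrite inE; apply/mapP/imsetP => -[u ut ->]; exists u; rewrite ?inE // in ut *.
rewrite /orders_facet !map_inj_uniq ?sE // => /andP[-> /maxsetP[sK smax]].
apply/maxsetP; split=> [|t tK]; first exact: fS.
have [t' tE] := vertex_face YC tK; rewrite tE in tK * => st.
have tfg : t' = f @: (g @: t').
  by rewrite -imset_comp -[LHS]imset_id; apply: eq_imset => u /=; rewrite fg.
have sub : [set x in s] \subset g @: t'.
  apply/subsetP => u us; rewrite -(mem_imset _ _ f_inj) -tfg -(mem_imset _ _ (@val_inj _ _ (overtex Y))).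
  by apply: (subsetP st); rewrite !imset_f.
have := smax (val @: (g @: t')) (gS _ tK) => /(_ (imsetS _ sub)).
by move/(imset_inj val_inj) => ts; rewrite tfg ts.
Qed.

Lemma isomorphic_trans (X Y Z : ocomplex) : is_complex (faces Y) ->
  isomorphic X Y -> isomorphic Y Z -> isomorphic X Z.
Proof.
move=> YC [f [g [fS gS gf fg fp]]] [f' [g' [fS' gS' gf' fg' fp']]].
exists (f' \o f), (g \o g'); split.
- by move=> s sK; rewrite (imset_comp f' f); exact: fS' _ (fS _ sK).
- by move=> s sK; rewrite (imset_comp g g'); exact: gS _ (gS' _ sK).
- exact: can_comp.
- exact: can_comp.
by move=> s Fs; rewrite map_comp fp' ?fp //; exact: (isomorphic_facet YC fS gS gf fg Fs).
Qed.

Lemma isomorphic_refl (X : ocomplex) : isomorphic X X.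
Proof. by exists id, id; split=> // s; rewrite ?imset_id // map_id. Qed.

Lemma anti_isomorphic_oopp (X Y : ocomplex) : anti_isomorphic X Y -> isomorphic X (oopp Y).
Proof.
move=> [f [g [fS gS gf fg fp]]]; exists f, g; split=> // s Fs.
by rewrite /= fp //= negbK.
Qed.

Lemma inj_surj_bij (S T : finType) (f : S -> T) : injective f -> (forall y, exists x, f x = y) -> bijective f.
Proof.
move=> f_inj /choice[g gP]; exists g => [x|//]; apply: f_inj; exact: gP.
Qed.

Section PairedLinks.
Variables (K : ocomplex) (C : finType) (ctr : C -> overtex K) (th : overtex K -> overtex K).
Hypotheses (ctr_inj : injective ctr) (thK : involutive th)
  (th_pair : forall x, x \notin codom ctr -> [/\ th x \notin codom ctr, th x != x
     & anti_isomorphic (vertex_link x) (vertex_link (th x))]).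

Lemma paired_links (k : nat) (Y : 'I_k -> ocomplex) (r : nat) (c : 'I_k * 'I_r -> C) :
  bijective c -> (forall p, isomorphic (vertex_link (ctr (c p))) (Y p.1)) ->
  exists l (z : 'I_l -> overtex K),
    same_up_to_iso (@vertex_link K) (@repeat_with_pairs k r l Y (fun j => vertex_link (z j))).
Proof.
move=> cb ctrY; pose rank (x : overtex K) : nat := enum_rank x.
(* Each pair is represented by its vertex of smaller rank; the other one supplies the link with
   reversed orientation. *)
pose P := [set x : overtex K | (x \notin codom ctr) && (rank x < rank (th x))%N].
pose z (j : 'I_#|P|) : overtex K := enum_val j; exists #|P|, z.
have zP j : z j \notin codom ctr /\ (rank (z j) < rank (th (z j)))%N.
  by have := enum_valP j; rewrite inE => /andP.
pose g (x : 'I_k * 'I_r + ('I_#|P| + 'I_#|P|)) : overtex K :=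
  match x with inl p => ctr (c p) | inr (inl j) => z j | inr (inr j) => th (z j) end.
have ctrz p j : ctr (c p) <> z j by move=> E; have [] := zP j; rewrite -E codom_f.
have ctrt p j : ctr (c p) <> th (z j).
  by move=> E; have [/th_pair[]] := zP j; rewrite -E codom_f.
have zt i j : z i <> th (z j).
  move=> E; have [_] := zP i; have [_] := zP j; rewrite E thK => l1 l2.
  by have := ltn_trans l1 l2; rewrite ltnn.
have g_bij : bijective g.
  apply: inj_surj_bij => [|x].
    move=> [p|[i|i]] [q|[j|j]] //=; try by [move/ctrz|move/ctrt|move/zt|move/esym/ctrz|move/esym/ctrt|move/esym/zt].
    - by move/ctr_inj/(bij_inj cb) ->.
    - by move/enum_val_inj ->.
    - by move/(inv_inj thK)/enum_val_inj ->.
  have [/codomP[y ->]|xc] := boolP (x \in codom ctr).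
    by have [c' _ cc'] := cb; exists (inl (c' y)); rewrite /= cc'.
  have [tc tx _] := th_pair xc.
  have [xP|xP] := boolP (x \in P); first by exists (inr (inl (enum_rank_in xP x))); rewrite /= /z enum_rankK_in.
  have tP : th x \in P.
    rewrite inE tc thK; move: xP; rewrite inE xc /= -leqNgt leq_eqVlt => /orP[/eqP/val_inj/enum_rank_inj E|//].
    by rewrite E eqxx in tx.
  by exists (inr (inr (enum_rank_in tP (th x)))); rewrite /= /z enum_rankK_in // thK.
have [f gf fg] := g_bij; exists f; first by exists g.
move=> x; rewrite -{1}[x]fg; case: (f x) => [[i q]|[j|j]] /=; first exact: (ctrY (i, q)).
  exact: isomorphic_refl.
apply: anti_isomorphic_oopp; have [/th_pair[tz _ _] _] := zP j.
by have [_ _] := th_pair tz; rewrite thK.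
Qed.

End PairedLinks.

(** * The manifold of a balanced set of spheres *)

Section Realization.
Variables (R : realType) (n k : nat) (Y : 'I_k -> ocomplex).
Hypotheses (n0 : (0 < n)%N) (hY : forall i : 'I_k, oriented_sphere_pred R n (Y i))
  (hbal : balanced Y) (i0 : 'I_k).

Let YC i : is_complex (faces (Y i)).
Proof. by case: (hY i) => -[]. Qed.

Let Yco i : coherent (Y i).
Proof. by case: (hY i). Qed.

Let Ysphere i : iso (@cone R _ (faces (Y i))) (@all_vec R 'I_n).
Proof. by have [/comb_sphere_iso[]] := hY i. Qed.

Local Notation F := (@painted_faces k Y).
Local Notation sg := (@painted_sign k Y).
Local Notation label := (chamber_label F sg).

Let FC a : is_complex (F a).
Proof. exact: painted_complex. Qed.

Lemma painted_ok : family_ok F sg.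
Proof. by have [tau [tauK tauN tauA]] := cid hbal; exact: (painted_family_ok YC Yco tauK tauN tauA). Qed.

Let v0 : label := ((i0, 1%g), painted_ok, set0).

Local Notation Phi := (@cross _ _ F sg FC).
Local Notation Fv := (fun v : label => F v.1.1).
Local Notation sgv := (fun v : label => sg v.1.1).
Local Notation K := (glued_oriented R Fv Phi sgv n).

Let FCv (v : label) : is_complex (Fv v).
Proof. exact: FC. Qed.

Let FS (v : label) : iso (@cone R _ (Fv v)) (@all_vec R 'I_n).
Proof. by apply: recolor_iso => //; exact: paint_inj. Qed.

Let sgC (v : label) : coherent (OComplex (Fv v) (sgv v)).
Proof. by apply: recolor_coherent => //; exact: paint_inj. Qed.

Let PhiK w : involutive (Phi w). Proof. exact: crossK. Qed.
Let PhiC (w w' : {set color Y}) (v : label) : w \subset w' -> Phi w (Phi w' v) = Phi w' (Phi w v).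
Proof. exact: crossC. Qed.
Let BPhi (w : {set color Y}) (v : label) u : (u \in (Phi w v).2) = (u == w) (+) (u \in v.2).
Proof. exact: cross_bit. Qed.
Let FPhi (w : {set color Y}) (v : label) (r : {set color Y}) : w \in Fv v -> w \subset r -> (r \in Fv (Phi w v)) = (r \in Fv v).
Proof. by move=> _; exact: cross_face. Qed.
Let sgPhi (w : {set color Y}) (v : label) (s : seq (color Y)) : w != set0 -> orders_facet (Fv v) s -> w \subset s ->
  sgv (Phi w v) s = ~~ sgv v s.
Proof. exact: cross_sign. Qed.
Let sgPhi0 (v : label) s : sgv (Phi set0 v) s = sgv v s.
Proof. exact: cross0_sign. Qed.

Lemma realization : exists (K : ocomplex) (r l : nat) (Z : 'I_l -> ocomplex),
  [/\ oriented_manifold R n K, (0 < r)%N, forall j : 'I_l, oriented_sphere_pred R n (Z j)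
    & same_up_to_iso (@vertex_link K) (@repeat_with_pairs k r l Y Z)].
Proof.
have Kman : oriented_manifold R n K by exact: (glued_manifold (B := fun v : label => v.2) v0).
have [[KC KL] Kco] := Kman.
pose ctr (v : label) : overtex K := exist _ (center Phi v) (center_vertex (F := Fv) Phi FCv v).
have ctr_inj : injective ctr by move=> v v' /(congr1 val)/center_inj.
(* [partner] as a map on vertices, the identity at centres. At a non-central vertex the outer
   default is not reached, since [partner_anti] makes the partner a vertex. *)
pose th (x : overtex K) : overtex K :=
  if insub (partner Phi (val x)) is Some y then if central (val x) then x else y else x.
(* A label without the index of its sphere. These data range over the same set for every [Y i], so
   its cardinality is [r]. *)
pose T : finType := ({perm color Y} * family_ok F sg * {set {set color Y}})%type.
pose c (p : 'I_k * 'I_#|T|) : label := ((p.1, (enum_val p.2).1.1), (enum_val p.2).1.2, (enum_val p.2).2).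
have cb : bijective c.
  exists (fun v : label => (v.1.1.1, enum_rank (v.1.1.2, v.1.2, v.2))) => [[i q]|[[[i p] L] C]].
    rewrite /c /= -[RHS]/(i, q); congr (_, _).
    by rewrite -[RHS]enum_valK; case: (enum_val q) => [[? ?] ?].
  by rewrite /c /= enum_rankK.
have centr (x : overtex K) : central (val x) = (x \in codom ctr).
  apply/idP/codomP => [cx|[v ->]]; last by rewrite /= eqxx.
  by have [v vE] := centralP (valP x) cx; exists v; apply: val_inj.
have anti x := partner_anti (B := fun v : label => v.2) v0 PhiK PhiC BPhi FPhi FCv FS sgC sgPhi sgPhi0 x.
have thE (x : overtex K) : ~~ central (val x) -> val (th x) = partner Phi (val x).
  move=> nx; have [pK _] := anti (val x) (valP x) nx.
  by rewrite /th insubT (negPf nx).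
have thC (x : overtex K) : central (val x) -> th x = x.
  by move=> cx; rewrite /th cx; case: insubP.
have thK : involutive th.
  move=> x; have [cx|nx] := boolP (central (val x)); first by rewrite !thC.
  apply: val_inj; rewrite thE thE ?central_partner //.
  exact: partnerK.
have [|p|l [z same]] := @paired_links K _ ctr th ctr_inj thK _ k Y #|T| c cb.
- move=> x xn; have nx : ~~ central (val x) by rewrite centr.
  have [_ ax] := anti (val x) (valP x) nx; split.
  + by rewrite -centr thE // central_partner.
  + have := partner_neq (B := fun v : label => v.2) PhiK PhiC BPhi FCv (valP x) nx.
    by rewrite -(thE x nx); apply: contra => /eqP ->.
  + by rewrite /vertex_link thE.
- rewrite /vertex_link /=.
  have H1 := center_isomorphic (B := fun v : label => v.2) v0 PhiK PhiC BPhi FPhi FCv FS sgC n0 (c p).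
  apply: (isomorphic_trans _ H1); first exact: FCv.
  exact: (recolor_isomorphic (@paint_inj _ _ _)).
exists K, #|T|, l, (fun j => vertex_link (z j)); split=> //.
  by apply/card_gt0P; exists (1%g, painted_ok, set0).
move=> j; split; first exact: KL.
exact: olink_coherent.
Qed.

End Realization.

Definition empty_ocomplex : ocomplex :=
  @OComplex void [set (set0 : {set void})] (fun _ => true).

Lemma empty_manifold (R : realType) (n : nat) : oriented_manifold R n empty_ocomplex.
Proof.
split; first by split=> [|[[]]]; split=> [|s t]; rewrite !inE // => /eqP->; rewrite subset0.
split=> [[|m] t p _|[]]; last by case: (tnth t ord0).
by rewrite (_ : p = 1%g) ?odd_perm1 //; apply/permP => -[].
Qed.

Local Close Scope ring_scope.

Theorem theorem1p1 (R : realType) (n k : nat) (hn : 1 <= n)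
  (Y : 'I_k -> ocomplex)
  (hY : forall i : 'I_k, oriented_sphere_pred R n (Y i))
  (hbal : balanced Y) :
  exists (K : ocomplex) (r l : nat) (Z : 'I_l -> ocomplex),
    [/\ oriented_manifold R n K,
        0 < r,
        forall j : 'I_l, oriented_sphere_pred R n (Z j)
      & same_up_to_iso (@vertex_link K) (@repeat_with_pairs k r l Y Z)].
Proof.
(* A chamber needs an index of a sphere. For k = 0 the empty manifold, with r = 1 and no pairs, has
   the required empty set of links. *)
case: k Y hY hbal => [|k] Y hY hbal; last exact: realization hn hY hbal ord0.
exists empty_ocomplex, 1, 0, (fun=> empty_ocomplex); split=> // [|[]//|].
  exact: empty_manifold.
exists (fun x : overtex empty_ocomplex => match val x with end) => [|[[]]].
by apply: inj_surj_bij => [[[]]|[[[? ?] ?]|[[? ?]|[? ?]]]].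
Qed.
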